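(* Let $\Omega\subset\mathbb{R}^2$ be a compact convex set of positive measure. Let $l\subset\mathbb{R}^2$ be a straight line through the origin, let $v_l$ be a unit vector orthogonal to $l$, and let $H=\{a_k\}_{k\in\mathbb{Z}}\subset\mathbb{R}$ be a uniformly discrete set. Put $$P=l+Hv_l:=\bigcup_{k\in\mathbb{Z}}(l+a_kv_l).$$ Then $P$ is a sampling set for the Bernstein space $\mathcal{B}_\Omega$ if and only if $$D^-(H)\,v_l\notin\Omega-\Omega.$$
   Context: Fourier transform: $\hat f(y)=\int_{\mathbb{R}^d}e^{-2\pi i\langle y,x\rangle}f(x)\,dx$. For a compact set $\Omega\subset\mathbb{R}^d$, the Bernstein space $\mathcal{B}_\Omega$ consists of all continuous bounded functions on $\mathbb{R}^d$ which are inverse Fourier transforms of tempered distributions supported by $\Omega$, with the uniform norm $\|\cdot\|_\infty$. A set $P\subset\mathbb{R}^d$ is a sampling set for $\mathcal{B}_\Omega$ if there is a constant $C>0$ such that $\|f\|_\infty\le C\sup_{x\in P}|f(x)|$ for every $f\in\mathcal{B}_\Omega$. A set $\Lambda\subset\mathbb{R}^d$ is uniformly discrete if $\inf_{\lambda,\lambda'\in\Lambda,\ \lambda\neq\lambda'}|\lambda-\lambda'|>0$. Its lower uniform density is $$D^-(\Lambda)=\lim_{r\to\infty}\inf_{x\in\mathbb{R}^d}\frac{\#(\Lambda\cap B_r(x))}{|B_r(x)|},$$ where $B_r(x)$ is the closed ball of radius $r$ centered at $x$ and $|\cdot|$ of a set is Lebesgue measure in $\mathbb{R}^d$. (For $H$,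 $d=1$.) Notation: $\Omega-\Omega=\{x-y:x,y\in\Omega\}$. *)

(* Defs.v *)
(* The Euclidean plane is [R * R] with [R : realType], its
   Lebesgue measure is the product measure [lebesgue2], and complex-valued
   functions take values in [R[i]]. *)
From HB Require Import structures.
From mathcomp Require Import all_boot all_order all_algebra.
From mathcomp Require Import all_classical all_reals all_analysis.
From mathcomp Require Import complex.

Set Implicit Arguments.
Unset Strict Implicit.
Unset Printing Implicit Defensive.

Import Order.TTheory GRing.Theory Num.Theory.
Import numFieldTopology.Exports numFieldNormedType.Exports.

Local Open Scope classical_set_scope.
Local Open Scope ring_scope.
Local Open Scope complex_scope.

Definition dot {R : realType} (x y : R * R) : R := x.1 * y.1 + x.2 * y.2.

(* The norm [`|x|] provided by the library on [R * R] is the maximum norm. *)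
Definition enorm {R : realType} (x : R * R) : R := Num.sqrt (dot x x).

(* The norm [`|z|] of [z : R[i]] lives in [R[i]]; [cabs z] is the same number
   as an element of [R]. *)
Definition cabs {R : realType} (z : R[i]) : R := ComplexField.Normc.normc z.

Definition lebesgue2 {R : realType} : set (R * R) -> \bar R :=
  (@lebesgue_measure R \x @lebesgue_measure R)%E.

Definition cintegral {R : realType} (g : R * R -> R[i]) : R[i] :=
  (\int[(@lebesgue_measure R \x @lebesgue_measure R)%E]_x complex.Re (g x))
  +i* (\int[(@lebesgue_measure R \x @lebesgue_measure R)%E]_x complex.Im (g x)).

Definition cis {R : realType} (t : R) : R[i] := cos t +i* sin t.

(* (F^-1 phi)(y) = \int e^{2 pi i <y, x>} phi(x) dx. *)
Definition inv_fourier {R : realType} (phi : R * R -> R[i]) (y : R * R) : R[i] :=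
  cintegral (fun x => cis (2 * pi * dot y x) * phi x).

Definition e1 {R : realType} : R * R := (1, 0).
Definition e2 {R : realType} : R * R := (0, 1).

Fixpoint Ck {R : realType} (k : nat) (g : R * R -> R) : Prop :=
  continuous g /\
  if k is k'.+1 then
    [/\ forall x, derivable g x e1, forall x, derivable g x e2,
        Ck k' ('D_e1 g) & Ck k' ('D_e2 g)]
  else True.

(* [R[i]] carries no normed module structure over [R] in the library, so
   differentiation of complex-valued functions is done componentwise. *)
Definition csmooth {R : realType} (phi : R * R -> R[i]) : Prop :=
  forall k, Ck k (fun x => complex.Re (phi x)) /\
            Ck k (fun x => complex.Im (phi x)).

Definition mixed_partial {R : realType} (a b : nat) (g : R * R -> R) : R * R -> R :=
  iter a (fun h => 'D_e1 h) (iter b (fun h => 'D_e2 h) g).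

Definition cpartial {R : realType} (a b : nat) (phi : R * R -> R[i])
    (x : R * R) : R[i] :=
  mixed_partial a b (fun y => complex.Re (phi y)) x
  +i* mixed_partial a b (fun y => complex.Im (phi y)) x.

(* All the Schwartz seminorms sup_x |x^(m,n) d^(a,b) phi(x)| with indices at
   most [N] are at most [M]. *)
Definition seminorms_le {R : realType} (N : nat) (M : R) (phi : R * R -> R[i]) :=
  forall m n a b x, (m <= N)%N -> (n <= N)%N -> (a <= N)%N -> (b <= N)%N ->
    `|x.1| ^+ m * `|x.2| ^+ n * cabs (cpartial a b phi x) <= M.

Definition schwartz {R : realType} (phi : R * R -> R[i]) : Prop :=
  csmooth phi /\ forall N, exists M, seminorms_le N M phi.

Definition supp {R : realType} (phi : R * R -> R[i]) : set (R * R) :=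
  closure [set x | phi x != 0].

(* A tempered distribution is a functional on Schwartz functions which is
   complex linear and continuous for the topology defined by the Schwartz
   seminorms; its values outside the Schwartz space are irrelevant. *)
Definition tempered_distribution {R : realType} (T : (R * R -> R[i]) -> R[i]) :=
  (forall (c : R[i]) (phi psi : R * R -> R[i]), schwartz phi -> schwartz psi ->
     T (fun x => c * phi x + psi x) = c * T phi + T psi) /\
  (forall phi, schwartz phi -> forall e : R, 0 < e ->
     exists N, exists2 d : R, 0 < d & forall psi, schwartz psi ->
       seminorms_le N d (fun x => psi x - phi x) -> cabs (T psi - T phi) < e).

(* [T] is supported by the closed set [K]: it vanishes on the complement of [K],
   i.e. on every compactly supported smooth function with support off [K]. *)
Definition distr_supported_by {R : realType} (T : (R * R -> R[i]) -> R[i])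
    (K : set (R * R)) : Prop :=
  forall phi, csmooth phi -> compact (supp phi) -> supp phi `<=` ~` K ->
    T phi = 0.

(* The function [f] is F^-1 T, where <F^-1 T, phi> = <T, F^-1 phi>. *)
Definition is_inv_fourier_distr {R : realType} (f : R * R -> R[i])
    (T : (R * R -> R[i]) -> R[i]) : Prop :=
  forall phi, schwartz phi ->
    cintegral (fun x => f x * phi x) = T (inv_fourier phi).

Definition bernstein {R : realType} (Omega : set (R * R)) : set (R * R -> R[i]) :=
  [set f | [/\ continuous (f : R * R -> R[i]^o),
               exists M, forall x, cabs (f x) <= M &
               exists T, [/\ tempered_distribution T,
                             distr_supported_by T Omega &
                             is_inv_fourier_distr f T]]].

Definition supnorm_on {R : realType} (P : set (R * R)) (f : R * R -> R[i]) : R :=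
  sup [set cabs (f x) | x in P].

Definition sampling_set {R : realType} (Omega P : set (R * R)) : Prop :=
  exists2 K : R, 0 < K & forall f, bernstein Omega f ->
    supnorm_on setT f <= K * supnorm_on P f.

(* The infimum is taken in the extended reals so that it is +oo, hence positive,
   for sets with at most one point. *)
Definition uniformly_discrete {R : realType} (H : set R) : Prop :=
  (0 < ereal_inf [set (`|p.1 - p.2|)%:E | p in [set p : R * R |
          [/\ H p.1, H p.2 & p.1 != p.2]]])%E.

Definition lower_density {R : realType} (H : set R) : \bar R :=
  lim ((fun r : R => ereal_inf (range (fun x : R =>
          counting (H `&` closed_ball x r) / lebesgue_measure (closed_ball x r))))%E
       @ +oo).

Definition line_through_origin {R : realType} (l : set (R * R)) : Prop :=
  exists2 u : R * R, u != 0 & l = range (fun t : R => t *: u).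

Definition lines_translates {R : realType} (l : set (R * R)) (a : int -> R)
    (v : R * R) : set (R * R) :=
  \bigcup_(k in [set: int]) [set x + a k *: v | x in l].

Definition difference_set {R : realType} (Omega : set (R * R)) : set (R * R) :=
  [set x - y | x in Omega & y in Omega].

(* Main.v *)
Require Import Defs.
From HB Require Import structures.
From mathcomp Require Import all_boot all_order all_algebra.
From mathcomp Require Import all_classical all_reals all_analysis.
From mathcomp Require Import measurable_realfun complex ring lra.

(** Sampling on a family of parallel lines is a question about functions of one
    variable.  Let [H] be the set of the offsets of the lines and [D] its lower
    uniform density, which exists by superadditivity ([density_dichotomy]).

    Sufficiency.  If [D *: v] is not in the compact convex set [Omega - Omega],
    separating it from that set gives a direction [d] with [dot v d = 1] along
    which [Omega] has some width [W < D] ([strip_of_not_difference]).  The lines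
    meet every line of direction [d] in a translate of [H], and there is a
    length [r] such that every interval of length [r] contains [n > W * r]
    points of [H].  It remains to represent the value of [f] at a point of such
    a line by a combination of bounded mass of its values on [H], up to an error
    of at most a quarter of the supremum of [f].  The distribution of which [f]
    is the inverse Fourier transform is never restricted to a line:
    [mollified_annihilator] shows that a combination of point evaluations along
    [d] almost annihilates [f], up to a Gaussian mollification, as soon as its
    symbol and sufficiently many derivatives of the symbol are small on a
    neighbourhood of the projection of [Omega].  A Gaussian is needed because a
    distribution can only be tested on Schwartz functions.

    The combination is built in [sampling_functional], in the normalisation
    where the width is less than 1 and every interval of length [L] contains [L]
    points of [H].  The cardinal series with Fejer weights computes, for a
    function [F] with spectrum in a compact part of (-1/2, 1/2), the value
    [F y * pi / sin (pi * y)] from the terms [(-1)^k F(k) / (y - k)]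
    ([fejer_sampling]).  Multiply [F] by a rational function with zeros at the
    lattice points of a large window and simple poles at 0 and at equally many
    points of [H] in that window.  Its partial fraction decomposition turns the
    series into a combination of the values of [F] at 0 and at the chosen points
    of [H]; the lattice points of the window drop out, and a factor
    [sinc (a * t) ^+ M] makes the contribution of the other ones small, since the
    rational function grows only polynomially, at a rate independent of the
    window ([swap_ratio_far]).

    Necessity.  If [D *: v] is in [Omega - Omega], then [Omega] contains a chord
    of direction [v] and of length [w >= D] with [w > 0]; when [D = 0] this uses
    that a convex set of positive measure is not contained in a line.  Every
    function [G] with spectrum in [-w/2, w/2] yields the function
    [cis (2 * pi * dot p x) * G (dot v x)] of the Bernstein space
    ([bernstein_trig]), so it suffices to find such [G], of size at least 1/2 at
    some point and arbitrarily small on [H] ([small_on_critical]).  If the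
    spectrum may be slightly larger than the critical one, linear algebra gives
    a function that vanishes on [H] in a long interval with few points of [H]
    and that is small far away ([small_on_sparse]).  An average of dilates of it
    over many scales has its spectrum in [-w/2, w/2]: at a given point the
    dilation destroys the smallness only at a few scales, by a weak form of the
    Bernstein inequality ([trig_lipschitz]). *)

Set Implicit Arguments.
Unset Strict Implicit.
Unset Printing Implicit Defensive.

Import Order.TTheory GRing.Theory Num.Theory.
Import numFieldTopology.Exports numFieldNormedType.Exports.

Local Open Scope classical_set_scope.
Local Open Scope ring_scope.

(** * The Fourier transform of a Gaussian *)
Section gauss.
Context {R : realType}.
Notation mu := (@lebesgue_measure R).
Variable m : R.
Local Notation gs := (@normal_fun R m).

Lemma is_derive_normal_fun (s x : R) : s != 0 ->
  is_derive x 1 (gs s) (- (x - m) / s ^+ 2 * gs s x).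
Proof.
move=> s0; rewrite /normal_fun; apply: is_derive_eq.
by rewrite /GRing.scale/=; field.
Qed.

Lemma is_derive_cosl (c th x : R) :
  is_derive x 1 (fun x => cos (c * (x - m) + th)) (- sin (c * (x - m) + th) * c).
Proof. by apply: is_derive_eq; rewrite /GRing.scale/=; ring. Qed.

Lemma is_derive_sinl (c th x : R) :
  is_derive x 1 (fun x => sin (c * (x - m) + th)) (cos (c * (x - m) + th) * c).
Proof. by apply: is_derive_eq; rewrite /GRing.scale/=; ring. Qed.

Lemma is_derive_continuous (f g : R -> R) :
  (forall x : R, is_derive x 1 f (g x)) -> continuous f.
Proof.
move=> fg x; apply/differentiable_continuous/derivable1_diffP.
exact: (@ex_derive _ _ _ _ _ _ _ (fg x)).
Qed.

Lemma continuous_cosl (c th : R) : continuous (fun x : R => cos (c * (x - m) + th)).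
Proof. exact: (is_derive_continuous (is_derive_cosl c th)). Qed.

Lemma continuous_sinl (c th : R) : continuous (fun x : R => sin (c * (x - m) + th)).
Proof. exact: (is_derive_continuous (is_derive_sinl c th)). Qed.

Lemma norm_sin_le1 (x : R) : `|sin x| <= 1.
Proof. by rewrite ler_norml sin_geN1 sin_le1. Qed.

Lemma norm_cos_le1 (x : R) : `|cos x| <= 1.
Proof. by rewrite ler_norml cos_geN1 cos_le1. Qed.

Lemma normal_fun_le1 (s x : R) : gs s x <= 1.
Proof.
rewrite /normal_fun -expR0 ler_expR mulNr oppr_le0 divr_ge0 ?sqr_ge0//.
by rewrite mulrn_wge0// sqr_ge0.
Qed.

Lemma continuous_integrable_itv (f : R -> R) (a b : R) :
  continuous f -> mu.-integrable `[a, b] (EFin \o f).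
Proof.
move=> cf; apply: continuous_compact_integrable; first exact: segment_compact.
exact: continuous_subspaceT.
Qed.

Lemma Rintegral_FTC2 (f F : R -> R) (a b : R) : a < b -> continuous f ->
  (forall x : R, is_derive x 1 F (f x)) -> \int[mu]_(x in `[a, b]) f x = F b - F a.
Proof.
move=> ab cf dF; have cF := is_derive_continuous dF.
rewrite /Rintegral (@continuous_FTC2 _ f F)//.
- exact: continuous_subspaceT.
- split => //.
  + by apply: cvg_at_right_filter; exact: cF.
  + by apply: cvg_at_left_filter; exact: cF.
- by move=> x _; rewrite derive1E; exact: (@derive_val _ _ _ _ _ _ _ (dF x)).
Qed.

Section truncated.
Variables (s A : R).
Hypotheses (s0 : s != 0) (A0 : 0 < A).
Variable th : R.

Let K (xi : R) := \int[mu]_(x in `[m - A, m + A]) (gs s x * cos (xi * (x - m) + th)).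

Let continuous_gs : continuous (gs s).
Proof. exact: (is_derive_continuous (fun x : R => is_derive_normal_fun x s0)). Qed.

Let cgc xi : continuous (fun x : R => gs s x * cos (xi * (x - m) + th)).
Proof.
move=> x; apply: cvgM; first exact: continuous_gs.
exact: continuous_cosl.
Qed.

Let cgxs xi : continuous (fun x : R => (x - m) * gs s x * sin (xi * (x - m) + th)).
Proof.
move=> x; apply: cvgM; first by apply: cvgM; [by apply: cvgB; [exact: cvg_id|exact: cvg_cst]|exact: continuous_gs].
exact: continuous_sinl.
Qed.

Let derK (xi : R) : is_derive xi 1 K
  (- \int[mu]_(x in `[m - A, m + A]) ((x - m) * gs s x * sin (xi * (x - m) + th))).
Proof.
pose f (xi x : R) := gs s x * cos (xi * (x - m) + th).
have d1 (z x : R) : is_derive z 1 (f ^~ x) (- ((x - m) * gs s x * sin (z * (x - m) + th))).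
  apply: is_derive_eq; rewrite /GRing.scale/=; ring.
have d1E (z x : R) : (f ^~ x)^`()%classic z = - ((x - m) * gs s x * sin (z * (x - m) + th)).
  by rewrite derive1E; exact: (@derive_val _ _ _ _ _ _ _ (d1 z x)).
have mI : measurable (`[m - A, m + A]%classic : set (measurableTypeR R)).
  exact: measurable_itv.
have Ixi : `](xi - 1), (xi + 1)[%classic xi by rewrite /= in_itv/=; lra.
have intf (x : R) : `](xi - 1), (xi + 1)[%classic x ->
    mu.-integrable `[m - A, m + A] (EFin \o f x).
  by move=> _; apply: continuous_integrable_itv; exact: cgc.
have df (x y : R) : `](xi - 1), (xi + 1)[%classic x -> `[m - A, m + A]%classic y ->
    derivable (f ^~ y) x 1.
  by move=> _ _; have ? := d1 x y; exact: ex_derive.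
have intG : mu.-integrable `[m - A, m + A] (EFin \o (fun _ : R => A)).
  by apply: continuous_integrable_itv => ?; exact: cvg_cst.
have ub (x y : R) : `](xi - 1), (xi + 1)[%classic x -> `[m - A, m + A]%classic y ->
    `|partial1of2 f x y| <= A.
  move=> _ /=; rewrite in_itv/= => /andP[yA Ay].
  rewrite /partial1of2 d1E normrN !normrM -[leRHS]mulr1.
  apply: ler_pM => //; last exact: norm_sin_le1.
  rewrite -[leRHS]mulr1; apply: ler_pM => //; first by rewrite ler_norml; apply/andP; split; lra.
  by rewrite ger0_norm ?normal_fun_ge0// normal_fun_le1.
have A0' : forall y : R, 0 <= (fun _ : R => A) y by move=> _; exact: ltW.
have := derivable_under_integral mI Ixi intf df A0' intG ub.
have := differentiation_under_integral mI Ixi intf df A0' intG ub.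
rewrite derive1E => KE dK.
have -> : - (\int[mu]_(x in `[m - A, m + A]) ((x - m) * gs s x * sin (xi * (x - m) + th))) =
    'D_1 K xi.
  rewrite KE -[LHS]mulN1r -RintegralZl//; last first.
    apply: continuous_integrable_itv; exact: cgxs.
  by apply: eq_Rintegral => x _; rewrite /partial1of2 d1E mulN1r.
exact: DeriveDef.
Qed.

Let K_ode (xi : R) : - (\int[mu]_(x in `[m - A, m + A]) ((x - m) * gs s x * sin (xi * (x - m) + th))) =
  s ^+ 2 * (gs s (m + A) * (sin (xi * A + th) - sin (- (xi * A) + th)) - xi * K xi).
Proof.
have dG (x : R) : is_derive (x : R) 1 (fun x : R => s ^+ 2 * (gs s x * sin (xi * (x - m) + th)))
   (- 1 * ((x - m) * gs s x * sin (xi * (x - m) + th)) +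
    s ^+ 2 * xi * (gs s x * cos (xi * (x - m) + th))).
  have := is_derive_normal_fun x s0 => ?.
  apply: is_derive_eq; rewrite /GRing.scale/=; field; exact: s0.
have AA : m - A < m + A by rewrite ltrD2l -subr_gt0 opprK addr_gt0.
have cg1 : continuous (fun x : R => - 1 * ((x - m) * gs s x * sin (xi * (x - m) + th))).
  by move=> x; apply: cvgMl_tmp; exact: cgxs.
have cg2 : continuous (fun x : R => s ^+ 2 * xi * (gs s x * cos (xi * (x - m) + th))).
  by move=> x; apply: cvgMl_tmp; exact: cgc.
have := Rintegral_FTC2 AA _ dG.
rewrite RintegralD//; last 2 first.
- exact: continuous_integrable_itv.
- exact: continuous_integrable_itv.
rewrite !RintegralZl//;
  try by apply: continuous_integrable_itv; (exact: cgxs || exact: cgc).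
have -> : gs s (m - A) = gs s (m + A).
  have e1 : m - A - m = - A by ring.
  have e2 : m + A - m = A by ring.
  by rewrite /normal_fun e1 e2 sqrrN.
have -> : m + A - m = A by ring.
have -> : m - A - m = - A by ring.
rewrite mulrN mulN1r => H.
have {}H := H (fun x => cvgD (cg1 x) (cg2 x)).
rewrite -/(K xi) in H.
by rewrite -[LHS](addrK (s ^+ 2 * xi * K xi)) H; ring.
Qed.

(** Integration by parts gives a linear differential equation for the transform
    of the truncated Gaussian, up to a boundary term of the size of the Gaussian
    at the endpoints; the mean value theorem integrates it. *)
Lemma truncated_gauss_fourier (xi : R) : 0 <= xi ->
  `|expR (s ^+ 2 * xi ^+ 2 / 2) * K xi - K 0| <=
    xi * (2 * s ^+ 2 * expR (s ^+ 2 * xi ^+ 2 / 2) * gs s (m + A)).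
Proof.
rewrite le_eqVlt => /predU1P[<-|xi0].
  by rewrite expr0n/= mulr0 mul0r expR0 mul1r subrr normr0 mul0r.
pose E (z : R) := expR (s ^+ 2 * z ^+ 2 / 2).
pose B z := gs s (m + A) * (sin (z * A + th) - sin (- (z * A) + th)).
have dEK (z : R) : is_derive (z : R) 1 (fun z : R => E z * K z) (E z * s ^+ 2 * B z).
  have := derK z; rewrite K_ode -/(B z) => ?.
  rewrite /E; apply: is_derive_eq; rewrite /GRing.scale/=. by field.
have := @MVT _ (fun z => E z * K z) _ 0 xi xi0 (fun z _ => dEK z); case=> [|c].
  by apply: continuous_subspaceT; exact: is_derive_continuous dEK.
rewrite in_itv/= => /andP[c0 cxi].
rewrite {2}/E expr0n/= mulr0 mul0r expR0 mul1r subr0 => ->.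
rewrite normrM [leRHS]mulrC; apply: ler_pM => //; last by rewrite gtr0_norm.
have -> : 2 * s ^+ 2 * expR (s ^+ 2 * xi ^+ 2 / 2) * gs s (m + A) =
  (E xi * s ^+ 2) * (gs s (m + A) * 2) by rewrite /E; ring.
rewrite normrM; apply: ler_pM => //.
  rewrite ger0_norm; last by rewrite mulr_ge0 ?expR_ge0 ?sqr_ge0.
  apply: ler_wpM2r; first exact: sqr_ge0.
  rewrite ler_expR ler_wpM2r ?invr_ge0// ler_wpM2l ?sqr_ge0//.
  by rewrite ler_sqr ?nnegrE ltW.
rewrite normrM ger0_norm ?normal_fun_ge0//; apply: ler_wpM2l.
  exact: normal_fun_ge0.
apply: (le_trans (ler_normB _ _)).
by rewrite -[2]/(1 + 1); apply: lerD; exact: norm_sin_le1.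
Qed.

End truncated.

Lemma dominated_Rintegral d (T : measurableType d) (nu : {measure set T -> \bar R})
    (f_ : (T -> R)^nat) (f g : T -> R) :
  (forall n, measurable_fun setT (f_ n)) -> measurable_fun setT f ->
  (forall x, f_ ^~ x @ \oo --> f x) ->
  nu.-integrable setT (EFin \o g) -> (forall n x, `|f_ n x| <= g x) ->
  \int[nu]_x f_ n x @[n --> \oo] --> \int[nu]_x f x.
Proof.
move=> mf_ mf f_f ig fg.
have [] := @dominated_convergence _ _ _ nu setT measurableT
  (fun n => EFin \o f_ n) (EFin \o f) (EFin \o g).
- by move=> n; exact/measurable_EFinP.
- exact/measurable_EFinP.
- by apply: aeW => x _; apply/fine_cvgP; split; [exact: nearW|exact: f_f].
- exact: ig.
- by apply: aeW => x n _ /=; rewrite lee_fin.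
move=> intf _ cf; apply: fine_cvg => //.
by rewrite fineK//; exact: integrable_fin_num.
Qed.
End gauss.

Section gauss2.
Context {R : realType}.
Notation mu := (@lebesgue_measure R).

(** The integration by parts takes place on bounded intervals, so the integrals
    over the line are reached as limits of those. *)
Lemma Rintegral_cvg_itv (f : R -> R) (m : R) :
  mu.-integrable setT (EFin \o f) ->
  \int[mu]_(x in `[m - n%:R, m + n%:R]) f x @[n --> \oo] --> \int[mu]_x f x.
Proof.
move=> intf; have mf : measurable_fun setT f.
  by apply/measurable_EFinP; case/integrableP: intf.
have -> : (fun n : nat => \int[mu]_(x in `[m - n%:R, m + n%:R]) f x) =
  (fun n : nat => \int[mu]_x (f \_ `[m - n%:R, m + n%:R]) x).
  by apply/funext => n; rewrite Rintegral_mkcond.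
apply: (@dominated_Rintegral R _ _ mu (fun n : nat => f \_ `[m - n%:R, m + n%:R]) f (fun x => `|f x|)).
- by move=> n; apply/(measurable_restrictT _ _).1 => //; exact: measurable_funTS.
- by [].
- move=> x; apply: cvg_near_cst.
  near=> n; rewrite patchE mem_set//= in_itv/=.
  suff : `|x - m| <= n%:R by rewrite ler_norml => /andP[? ?]; apply/andP; split; lra.
  near: n; exact: nbhs_infty_ger.
- exact: integrable_norm.
- move=> n x; rewrite patchE; case: ifP => _ //.
  by rewrite normr0.
Unshelve. all: by end_near. Qed.

Lemma normal_fun_cvg0 (m s : R) : s != 0 ->
  normal_fun m s (m + n%:R) @[n --> \oo] --> (0 : R).
Proof.
move=> s0; pose c := (Num.sqrt (s ^+ 2 *+ 2))^-1.
have c0 : 0 < c by rewrite invr_gt0 sqrtr_gt0 pmulrn_lgt0// exprn_even_gt0.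
have -> : (fun n : nat => normal_fun m s (m + n%:R)) =
    gauss_fun \o (fun n : nat => n%:R * c).
  apply/funext => n /=; rewrite /normal_fun /gauss_fun; congr expR.
  rewrite exprMn exprVn sqr_sqrtr ?mulrn_wge0 ?sqr_ge0// mulNr.
  by congr (- (_ / _)); ring.
apply: (@cvg_comp _ _ _ _ _ _ (pinfty_nbhs R)); last exact: cvg_gauss_fun.
apply: (cvg_comp _ (fun x : R => x * c) (@cvgr_idn R)).
exact: (gt0_cvgMly c0).
Qed.

Lemma integrable_bounded_mul d (T : measurableType d)
    (nu : {measure set T -> \bar R}) (f g : T -> R) (M : R) :
  nu.-integrable setT (EFin \o f) -> measurable_fun setT g ->
  (forall x, `|g x| <= M) -> nu.-integrable setT (EFin \o (fun x => f x * g x)).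
Proof.
move=> intf mg gM.
have mf : measurable_fun setT f.
  by apply/measurable_EFinP; case/integrableP: intf.
apply: (@le_integrable _ _ _ nu _ measurableT _ (EFin \o (fun x => M * f x))).
- by apply/measurable_EFinP; exact: measurable_funM.
- move=> x _ /=; rewrite lee_fin !normrM mulrC.
  by apply: ler_pM => //; rewrite (le_trans (gM x))// ler_norm.
- by under [EFin \o _]eq_fun do rewrite /= EFinM; exact: integrableZl.
Qed.

Lemma integrable_normal_fun (m s : R) : s != 0 ->
  mu.-integrable setT (EFin \o normal_fun m s).
Proof.
move=> s0; have := integrable_normal_pdf m s.
rewrite normal_pdfE// => intp.
have p0 : normal_peak s != 0 by rewrite gt_eqF// normal_peak_gt0.
rewrite (_ : EFin \o normal_fun m s = fun x => (normal_peak s)^-1%:E *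
  (normal_peak s * normal_fun m s x)%:E)%E; first exact: integrableZl.
by apply/funext => x /=; rewrite -EFinM mulrA mulVf// mul1r.
Qed.

(** The Gaussian is the eigenfunction of the Fourier transform because both it
    and its cosine transform solve the same first-order linear equation. *)
Lemma gauss_fourier (m s th xi : R) : s != 0 ->
  \int[mu]_x (normal_pdf m s x * cos (xi * x + th)) =
    expR (- (s ^+ 2 * xi ^+ 2 / 2)) * cos (xi * m + th).
Proof.
move=> s0; wlog xi0 : xi th / 0 <= xi.
  move=> H; have [/H//|xi0] := leP 0 xi.
  have := H (- xi) (- th); rewrite oppr_ge0 ltW// => /(_ isT).
  rewrite sqrrN mulNr -opprD cosN => <-.
  by apply: eq_Rintegral => x _; rewrite mulNr -opprD cosN.
pose th' := xi * m + th.
pose f (z x : R) := normal_fun m s x * cos (z * (x - m) + th').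
have mc z : measurable_fun setT (fun x : R => cos (z * (x - m) + th')).
  by apply: continuous_measurable_fun; exact: continuous_cosl.
have intf z : mu.-integrable setT (EFin \o f z).
  apply: (integrable_bounded_mul (integrable_normal_fun m s0) (mc z)) => x.
  exact: norm_cos_le1.
pose K z := \int[mu]_x f z x.
pose E := expR (s ^+ 2 * xi ^+ 2 / 2).
have EK : E * K xi = K 0.
  apply/eqP; rewrite -subr_eq0 -normr_le0.
  have lim1 : `|E * (\int[mu]_(x in `[m - n%:R, m + n%:R]) f xi x) -
      \int[mu]_(x in `[m - n%:R, m + n%:R]) f 0 x| @[n --> \oo] -->
      `|E * K xi - K 0|.
    apply: cvg_norm; apply: cvgB; last exact: Rintegral_cvg_itv.
    by apply: cvgMl_tmp; exact: Rintegral_cvg_itv.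
  have lim2 : xi * (2 * s ^+ 2 * E * normal_fun m s (m + n%:R)) @[n --> \oo] -->
      (0 : R).
    rewrite -[X in _ --> X](mulr0 xi); apply: cvgMl_tmp.
    rewrite -[X in _ --> X](mulr0 (2 * s ^+ 2 * E)); apply: cvgMl_tmp.
    exact: normal_fun_cvg0.
  apply: (ler_cvg_to lim1 lim2); near=> n.
  apply: truncated_gauss_fourier => //.
  by rewrite ltr0n; near: n; exact: nbhs_infty_gt.
have K0 : K 0 = cos th' * (normal_peak s)^-1.
  rewrite /K /f; under eq_Rintegral do rewrite mul0r add0r mulrC.
  rewrite RintegralZl//; last exact: integrable_normal_fun.
  congr (_ * _).
  have := integral_normal_pdf m s; rewrite normal_pdfE//.
  have p0 : normal_peak s != 0 by rewrite gt_eqF// normal_peak_gt0.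
  move=> /(congr1 fine)/=; rewrite -[X in X = 1]/(\int[mu]_x (normal_peak s * normal_fun m s x)).
  rewrite RintegralZl//; last exact: integrable_normal_fun.
  by move=> H; apply: (mulfI p0); rewrite H divff.
have -> : \int[mu]_x (normal_pdf m s x * cos (xi * x + th)) =
    normal_peak s * K xi.
  rewrite /K -RintegralZl//; apply: eq_Rintegral => x _.
  rewrite normal_pdfE// /f /th' mulrA; congr (_ * cos _); ring.
have E0 : E != 0 by rewrite expR_eq0.
have p0 : normal_peak s != 0 by rewrite gt_eqF// normal_peak_gt0.
have -> : K xi = E^-1 * K 0 by rewrite -EK mulKf.
by rewrite K0 expRN -/E; field; rewrite p0 E0.
Unshelve. all: by end_near. Qed.
End gauss2.

(** * Integration in the plane *)
Section plane.
Context {R : realType}.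
Notation mu := (@lebesgue_measure R).
Notation mu2 := (mu \x mu)%E.

(** The product sigma-algebra contains the open sets because the plane is
    second countable: an open set is a union of boxes with rational sides. *)
Lemma open_measurable_plane (U : set (R * R)) : open U -> measurable U.
Proof.
move=> oU.
pose box (q : rat * rat * (rat * rat)) : set (R * R) :=
  `]ratr q.1.1, ratr q.1.2[%classic `*` `]ratr q.2.1, ratr q.2.2[%classic.
rewrite (_ : U = \bigcup_q (if `[< box q `<=` U >] then box q else set0)).
  apply: countable_bigcupT_measurable => [|q]; first exact: countableP.
  case: ifP => _; last exact: measurable0.
  by apply: measurableX; exact: measurable_itv.
apply/seteqP; split => [x Ux|x [q _]]; last first.
  by case: ifP => // /asboolP qU /qU.
move: oU; rewrite openE => /(_ _ Ux) /nbhs_ballP[e /= e0 eU].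
have h (t : R) : t - e < t /\ t < t + e by split; lra.
have [a1 ha1] := rat_in_itvoo (h x.1).1; have [b1 hb1] := rat_in_itvoo (h x.1).2.
have [a2 ha2] := rat_in_itvoo (h x.2).1; have [b2 hb2] := rat_in_itvoo (h x.2).2.
exists ((a1, b1), (a2, b2)) => //; rewrite ifT.
  move: ha1 hb1 ha2 hb2; rewrite /box/= !in_itv/= => /andP[_ ->] /andP[-> _].
  by move=> /andP[_ ->] /andP[-> _].
apply/asboolP => -[y1 y2]; rewrite /box /= !in_itv/= => -[/andP[p1 p2] /andP[p3 p4]].
move: ha1 hb1 ha2 hb2; rewrite !in_itv/= => /andP[? ?] /andP[? ?] /andP[? ?] /andP[? ?].
by apply: eU; split; rewrite /ball/= ltr_norml; apply/andP; split; lra.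
Qed.

Lemma continuous_measurable_plane (f : R * R -> R) :
  continuous f -> measurable_fun setT f.
Proof.
move=> /continuousP cf; apply: (measurability _ (RGenOpens.measurableE R)) => //.
move=> _ [_ [a [b ->] <-]]; rewrite setTI.
apply: open_measurable_plane; apply: cf; exact: interval_open.
Qed.

Lemma integrable_plane_mul (f g : R -> R) :
  mu.-integrable setT (EFin \o f) -> mu.-integrable setT (EFin \o g) ->
  mu2.-integrable setT (EFin \o (fun x => f x.1 * g x.2)).
Proof.
move=> intf intg.
have mf : measurable_fun setT f.
  by apply/measurable_EFinP; case/integrableP: intf.
have mg : measurable_fun setT g.
  by apply/measurable_EFinP; case/integrableP: intg.
have mfg : measurable_fun setT (EFin \o (fun x : R * R => f x.1 * g x.2)).
  apply/measurable_EFinP; apply: measurable_funM.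
  - exact: (measurableT_comp mf measurable_fst).
  - exact: (measurableT_comp mg measurable_snd).
apply/integrable12ltyP => //.
have -> : (fun x : R => \int[mu]_y `|(EFin \o (fun x : R * R => (f x.1 * g x.2)%R)) (x, y)|)%E =
  (fun x : R => (\int[mu]_y `|(EFin \o g) y|) * `|(EFin \o f) x|)%E.
  apply/funext => x; under eq_integral do rewrite /= normrM EFinM.
  rewrite ge0_integralZl//; first by rewrite muleC.
  by apply/measurable_EFinP/measurableT_comp.
rewrite ge0_integralZl//.
- apply: lte_mul_pinfty.
  + exact: integral_ge0.
  + by apply: integral_fune_fin_num => //; exact: integrable_abse.
  + by case/integrableP: intf.
- by apply: measurableT_comp => //; exact/measurable_EFinP.
- exact: integral_ge0.
Qed.

Lemma Rintegral_plane_mul (f g : R -> R) :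
  mu.-integrable setT (EFin \o f) -> mu.-integrable setT (EFin \o g) ->
  \int[mu2]_x (f x.1 * g x.2) = (\int[mu]_x f x) * (\int[mu]_x g x).
Proof.
move=> intf intg.
rewrite {1}/Rintegral -(integral12_prod_meas1 (integrable_plane_mul intf intg)).
rewrite -RintegralZr// /Rintegral; congr fine; apply: eq_integral => x _ /=.
transitivity (\int[mu]_y ((f x)%:E * (g y)%:E))%E.
  by apply: eq_integral => y _ /=; rewrite EFinM.
rewrite integralZl// EFinM; congr (_ * _)%E.
by rewrite fineK//; exact: integrable_fin_num.
Qed.
End plane.

(** * Gaussian mollification in the plane *)
Section kernel.
Context {R : realType}.
Notation mu := (@lebesgue_measure R).
Notation mu2 := (mu \x mu)%E.

Lemma integrable_gauss_cos (m s c th : R) : s != 0 ->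
  mu.-integrable setT (EFin \o (fun x : R => normal_pdf m s x * cos (c * x + th))).
Proof.
move=> s0.
apply: (integrable_bounded_mul (M := 1) (integrable_normal_pdf m s)) => [|x].
  have := @continuous_cosl R 0 c th; under eq_fun do rewrite subr0.
  exact: continuous_measurable_fun.
exact: norm_cos_le1.
Qed.

Definition gauss_kernel (s : R) (p x : R * R) : R :=
  normal_pdf p.1 s x.1 * normal_pdf p.2 s x.2.

Lemma gauss_kernel_ge0 s p x : 0 <= gauss_kernel s p x.
Proof. by rewrite mulr_ge0 ?normal_pdf_ge0. Qed.

Lemma integrable_gauss_kernel (s : R) p :
  mu2.-integrable setT (EFin \o gauss_kernel s p).
Proof. by apply: integrable_plane_mul; exact: integrable_normal_pdf. Qed.

Lemma Rintegral_normal_pdf (m s : R) : \int[mu]_x (normal_pdf m s x) = 1.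
Proof. by rewrite /Rintegral integral_normal_pdf. Qed.

Lemma Rintegral_gauss_kernel (s : R) p : \int[mu2]_x gauss_kernel s p x = 1.
Proof.
rewrite Rintegral_plane_mul ?Rintegral_normal_pdf ?mulr1//;
  exact: integrable_normal_pdf.
Qed.

Lemma gauss_kernel_fourier (s c1 c2 th : R) (p : R * R) : s != 0 ->
  \int[mu2]_x (gauss_kernel s p x * cos (c1 * x.1 + c2 * x.2 + th)) =
  expR (- (s ^+ 2 * c1 ^+ 2 / 2)) * expR (- (s ^+ 2 * c2 ^+ 2 / 2)) *
    cos (c1 * p.1 + c2 * p.2 + th).
Proof.
move=> s0.
have sinE (t : R) : sin t = cos (t + - (pi / 2)).
  by rewrite cosD cosN sinN sin_pihalf cos_pihalf mulr0 add0r mulrN1 opprK.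
have cosDE (u v : R) : cos (u + v + th) =
    cos (u + 0) * cos (v + th) - cos (u + - (pi / 2)) * cos (v + (th - pi / 2)).
  by rewrite (addrA v) -!sinE addr0 -(addrA u) (cosD u).
pose f1 x : R := normal_pdf p.1 s x * cos (c1 * x + 0).
pose g1 x : R := normal_pdf p.2 s x * cos (c2 * x + th).
pose f2 x : R := normal_pdf p.1 s x * cos (c1 * x + - (pi / 2)).
pose g2 x : R := normal_pdf p.2 s x * cos (c2 * x + (th - pi / 2)).
have if1 : mu.-integrable setT (EFin \o f1) := integrable_gauss_cos _ _ _ s0.
have ig1 : mu.-integrable setT (EFin \o g1) := integrable_gauss_cos _ _ _ s0.
have if2 : mu.-integrable setT (EFin \o f2) := integrable_gauss_cos _ _ _ s0.
have ig2 : mu.-integrable setT (EFin \o g2) := integrable_gauss_cos _ _ _ s0.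
have i1 := integrable_plane_mul if1 ig1.
have i2 := integrable_plane_mul if2 ig2.
transitivity (\int[mu2]_x (f1 x.1 * g1 x.2 - f2 x.1 * g2 x.2)).
  apply: eq_Rintegral => x _; rewrite /f1 /g1 /f2 /g2 /gauss_kernel.
  by rewrite cosDE; ring.
rewrite RintegralB// !Rintegral_plane_mul//.
by rewrite !gauss_fourier// cosDE; ring.
Qed.

Lemma normal_pdf_tail (m s d x : R) : 0 < s -> 0 < d -> d <= `|x - m| ->
  normal_pdf m s x <= 6 * s ^+ 2 / d ^+ 2 * normal_pdf m (2 * s) x.
Proof.
move=> s0 d0 dx; have s20 : 2 * s != 0 by rewrite gt_eqF// mulr_gt0.
rewrite !normal_pdfE ?gt_eqF ?mulr_gt0//.
have peakE : normal_peak s = 2 * normal_peak (2 * s).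
  rewrite /normal_peak.
  have -> : (2 * s) ^+ 2 * pi *+ 2 = 2 ^+ 2 * (s ^+ 2 * pi *+ 2) by ring.
  rewrite [Num.sqrt (2 ^+ 2 * _)]sqrtrM ?sqr_ge0// sqrtr_sqr normr_nat.
  by rewrite invfM mulVKf// pnatr_eq0.
rewrite peakE [leRHS]mulrCA -[leLHS]mulrA [leLHS]mulrCA.
apply: ler_wpM2l; first exact: normal_peak_ge0.
rewrite /normal_fun; set u := (x - m) ^+ 2.
have du : d ^+ 2 <= u.
  by rewrite /u -(real_normK (num_real (x - m))) ler_sqr ?nnegrE// ltW.
have u0 : 0 < u by rewrite (lt_le_trans _ du)// exprn_gt0.
have -> : - u / (s ^+ 2 *+ 2) = - (3 * u / (8 * s ^+ 2)) + - u / ((2 * s) ^+ 2 *+ 2).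
  by field; rewrite gt_eqF.
rewrite expRD mulrA; apply: ler_wpM2r; first exact: expR_ge0.
have y0 : 0 < 3 * u / (8 * s ^+ 2). by apply: divr_gt0; apply: mulr_gt0 => //; exact: exprn_gt0.
have w0 : 0 < 8 * s ^+ 2 / (3 * d ^+ 2).
  by apply: divr_gt0; apply: mulr_gt0 => //; exact: exprn_gt0.
have : expR (- (3 * u / (8 * s ^+ 2))) <= 8 * s ^+ 2 / (3 * d ^+ 2).
  rewrite expRN -[leRHS]invrK lef_pV2 ?posrE ?expR_gt0 ?invr_gt0//.
  rewrite invf_div; apply: (@le_trans _ _ (3 * u / (8 * s ^+ 2))).
    apply: ler_wpM2r; first by rewrite invr_ge0 mulr_ge0 ?sqr_ge0.
    by rewrite ler_pM2l.
  by apply: le_trans (expR_ge1Dx _); rewrite lerDr.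
move=> h; apply: (@le_trans _ _ (2 * (8 * s ^+ 2 / (3 * d ^+ 2)))).
  by rewrite ler_pM2l.
have -> : 2 * (8 * s ^+ 2 / (3 * d ^+ 2)) = (16 / 3) * (s ^+ 2 / d ^+ 2).
  by field; rewrite gt_eqF.
rewrite -[leRHS]mulrA; apply: ler_wpM2r; first by rewrite divr_ge0 ?sqr_ge0.
by rewrite ler_pdivrMr//; lra.
Qed.

(** Outside the ball where [f] is almost constant, the kernel is dominated by a
    multiple of its second moment, which tends to 0 with the width. *)
Lemma gauss_kernel_approx (f : R * R -> R) (M : R) (p : R * R) (e : R) :
  continuous f -> (forall x, `|f x| <= M) -> 0 < e ->
  exists2 s : R, 0 < s & forall s', 0 < s' -> s' <= s ->
    `|\int[mu2]_x (f x * gauss_kernel s' p x) - f p| <= e.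
Proof.
move=> cf fM e0.
have M0 : 0 <= M by rewrite (le_trans _ (fM p)).
have e20 : 0 < e / 2 by rewrite divr_gt0.
have /cvgrPdist_le /(_ _ e20) := cf p.
move=> /nbhs_ballP[d /= d0 df].
have D0 : 0 < (24 * M + 1) / d ^+ 2 by rewrite divr_gt0 ?exprn_gt0// ltr_wpDl ?mulr_ge0.
pose s := Num.min 1 (e / 2 / ((24 * M + 1) / d ^+ 2)).
have s0 : 0 < s by rewrite lt_min ltr01/= divr_gt0.
exists s => // t t0 ts.
have t2 : (24 * M) / d ^+ 2 * t ^+ 2 <= e / 2.
  have t1 : t <= 1 by rewrite (le_trans ts)// ge_min lexx.
  have : t <= e / 2 / ((24 * M + 1) / d ^+ 2) by rewrite (le_trans ts)// ge_min lexx orbT.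
  rewrite ler_pdivlMr// => h; apply: le_trans h; rewrite [leRHS]mulrC.
  apply: ler_pM.
  + by rewrite divr_ge0 ?sqr_ge0// mulr_ge0.
  + exact: sqr_ge0.
  + by apply: ler_wpM2r; [rewrite invr_ge0 sqr_ge0|rewrite lerDl].
  + by rewrite expr2 ler_piMr// ltW.
have tn0 : t != 0 by rewrite gt_eqF.
have mf : measurable_fun setT f by exact: continuous_measurable_plane.
have intfk : mu2.-integrable setT (EFin \o (fun x => f x * gauss_kernel t p x)).
  under [EFin \o _]eq_fun do rewrite mulrC.
  exact: (integrable_bounded_mul (integrable_gauss_kernel t p) mf fM).
pose k1 x : R := normal_pdf p.1 (2 * t) x.1 * normal_pdf p.2 t x.2.
pose k2 x : R := normal_pdf p.1 t x.1 * normal_pdf p.2 (2 * t) x.2.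
have ik1 : mu2.-integrable setT (EFin \o k1).
  by apply: integrable_plane_mul; exact: integrable_normal_pdf.
have ik2 : mu2.-integrable setT (EFin \o k2).
  by apply: integrable_plane_mul; exact: integrable_normal_pdf.
have Ik1 : \int[mu2]_x k1 x = 1.
  by rewrite Rintegral_plane_mul ?Rintegral_normal_pdf ?mulr1//; exact: integrable_normal_pdf.
have Ik2 : \int[mu2]_x k2 x = 1.
  by rewrite Rintegral_plane_mul ?Rintegral_normal_pdf ?mulr1//; exact: integrable_normal_pdf.
pose c := 2 * M * (6 * t ^+ 2 / d ^+ 2).
have td0 : 0 <= 6 * t ^+ 2 / d ^+ 2.
  by apply: divr_ge0; [apply: mulr_ge0 => //; exact: sqr_ge0|exact: sqr_ge0].
have c0 : 0 <= c by apply: mulr_ge0 => //; exact: mulr_ge0.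
have ub x : `|f x * gauss_kernel t p x - f p * gauss_kernel t p x| <=
    e / 2 * gauss_kernel t p x + c * (k1 x + k2 x).
  rewrite -mulrBl normrM (ger0_norm (gauss_kernel_ge0 t p x)).
  have kk0 : 0 <= k1 x + k2 x by rewrite addr_ge0 ?mulr_ge0 ?normal_pdf_ge0.
  have [bx|nbx] := pselect (ball p d x).
    apply: ler_wpDr; first by rewrite mulr_ge0.
    by apply: ler_wpM2r; [exact: gauss_kernel_ge0|rewrite distrC; exact: df].
  apply: ler_wpDl; first by rewrite mulr_ge0 ?gauss_kernel_ge0// ltW.
  rewrite -mulrA; apply: ler_pM => //; first exact: gauss_kernel_ge0.
    apply: (le_trans (ler_normB _ _)).
    by rewrite -[2]/(1 + 1) mulrDl mul1r lerD.
  have [x1|x1] := leP d `|x.1 - p.1|.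
    rewrite mulrDr; apply: ler_wpDr.
      by apply: mulr_ge0 => //; apply: mulr_ge0; exact: normal_pdf_ge0.
    rewrite mulrA; apply: ler_wpM2r; first exact: normal_pdf_ge0.
    exact: normal_pdf_tail.
  have [x2|x2] := leP d `|x.2 - p.2|.
    rewrite mulrDr; apply: ler_wpDl.
      by apply: mulr_ge0 => //; apply: mulr_ge0; exact: normal_pdf_ge0.
    rewrite mulrCA; apply: ler_wpM2l; first exact: normal_pdf_ge0.
    exact: normal_pdf_tail.
  by exfalso; apply: nbx; split; rewrite /ball/= distrC.
have fpE : f p = \int[mu2]_x (f p * gauss_kernel t p x).
  rewrite RintegralZl ?Rintegral_gauss_kernel ?mulr1//.
  exact: integrable_gauss_kernel.
have intpk : mu2.-integrable setT (EFin \o (fun x => f p * gauss_kernel t p x)).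
  under [EFin \o _]eq_fun do rewrite /= EFinM.
  by apply: integrableZl => //; exact: integrable_gauss_kernel.
rewrite {1}fpE -RintegralB//.
have intd : mu2.-integrable setT
    (EFin \o (fun x => f x * gauss_kernel t p x - f p * gauss_kernel t p x)).
  under [EFin \o _]eq_fun do rewrite /= EFinB.
  exact: integrableB.
apply: le_trans (le_normr_Rintegral _ intd) _ => //.
have i12 : mu2.-integrable setT (EFin \o (fun x => k1 x + k2 x)).
  by under [EFin \o _]eq_fun do rewrite /= EFinD; exact: integrableD.
have ie : mu2.-integrable setT (EFin \o (fun x => e / 2 * gauss_kernel t p x)).
  under [EFin \o _]eq_fun do rewrite /= EFinM.
  by apply: integrableZl => //; exact: integrable_gauss_kernel.
have ic : mu2.-integrable setT (EFin \o (fun x => c * (k1 x + k2 x))).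
  by under [EFin \o _]eq_fun do rewrite /= EFinM; exact: integrableZl.
apply: (@le_trans _ _ (\int[mu2]_x (e / 2 * gauss_kernel t p x + c * (k1 x + k2 x)))).
  apply: le_Rintegral => //.
  - exact: integrable_norm.
  - by under [EFin \o _]eq_fun do rewrite /= EFinD; exact: integrableD.
rewrite RintegralD// RintegralZl//; last exact: integrable_gauss_kernel.
rewrite RintegralZl// RintegralD// Ik1 Ik2 Rintegral_gauss_kernel mulr1.
rewrite [leRHS](splitr e); apply: lerD => //; apply: le_trans t2.
rewrite le_eqVlt; apply/orP; left; apply/eqP.
by rewrite /c; field; rewrite gt_eqF.
Qed.
End kernel.

(** * Smooth functions of two variables *)
Section smooth_plane.
Context {R : realType}.
Implicit Types (g h : R * R -> R) (k a b : nat) (x : R * R).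

Definition smooth2 g := forall k, Ck k g.

Local Opaque Defs.e1 Defs.e2.

Lemma CkW k g : Ck k.+1 g -> Ck k g.
Proof.
elim: k g => [g [cg _]//|k IH g [cg [d1 d2 c1 c2]]].
split; [exact: cg|split; [exact: d1|exact: d2|exact: (IH _ c1)|exact: (IH _ c2)]].
Qed.

Lemma Ck_add k g h : Ck k g -> Ck k h -> Ck k (fun x => g x + h x).
Proof.
elim: k g h => [g h [cg _] [ch _]|k IH g h [cg [g1 g2 c1 c2]] [ch [h1 h2 e1 e2]]].
  by split; [move=> x; apply: cvgD; [exact: cg|exact: ch]|].
split; first by move=> x; apply: cvgD; [exact: cg|exact: ch].
have D v x : derivable g x v -> derivable h x v ->
   is_derive x v (fun x => g x + h x) ('D_v g x + 'D_v h x).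
  move=> ? ?; apply: (is_deriveD); exact: DeriveDef.
split => [x|x||].
- by have ? := D _ x (g1 x) (h1 x); exact: ex_derive.
- by have ? := D _ x (g2 x) (h2 x); exact: ex_derive.
- rewrite (_ : 'D_Defs.e1 _ = fun x => 'D_Defs.e1 g x + 'D_Defs.e1 h x).
    exact: (IH _ _ c1 e1).
  by apply/funext => x; have ? := D _ x (g1 x) (h1 x); exact: derive_val.
- rewrite (_ : 'D_Defs.e2 _ = fun x => 'D_Defs.e2 g x + 'D_Defs.e2 h x).
    exact: (IH _ _ c2 e2).
  by apply/funext => x; have ? := D _ x (g2 x) (h2 x); exact: derive_val.
Qed.

Lemma is_derive_mul2 g h v x : derivable g x v -> derivable h x v ->
  is_derive x v (fun x => g x * h x) ('D_v g x * h x + g x * 'D_v h x).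
Proof.
move=> dg dh.
have dg' : is_derive x v g ('D_v g x) by exact: DeriveDef.
have dh' : is_derive x v h ('D_v h x) by exact: DeriveDef.
have := @is_deriveM _ _ g h x v _ _ dg' dh'.
by rewrite /GRing.scale/= addrC (mulrC (h x)).
Qed.

Lemma Ck_mul k g h : Ck k g -> Ck k h -> Ck k (fun x => g x * h x).
Proof.
elim: k g h => [g h [cg _] [ch _]|k IH g h].
  by split; [move=> x; apply: cvgM; [exact: cg|exact: ch]|].
move=> cg ch; have cg' := CkW cg; have ch' := CkW ch.
move: cg ch => [cg [g1 g2 c1 c2]] [ch [h1 h2 e1 e2]].
split; first by move=> x; apply: cvgM; [exact: cg|exact: ch].
split => [x|x||].
- by have ? := is_derive_mul2 (g1 x) (h1 x); exact: ex_derive.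
- by have ? := is_derive_mul2 (g2 x) (h2 x); exact: ex_derive.
- rewrite (_ : 'D_Defs.e1 _ = fun x => 'D_Defs.e1 g x * h x + g x * 'D_Defs.e1 h x).
    by apply: Ck_add; [exact: (IH _ _ c1 ch')|exact: (IH _ _ cg' e1)].
  by apply/funext => x; have ? := is_derive_mul2 (g1 x) (h1 x); exact: derive_val.
- rewrite (_ : 'D_Defs.e2 _ = fun x => 'D_Defs.e2 g x * h x + g x * 'D_Defs.e2 h x).
    by apply: Ck_add; [exact: (IH _ _ c2 ch')|exact: (IH _ _ cg' e2)].
  by apply/funext => x; have ? := is_derive_mul2 (g2 x) (h2 x); exact: derive_val.
Qed.

Lemma smooth2_add g h : smooth2 g -> smooth2 h -> smooth2 (fun x => g x + h x).
Proof. by move=> sg sh k; exact: Ck_add. Qed.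

Lemma smooth2_mul g h : smooth2 g -> smooth2 h -> smooth2 (fun x => g x * h x).
Proof. by move=> sg sh k; exact: Ck_mul. Qed.

Lemma smooth2_D1 g : smooth2 g -> smooth2 ('D_Defs.e1 g).
Proof. by move=> sg k; have [_ [_ _ c1 c2]] := sg k.+1; exact: c1. Qed.

Lemma smooth2_D2 g : smooth2 g -> smooth2 ('D_Defs.e2 g).
Proof. by move=> sg k; have [_ [_ _ c1 c2]] := sg k.+1; exact: c2. Qed.

Lemma smooth2_derivable1 g : smooth2 g -> forall x, derivable g x Defs.e1.
Proof. by move=> sg; have [_ [d1 d2 _ _]] := sg 1%N; exact: d1. Qed.

Lemma smooth2_derivable2 g : smooth2 g -> forall x, derivable g x Defs.e2.
Proof. by move=> sg; have [_ [d1 d2 _ _]] := sg 1%N; exact: d2. Qed.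

Local Notation D1 := (fun h : R * R -> R => 'D_Defs.e1 h).
Local Notation D2 := (fun h : R * R -> R => 'D_Defs.e2 h).

Lemma D1_mul g h : smooth2 g -> smooth2 h ->
  D1 (fun x => g x * h x) = fun x => 'D_Defs.e1 g x * h x + g x * 'D_Defs.e1 h x.
Proof.
move=> sg sh; apply/funext => x.
have ? := is_derive_mul2 (@smooth2_derivable1 g sg x) (@smooth2_derivable1 h sh x).
exact: derive_val.
Qed.

Lemma D2_mul g h : smooth2 g -> smooth2 h ->
  D2 (fun x => g x * h x) = fun x => 'D_Defs.e2 g x * h x + g x * 'D_Defs.e2 h x.
Proof.
move=> sg sh; apply/funext => x.
have ? := is_derive_mul2 (@smooth2_derivable2 g sg x) (@smooth2_derivable2 h sh x).
exact: derive_val.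
Qed.

Lemma D1_add g h : smooth2 g -> smooth2 h ->
  D1 (fun x => g x + h x) = fun x => 'D_Defs.e1 g x + 'D_Defs.e1 h x.
Proof.
by move=> sg sh; apply/funext => x; apply: deriveD; exact: smooth2_derivable1.
Qed.

Lemma D2_add g h : smooth2 g -> smooth2 h ->
  D2 (fun x => g x + h x) = fun x => 'D_Defs.e2 g x + 'D_Defs.e2 h x.
Proof.
by move=> sg sh; apply/funext => x; apply: deriveD; exact: smooth2_derivable2.
Qed.

Lemma smooth2_iter1 a g : smooth2 g -> smooth2 (iter a D1 g).
Proof. by move=> sg; elim: a => //= a IH; exact: smooth2_D1. Qed.

Lemma smooth2_iter2 b g : smooth2 g -> smooth2 (iter b D2 g).
Proof. by move=> sg; elim: b => //= b IH; exact: smooth2_D2. Qed.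

Lemma mixed_partial_add a b g h : smooth2 g -> smooth2 h ->
  mixed_partial a b (fun x => g x + h x) =
  fun x => mixed_partial a b g x + mixed_partial a b h x.
Proof.
move=> sg sh; rewrite /mixed_partial.
have -> : iter b D2 (fun x => g x + h x) = fun x => iter b D2 g x + iter b D2 h x.
  elim: b => //= b ->; apply: D2_add; exact: smooth2_iter2.
elim: a => //= a ->; apply: D1_add; apply: smooth2_iter1; exact: smooth2_iter2.
Qed.

(** A quantitative Leibniz rule: pointwise bounds on the derivatives, with
    weights, multiply up to a power of two.  The weights make it usable both
    for decaying and for merely bounded factors. *)
Lemma mixed_partial_mul_le a b g h x (V W A B : R) :
  smooth2 g -> smooth2 h -> 0 <= V -> 0 <= W ->
  (forall i j, (i <= a)%N -> (j <= b)%N -> V * `|mixed_partial i j g x| <= A) ->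
  (forall i j, (i <= a)%N -> (j <= b)%N -> W * `|mixed_partial i j h x| <= B) ->
  V * W * `|mixed_partial a b (fun x => g x * h x) x| <= 2 ^+ (a + b) * (A * B).
Proof.
move=> sg sh V0 W0; elim: b g h sg sh => [|b IHb] g h sg sh.
- rewrite addn0; elim: a g h sg sh => [|a IHa] g h sg sh gA hB.
    have := gA 0%N 0%N isT isT; have := hB 0%N 0%N isT isT.
    rewrite /mixed_partial/= mul1r normrM => h2 h1.
    by rewrite mulrACA; apply: ler_pM => //; rewrite mulr_ge0.
  rewrite /mixed_partial [iter 0 _ _]/= iterSr D1_mul//.
  have := mixed_partial_add a 0 (smooth2_mul (smooth2_D1 sg) sh)
                                (smooth2_mul sg (smooth2_D1 sh)).
  rewrite /mixed_partial [iter 0 _ _]/= => ->.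
  apply: (@le_trans _ _ (2 ^+ a * (A * B) + 2 ^+ a * (A * B))); last first.
    by rewrite exprS; lra.
  apply: (@le_trans _ _ (V * W * (`|mixed_partial a 0 (fun x => 'D_Defs.e1 g x * h x) x| +
    `|mixed_partial a 0 (fun x => g x * 'D_Defs.e1 h x) x|))).
    by apply: ler_wpM2l; [exact: mulr_ge0|exact: ler_normD].
  rewrite mulrDr; apply: lerD; apply: IHa => //; try exact: smooth2_D1.
  + by move=> i j ia j0; have := gA i.+1 j ia j0; rewrite /mixed_partial; case: j j0 => // _; rewrite iterSr.
  + by move=> i j ia j0; apply: hB => //; exact: leqW.
  + by move=> i j ia j0; apply: gA => //; exact: leqW.
  + by move=> i j ia j0; have := hB i.+1 j ia j0; rewrite /mixed_partial; case: j j0 => // _; rewrite iterSr.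
- move=> gA hB; rewrite /mixed_partial iterSr D2_mul//.
  have := mixed_partial_add a b (smooth2_mul (smooth2_D2 sg) sh)
                                (smooth2_mul sg (smooth2_D2 sh)).
  rewrite /mixed_partial => ->.
  apply: (@le_trans _ _ (2 ^+ (a + b) * (A * B) + 2 ^+ (a + b) * (A * B))); last first.
    by rewrite addnS exprS; lra.
  apply: (@le_trans _ _ (V * W * (`|mixed_partial a b (fun x => 'D_Defs.e2 g x * h x) x| +
    `|mixed_partial a b (fun x => g x * 'D_Defs.e2 h x) x|))).
    by apply: ler_wpM2l; [exact: mulr_ge0|exact: ler_normD].
  rewrite mulrDr; apply: lerD; apply: IHb => //; try exact: smooth2_D2.
  + by move=> i j ia jb; have := gA i j.+1 ia jb; rewrite /mixed_partial iterSr.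
  + by move=> i j ia jb; apply: hB => //; exact: leqW.
  + by move=> i j ia jb; apply: gA => //; exact: leqW.
  + by move=> i j ia jb; have := hB i j.+1 ia jb; rewrite /mixed_partial iterSr.
Qed.

(** Locality of the derivatives, in the form used for supports. *)
Lemma mixed_partial_eq0 (U : set (R * R)) g a b : open U ->
  (forall x, U x -> g x = 0) -> forall x, U x -> mixed_partial a b g x = 0.
Proof.
move=> oU gU.
have D0 v (h : R * R -> R) : (forall x, U x -> h x = 0) ->
    forall x, U x -> 'D_v h x = 0.
  move=> hU x Ux; rewrite -[RHS](@derive_cst _ _ _ (0 : R) x v).
  apply: near_eq_derive.
  by near=> y; rewrite hU//; near: y; exact: open_nbhs_nbhs.
have H2 : forall x, U x -> iter b D2 g x = 0 by elim: b => //= b IH; exact: D0.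
by rewrite /mixed_partial; elim: a => //= a IH; exact: D0.
Unshelve. all: by end_near. Qed.

(** Ridge functions: all the functions of two variables used below are products
    of functions of one linear form, whose partial derivatives are explicit. *)
Section ridge.
Variables (U : nat -> R -> R).
Hypothesis dU : forall j t, is_derive (t : R) 1 (U j) (U j.+1 t).
Variables (al be c : R).

Definition ridge j x := U j (al * x.1 + be * x.2 + c).

Lemma is_derive_line g x v (V : R -> R) d :
  (forall s : R, g (s *: v + x) = V s) -> is_derive (0 : R) 1 V d ->
  is_derive x v g d.
Proof.
move=> gV [exV dV].
have E : (fun s : R => s^-1 *: ((g \o shift x) (s *: v) - g x)) =
         (fun s : R => s^-1 *: ((V \o shift 0) (s *: 1) - V 0)).
  apply/funext => s /=; rewrite gV -(gV 0) scale0r add0r.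
  by rewrite addr0 [s *: 1]mulr1.
by apply: DeriveDef; rewrite ?/derivable /derive E.
Qed.

Lemma is_derive_ridge1 j x :
  is_derive x Defs.e1 (ridge j) (al * ridge j.+1 x).
Proof.
apply: (@is_derive_line _ _ _ (fun s => U j (al * (s + x.1) + be * x.2 + c))).
  by move=> s; rewrite /ridge /=; congr (U j (_ * (_ + _) + _ * _ + _));
    rewrite /GRing.scale/= ?mulr1 ?mulr0 ?add0r.
have := dU j (al * (0 + x.1) + be * x.2 + c) => ?.
apply: is_derive_eq; rewrite /GRing.scale/= /ridge !add0r; ring.
Qed.

Lemma is_derive_ridge2 j x :
  is_derive x Defs.e2 (ridge j) (be * ridge j.+1 x).
Proof.
apply: (@is_derive_line _ _ _ (fun s => U j (al * x.1 + be * (s + x.2) + c))).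
  by move=> s; rewrite /ridge /=; congr (U j (_ * _ + _ * (_ + _) + _));
    rewrite /GRing.scale/= ?mulr1 ?mulr0 ?add0r.
have := dU j (al * x.1 + be * (0 + x.2) + c) => ?.
apply: is_derive_eq; rewrite /GRing.scale/= /ridge !add0r; ring.
Qed.

Lemma continuous_ridge j : continuous (ridge j).
Proof.
move=> x; rewrite /ridge.
apply: (cvg_comp (fun x : R * R => al * x.1 + be * x.2 + c) (U j)).
  apply: cvgD; last exact: cvg_cst.
  by apply: cvgD; apply: cvgM; [exact: cvg_cst|exact: cvg_fst|exact: cvg_cst|exact: cvg_snd].
exact: (is_derive_continuous (dU j)).
Qed.

Lemma D1_ridge j C : D1 (fun x => C * ridge j x) = fun x => C * al * ridge j.+1 x.
Proof.
apply/funext => x; have ? := is_derive_ridge1 j x.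
rewrite -mulrA; apply: (@derive_val _ _ _ _ _ (fun x => C * ridge j x)).
Qed.

Lemma D2_ridge j C : D2 (fun x => C * ridge j x) = fun x => C * be * ridge j.+1 x.
Proof.
apply/funext => x; have ? := is_derive_ridge2 j x.
rewrite -mulrA; apply: (@derive_val _ _ _ _ _ (fun x => C * ridge j x)).
Qed.

Lemma Ck_ridge k j C : Ck k (fun x => C * ridge j x).
Proof.
elim: k j C => [|k IH] j C.
  by split; [move=> x; apply: cvgMl_tmp; exact: continuous_ridge|].
split; first by move=> x; apply: cvgMl_tmp; exact: continuous_ridge.
split.
- move=> x; have ? := is_derive_ridge1 j x.
  have ? := @is_deriveZ _ _ _ (ridge j) C x Defs.e1 _ _.
  exact: (@ex_derive _ _ _ _ _ (fun x => C * ridge j x)).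
- move=> x; have ? := is_derive_ridge2 j x.
  have ? := @is_deriveZ _ _ _ (ridge j) C x Defs.e2 _ _.
  exact: (@ex_derive _ _ _ _ _ (fun x => C * ridge j x)).
- by rewrite D1_ridge; exact: IH.
- by rewrite D2_ridge; exact: IH.
Qed.

Lemma smooth2_ridge j : smooth2 (ridge j).
Proof.
move=> k; have := Ck_ridge k j 1.
by rewrite (_ : (fun x => 1 * ridge j x) = ridge j)//; apply/funext => x; rewrite mul1r.
Qed.

Lemma mixed_partial_ridge a b j :
  mixed_partial a b (ridge j) = fun x => al ^+ a * be ^+ b * ridge (j + a + b) x.
Proof.
rewrite /mixed_partial.
have -> : iter b D2 (ridge j) = fun x => be ^+ b * ridge (j + b) x.
  elim: b => [|b IH] /=; first by apply/funext => x; rewrite mul1r addn0.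
  by rewrite IH D2_ridge; apply/funext => x; rewrite exprSr addnS.
elim: a => [|a IH] /=; first by apply/funext => x; rewrite mul1r addn0.
rewrite IH D1_ridge; apply/funext => x.
by rewrite addnS addSn exprSr; congr (_ * _); ring.
Qed.

End ridge.
End smooth_plane.

(** * Smooth functions of one variable and cutoffs *)
Section smooth_line.
Context {R : realType}.

Fixpoint Cn (k : nat) (u : R -> R) : Prop :=
  if k is k'.+1 then
    exists2 u', (forall t : R, is_derive t 1 u (u' t)) & Cn k' u'
  else True.

Lemma CnW k u : Cn k.+1 u -> Cn k u.
Proof. by elim: k u => // k IH u [u' du /IH cu]; exists u'. Qed.

Lemma Cn_add k u v : Cn k u -> Cn k v -> Cn k (fun t => u t + v t).
Proof.
elim: k u v => // k IH u v [u' du cu] [v' dv cv].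
exists (fun t => u' t + v' t); last exact: IH.
by move=> t; have ? := du t; have ? := dv t; exact: is_deriveD.
Qed.

Lemma Cn_mul k u v : Cn k u -> Cn k v -> Cn k (fun t => u t * v t).
Proof.
elim: k u v => // k IH u v cu cv; have cu' := CnW cu; have cv' := CnW cv.
move: cu cv => [u' du cu] [v' dv cv].
exists (fun t => u t * v' t + u' t * v t); last by apply: Cn_add; exact: IH.
move=> t; have ? := du t; have ? := dv t.
by apply: is_derive_eq; rewrite /GRing.scale/= (mulrC (v t)).
Qed.

Lemma Cn_comp k u v : Cn k u -> Cn k v -> Cn k (fun t => u (v t)).
Proof.
elim: k u v => // k IH u v cu cv; have cv' := CnW cv.
move: cu cv => [u' du cu] [v' dv cv].
exists (fun t => u' (v t) * v' t); last by apply: Cn_mul => //; exact: IH.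
move=> t; have ? := du (v t); have ? := dv t; exact: is_derive1_comp.
Qed.

Lemma Cn_affine k (al c : R) : Cn k (fun t => al * t + c).
Proof.
have cst_Cn j (d : R) : Cn j (cst d).
  by elim: j d => // j IH d; exists (cst 0) => // t; exact: is_derive_cst.
case: k => // k; exists (cst al); last exact: cst_Cn.
by move=> t; apply: is_derive_eq; rewrite /GRing.scale/=; ring.
Qed.

(** A function together with all its successive derivatives. *)
Definition smooth_seq (U : nat -> R -> R) :=
  forall j (t : R), is_derive t 1 (U j) (U j.+1 t).

Lemma smooth_seq_Cn U k j : smooth_seq U -> Cn k (U j).
Proof. by move=> dU; elim: k j => // k IH j; exists (U j.+1). Qed.

Lemma Cn_smooth_seq u : (forall k, Cn k u) ->
  smooth_seq (fun j => derive1n j u).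
Proof.
move=> cu j t.
have : Cn j.+1 u by [].
elim: j u cu t => [|j IH] u cu t [u' du cu'].
  rewrite derive1nS derive1E; have ? := du t; exact: DeriveDef.
have u'E : u^`()%classic = u'.
  by apply/funext => s; rewrite derive1E; have ? := du s; exact: derive_val.
rewrite (derive1Sn u j.+1) (derive1Sn u j) u'E; apply: IH => // k.
have [w dw cw] := cu k.+1; rewrite -u'E.
suff -> : u^`()%classic = w by [].
by apply/funext => s; rewrite derive1E; have ? := dw s; exact: derive_val.
Qed.

Lemma smooth_seq_eq_on (U : nat -> R -> R) (A : set R) (d : R) :
  smooth_seq U -> open A -> (forall t, A t -> U 0%N t = d) ->
  forall j t, A t -> U j.+1 t = 0.
Proof.
move=> dU oA UA.
have D0 j e : (forall t, A t -> U j t = e) -> forall t, A t -> U j.+1 t = 0.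
  move=> H t At; have ? := dU j t.
  have <- : 'D_1 (U j) t = U j.+1 t by exact: derive_val.
  rewrite -[RHS](@derive_cst _ _ _ e t 1); apply: near_eq_derive.
  by near=> y; rewrite H//; near: y; exact: open_nbhs_nbhs.
by elim=> [|j IH]; [exact: (D0 0%N d)|exact: (D0 j.+1 0)].
Unshelve. all: by end_near. Qed.

(** ** The flat function exp(-1/t) *)

Fixpoint flat_poly (j : nat) : {poly R} :=
  if j is j'.+1 then 'X^2 * (flat_poly j' - (flat_poly j')^`()) else 1.

Definition flat (j : nat) (t : R) : R :=
  if 0 < t then (flat_poly j).[t^-1] * expR (- t^-1) else 0.

Lemma expn_expR_le (n : nat) (y : R) : 0 < y ->
  y ^+ n * expR (- y) <= (n.+1)`!%:R / y.
Proof.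
move=> y0; have h := expR_ge1Dxn n (ltW y0).
rewrite expRN ler_pdivlMr// mulrAC -exprSr ler_pdivrMr ?expR_gt0//.
have f0 : 0 < (n.+1)`!%:R :> R by rewrite ltr0n fact_gt0.
rewrite -ler_pdivrMl// mulrC; apply: le_trans h.
by rewrite lerDr.
Qed.

Lemma poly_expR_le (p : {poly R}) : exists2 M : R, 0 <= M &
  forall y, 0 < y -> `|p.[y] * expR (- y)| <= M / y.
Proof.
exists (\sum_(i < size p) `|p`_i| * (i.+1)`!%:R).
  by apply: sumr_ge0 => i _; rewrite mulr_ge0.
move=> y y0; rewrite horner_coef !mulr_suml.
apply: le_trans (ler_norm_sum _ _ _) _; apply: ler_sum => i _.
rewrite -!mulrA normrM ler_wpM2l//.
rewrite ger0_norm; first exact: expn_expR_le.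
by rewrite mulr_ge0 ?expR_ge0 ?exprn_ge0// ltW.
Qed.

Lemma is_derive_horner (p : {poly R}) (t : R) :
  is_derive t 1 (horner p) p^`().[t].
Proof. by apply: DeriveDef; [exact: derivable_horner|rewrite derivE derive1E]. Qed.

Lemma is_derive0_quad (f : R -> R) (M : R) :
  (forall s, `|f s| <= M * s ^+ 2) -> is_derive (0 : R) 1 f 0.
Proof.
move=> fM.
have f0 : f 0 = 0.
  by apply/eqP; rewrite -normr_le0 (le_trans (fM 0))// expr0n/= mulr0.
have lim0 : (fun h : R => h^-1 *: ((f \o shift 0) (h *: 1) - f 0)) @ 0^' --> (0 : R).
  apply: norm_cvg0.
  apply: (@squeeze_cvgr _ _ _ _ (cst 0) (fun h : R => `|M| * `|h|)).
  - near=> h; rewrite /= addr0 f0 subr0 normr_ge0/=.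
    have h0 : h != 0 by near: h; exact: nbhs_dnbhs_neq.
    rewrite /GRing.scale/= mulr1 normrM normfV ler_pdivrMl ?normr_gt0//.
    apply: le_trans (fM h) _; apply: le_trans (ler_norm _) _.
    by rewrite normrM normrX expr2 mulrCA.
  - exact: cvg_cst.
  - rewrite -[X in _ --> X](mulr0 `|M|); apply: cvgMl_tmp.
    rewrite -[X in _ --> X](@normr0 _ R); apply: cvg_norm.
    exact: (cvg_within_filter _).
by apply: DeriveDef; [apply/cvg_ex; exists 0|exact: cvg_lim].
Unshelve. all: by end_near. Qed.

Lemma flat_smooth : smooth_seq flat.
Proof.
move=> j t; have [t0|t0|t0] := ltgtP t 0.
- rewrite [flat j.+1 t](_ : _ = 0); last by rewrite /flat ltNge ltW.
  have dc : is_derive t 1 (cst (0 : R)) (0 : R) by exact: is_derive_cst.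
  apply: near_eq_is_derive dc.
  near=> s; rewrite /flat ltNge.
  suff -> : s <= 0 by [].
  by apply: ltW; near: s; exact: lt_nbhsl.
- pose G (s : R) := (flat_poly j).[s^-1] * expR (- s^-1).
  apply: (@near_eq_is_derive _ _ _ G).
    near=> s; rewrite /flat /G ifT//.
    by near: s; exact: lt_nbhsr.
  rewrite /flat t0 /G.
  have tn0 : t != 0 by rewrite gt_eqF.
  have dV : is_derive t 1 (fun s : R => s^-1) (- t ^- 2).
    have := @is_deriveV _ id t 1 1 tn0 (is_derive_id t 1).
    by rewrite /GRing.scale/= mulr1.
  have dH : is_derive t 1 (fun s : R => (flat_poly j).[s^-1])
      ((flat_poly j)^`().[t^-1] * - t ^- 2).
    exact: (@is_derive1_comp _ (horner (flat_poly j)) _ _ _ _ (is_derive_horner _ _) dV).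
  apply: is_derive_eq; rewrite /GRing.scale/= !hornerE /= exprVn; ring.
- rewrite t0 /flat ltxx.
  have [M M0 hM] := poly_expR_le ('X * flat_poly j).
  apply: (@is_derive0_quad _ M) => s; rewrite /flat.
  case: ifPn => s0; last by rewrite normr0 mulr_ge0 ?sqr_ge0.
  have y0 : 0 < s^-1 by rewrite invr_gt0.
  have := hM _ y0; rewrite hornerM hornerX invrK -mulrA normrM gtr0_norm//.
  rewrite ler_pdivrMl// => /le_trans; apply.
  by rewrite expr2 mulrCA.
Unshelve. all: by end_near. Qed.

Lemma flat0E (t : R) : flat 0 t = if 0 < t then expR (- t^-1) else 0.
Proof. by rewrite /flat /= hornerE mul1r. Qed.

Lemma flat_gt0 (t : R) : 0 < t -> 0 < flat 0 t.
Proof. by move=> t0; rewrite flat0E t0 expR_gt0. Qed.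

Lemma flat_le (s t : R) : s <= t -> flat 0 s <= flat 0 t.
Proof.
move=> st; rewrite !flat0E; case: ifPn => s0; last by case: ifP => // _; exact: expR_ge0.
have t0 : 0 < t by exact: lt_le_trans st.
by rewrite t0 ler_expR lerN2 lef_pV2.
Qed.

(** A cutoff is obtained by composing the flat function with itself: it is
    constant where the inner function vanishes, and vanishes where the inner
    function exceeds its value at [b]. *)
Lemma cutoff_exists (a b : R) : a < b -> exists U : nat -> R -> R,
  [/\ smooth_seq U, forall t, t <= a -> U 0%N t = 1,
      forall t, b <= t -> U 0%N t = 0,
      forall j t, b <= t -> U j t = 0 &
      forall N, exists2 M : R, 0 <= M & forall j t, (j <= N)%N -> `|U j t| <= M].
Proof.
move=> ab.
pose d := flat 0 (b - a).
have d0 : 0 < d by apply: flat_gt0; rewrite subr_gt0.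
have fd0 : 0 < flat 0 d by exact: flat_gt0.
pose u (t : R) := (flat 0 d)^-1 * flat 0 (d - flat 0 (t - a)).
have cu k : Cn k u.
  pose w1 (t : R) := 1 * t + - a.
  pose w2 (t : R) := (- 1) * t + d.
  pose w3 (t : R) := (flat 0 d)^-1 * t + 0.
  have -> : u = fun t => w3 (flat 0 (w2 (flat 0 (w1 t)))).
    apply/funext => t; rewrite /u /w3 /w2 /w1 addr0 mul1r mulN1r.
    by rewrite [- _ + d]addrC.
  apply: Cn_comp; first exact: Cn_affine.
  apply: Cn_comp; first by apply: smooth_seq_Cn; exact: flat_smooth.
  apply: Cn_comp; first exact: Cn_affine.
  apply: Cn_comp; first by apply: smooth_seq_Cn; exact: flat_smooth.
  exact: Cn_affine.
pose U j : R -> R := derive1n j u.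
have sU : smooth_seq U := Cn_smooth_seq cu.
have Ua t : t <= a -> U 0%N t = 1.
  move=> ta; rewrite /U /= /u [flat 0 (t - a)]flat0E ltNge subr_le0 ta/= subr0.
  by rewrite mulVf// gt_eqF.
have Ub t : b <= t -> U 0%N t = 0.
  move=> bt; rewrite /U /= /u [flat 0 (d - _)]flat0E ifN ?mulr0//.
  by rewrite -leNgt subr_le0; apply: flat_le; rewrite lerB.
have Ub' j t : b < t -> U j.+1 t = 0.
  move=> bt; exact: (@smooth_seq_eq_on U [set s : R | b < s] 0 sU (@open_gt R b) (fun s h => Ub s (ltW h)) j t bt).
have Ua' j t : t < a -> U j.+1 t = 0.
  move=> ta; exact: (@smooth_seq_eq_on U [set s : R | s < a] 1 sU (@open_lt R a) (fun s h => Ua s (ltW h)) j t ta).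
have cU j : continuous (U j) by exact: (is_derive_continuous (sU j)).
have Ub0 j t : b <= t -> U j t = 0.
  case: j => [|j]; first exact: Ub.
  rewrite le_eqVlt => /predU1P[<-|]; last exact: Ub'.
  (* the derivatives vanish at the endpoint by continuity *)
  have lim0 : b + n.+1%:R^-1 @[n --> \oo] --> b.
    by rewrite -[X in _ --> X]addr0; apply: cvgD; [exact: cvg_cst|exact: cvg_harmonic].
  have lim1 : U j.+1 (b + n.+1%:R^-1) @[n --> \oo] --> U j.+1 b.
    exact: (cvg_comp _ _ lim0 (cU j.+1 b)).
  apply: (cvg_unique _ lim1); first exact: norm_hausdorff.
  rewrite (_ : (fun n : nat => _) = cst 0); first exact: cvg_cst.
  by apply/funext => n; rewrite Ub' // ltrDl invr_gt0.
exists U; split => //.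
have bj j : exists2 M : R, 0 <= M & forall t, `|U j t| <= M.
  have a1b1 : a - 1 <= b + 1 by lra.
  have cn : {within `[a - 1, b + 1], continuous (fun t => `|U j t|)}.
    by apply: continuous_subspaceT => t; apply: cvg_norm; exact: cU.
  have [c _ cmax] := EVT_max a1b1 cn.
  exists (1 + `|U j c|) => [|t]; first by rewrite addr_ge0.
  have [t1|t1] := ltP t (a - 1).
    case: j {cn cmax} => [|j]; last by rewrite Ua' ?normr0 ?addr_ge0//; lra.
    by rewrite Ua ?normr1 ?lerDl//; lra.
  have [t2|t2] := ltP (b + 1) t.
    by rewrite Ub0 ?normr0 ?addr_ge0//; lra.
  by rewrite ler_wpDl// cmax// in_itv/= t1 t2.
elim=> [|N [M M0 hM]].
  by have [M M0 hM] := bj 0%N; exists M => // j t; rewrite leqn0 => /eqP ->.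
have [M' M'0 hM'] := bj N.+1; exists (M + M'); first exact: addr_ge0.
move=> j t; rewrite leq_eqVlt ltnS => /predU1P[->|jN].
  by rewrite ler_wpDl// hM'.
by rewrite ler_wpDr// hM.
Qed.
End smooth_line.

(** * Schwartz functions *)
Section schwartz_functions.
Context {R : realType}.
Implicit Types (g h u v : R * R -> R).

Definition rschwartz g := smooth2 g /\ forall N, exists M : R,
  forall m n a b x, (m <= N)%N -> (n <= N)%N -> (a <= N)%N -> (b <= N)%N ->
    `|x.1| ^+ m * `|x.2| ^+ n * `|mixed_partial a b g x| <= M.

(** One factor carries the weight, the other one is merely bounded. *)
Lemma seminorm_mul_le (N : nat) g h x (A M : R) m n a b :
  smooth2 g -> smooth2 h ->
  (forall i j, (i <= N)%N -> (j <= N)%N -> `|mixed_partial i j g x| <= A) ->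
  (forall i j, (i <= N)%N -> (j <= N)%N ->
     `|x.1| ^+ m * `|x.2| ^+ n * `|mixed_partial i j h x| <= M) ->
  (a <= N)%N -> (b <= N)%N ->
  `|x.1| ^+ m * `|x.2| ^+ n * `|mixed_partial a b (fun x => g x * h x) x| <=
    2 ^+ (N + N) * (A * M).
Proof.
move=> sg sh gA hM aN bN.
have A0 : 0 <= A by apply: le_trans (gA 0%N 0%N isT isT).
have W0 : 0 <= `|x.1| ^+ m * `|x.2| ^+ n by rewrite mulr_ge0.
have M0 : 0 <= M by apply: le_trans (hM 0%N 0%N isT isT); rewrite mulr_ge0.
have := @mixed_partial_mul_le _ a b g h x 1 _ A M sg sh ler01 W0.
rewrite mul1r => H; apply: le_trans (H _ _) _.
- by move=> i j ia jb; rewrite mul1r; apply: gA; [exact: leq_trans aN|exact: leq_trans bN].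
- by move=> i j ia jb; apply: hM; [exact: leq_trans aN|exact: leq_trans bN].
by apply: ler_wpM2r; [exact: mulr_ge0|rewrite ler_eXn2l ?ltr1n// leq_add].
Qed.

(** Smooth functions all of whose derivatives are bounded: they multiply the
    Schwartz space into itself. *)
Definition bsmooth g := smooth2 g /\ forall N, exists A : R,
  forall a b x, (a <= N)%N -> (b <= N)%N -> `|mixed_partial a b g x| <= A.

Lemma rschwartz_mul g h : bsmooth g -> rschwartz h -> rschwartz (fun x => g x * h x).
Proof.
move=> [sg bg] [sh bh]; split; first exact: smooth2_mul.
move=> N; have [A gA] := bg N; have [M hM] := bh N.
exists (2 ^+ (N + N) * (A * M)) => m n a b x mN nN aN bN.
apply: seminorm_mul_le => // [i j iN jN|i j iN jN]; first exact: gA.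
exact: hM.
Qed.

Lemma bsmooth_mul g h : bsmooth g -> bsmooth h -> bsmooth (fun x => g x * h x).
Proof.
move=> [sg bg] [sh bh]; split; first exact: smooth2_mul.
move=> N; have [A gA] := bg N; have [M hM] := bh N.
exists (2 ^+ (N + N) * (A * M)) => a b x aN bN.
have := @seminorm_mul_le N g h x A M 0 0 a b sg sh.
rewrite !expr0 !mul1r; apply => //; first by move=> i j *; exact: gA.
by move=> i j *; rewrite mul1r; exact: hM.
Qed.

Lemma ridge_deriv_le (U : nat -> R -> R) (al be c B : R) N : smooth_seq U ->
  1 <= B -> `|al| <= B -> `|be| <= B ->
  forall x (A : R), (forall j, (j <= N + N)%N -> `|U j (al * x.1 + be * x.2 + c)| <= A) ->
  forall a b, (a <= N)%N -> (b <= N)%N ->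
    `|mixed_partial a b (ridge U al be c 0) x| <= B ^+ (N + N) * A.
Proof.
move=> sU B1 alB beB x A UA a b aN bN.
have B0 : 0 <= B by rewrite (le_trans ler01).
rewrite (mixed_partial_ridge sU) add0n normrM; apply: ler_pM => //.
  rewrite normrM !normrX; apply: (@le_trans _ _ (B ^+ a * B ^+ b)).
    by apply: ler_pM; rewrite ?exprn_ge0// ?lerXn2r ?nnegrE.
  rewrite -exprD; apply: ler_weXn2l => //; exact: leq_add.
by apply: UA; exact: leq_add.
Qed.

Lemma bsmooth_ridge (U : nat -> R -> R) (al be c : R) : smooth_seq U ->
  (forall N, exists2 M : R, 0 <= M & forall j t, (j <= N)%N -> `|U j t| <= M) ->
  bsmooth (ridge U al be c 0).
Proof.
move=> sU bU; split; first exact: (smooth2_ridge _).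
move=> N; have [M M0 hM] := bU (N + N)%N.
pose B := 1 + `|al| + `|be|.
exists (B ^+ (N + N) * M) => a b x aN bN.
have ? : 0 <= `|al| by []. have ? : 0 <= `|be| by [].
apply: (@ridge_deriv_le U al be c B N sU) => //; rewrite /B; try lra.
by move=> j jN; exact: hM.
Qed.

(** ** Gaussians *)

Fixpoint gauss_poly (c : R) (j : nat) : {poly R} :=
  if j is j'.+1 then (gauss_poly c j')^`() - (2 * c) *: ('X * gauss_poly c j')
  else 1.

Definition gauss_seq (c : R) (j : nat) (t : R) : R :=
  (gauss_poly c j).[t] * expR (- (c * t ^+ 2)).

Lemma gauss_seq_smooth c : smooth_seq (gauss_seq c).
Proof.
move=> j t; rewrite /gauss_seq.
have dH := is_derive_horner (gauss_poly c j) t.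
have dE : is_derive t 1 (fun t : R => expR (- (c * t ^+ 2)))
   (expR (- (c * t ^+ 2)) * - (2 * c * t)).
  by apply: is_derive_eq; rewrite /GRing.scale/=; ring.
have := @is_deriveM _ _ _ _ t 1 _ _ dH dE.
rewrite /GRing.scale/= => D.
apply: (is_derive_eq D); rewrite hornerD hornerN hornerZ hornerM hornerX; ring.
Qed.

Lemma gauss_seq0 c (t : R) : gauss_seq c 0 t = expR (- (c * t ^+ 2)).
Proof. by rewrite /gauss_seq /= hornerE mul1r. Qed.

Lemma expr_gauss_le (c : R) (k : nat) : 0 < c -> exists2 M : R, 0 <= M &
  forall t, `|t| ^+ k * expR (- (c * t ^+ 2)) <= M.
Proof.
move=> c0; exists (1 + k`!%:R / c ^+ k).
  by rewrite addr_ge0// divr_ge0// exprn_ge0// ltW.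
move=> t; set y := c * t ^+ 2.
have y0 : 0 <= y by rewrite mulr_ge0 ?sqr_ge0// ltW.
have e1 : expR (- y) <= 1 by rewrite -expR0 ler_expR oppr_le0.
have e0 : 0 <= expR (- y) by exact: expR_ge0.
have yk : y ^+ k * expR (- y) <= k`!%:R.
  have f0 : 0 < k`!%:R :> R by rewrite ltr0n fact_gt0.
  rewrite expRN ler_pdivrMr ?expR_gt0// -ler_pdivrMl//.
  case: k f0 => [|k] f0; first by rewrite expr0 invr1 mulr1 -expR0 ler_expR.
  by rewrite mulrC; apply: le_trans (expR_ge1Dxn k y0); rewrite lerDr.
have tk : `|t| ^+ k <= 1 + `|t| ^+ k * `|t| ^+ k.
  set s := `|t| ^+ k.
  have ? : 0 <= s by rewrite exprn_ge0.
  by have : 0 <= (s - 1) ^+ 2 by [rewrite sqr_ge0]; nra.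
apply: (@le_trans _ _ ((1 + `|t| ^+ k * `|t| ^+ k) * expR (- y))).
  by apply: ler_wpM2r.
rewrite mulrDl mul1r; apply: lerD => //.
rewrite ler_pdivlMr ?exprn_gt0//.
have -> : `|t| ^+ k * `|t| ^+ k * expR (- y) * c ^+ k = y ^+ k * expR (- y).
  rewrite /y exprMn -exprM mulnC exprM -exprMn -normrM -expr2 ger0_norm ?sqr_ge0//.
  by rewrite -[in RHS]exprM mulnC exprM; ring.
exact: yk.
Qed.

(** Every derivative of a Gaussian is a polynomial times the Gaussian. *)
Lemma gauss_seq_decay (c : R) (m j : nat) : 0 < c -> exists2 M : R, 0 <= M &
  forall t, `|t| ^+ m * `|gauss_seq c j t| <= M.
Proof.
move=> c0; rewrite /gauss_seq; set p := gauss_poly c j.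
pose K i := sval (cid2 (expr_gauss_le (m + i) c0)).
have K0 i : 0 <= K i by rewrite /K; case: cid2.
have KP i t : `|t| ^+ (m + i) * expR (- (c * t ^+ 2)) <= K i.
  by rewrite /K; case: cid2.
exists (\sum_(i < size p) `|p`_i| * K i).
  by apply: sumr_ge0 => i _; rewrite mulr_ge0.
move=> t; rewrite horner_coef mulr_suml.
apply: (@le_trans _ _ (`|t| ^+ m * \sum_(i < size p) `|p`_i * t ^+ i * expR (- (c * t ^+ 2))|)).
  by apply: ler_wpM2l; [exact: exprn_ge0|exact: ler_norm_sum].
rewrite mulr_sumr; apply: ler_sum => i _.
rewrite !normrM (ger0_norm (expR_ge0 _)) normrX.
rewrite [leLHS](_ : _ = `|p`_i| * (`|t| ^+ (m + i) * expR (- (c * t ^+ 2)))).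
  by apply: ler_wpM2l.
by rewrite exprD; ring.
Qed.

Lemma gauss_seq_decay_le (c : R) (N : nat) : 0 < c -> exists2 M : R, 0 <= M &
  forall m j t, (m <= N)%N -> (j <= N)%N -> `|t| ^+ m * `|gauss_seq c j t| <= M.
Proof.
move=> c0.
pose K m j := sval (cid2 (gauss_seq_decay m j c0)).
have K0 m j : 0 <= K m j by rewrite /K; case: cid2.
have KP m j t : `|t| ^+ m * `|gauss_seq c j t| <= K m j.
  by rewrite /K; case: cid2.
exists (\sum_(m < N.+1) \sum_(j < N.+1) K m j).
  by apply: sumr_ge0 => m _; apply: sumr_ge0.
move=> m j t mN jN; apply: le_trans (KP m j t) _.
rewrite (bigD1 (@Ordinal N.+1 m mN))//= (bigD1 (@Ordinal N.+1 j jN))//= -addrA lerDl.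
by rewrite addr_ge0// sumr_ge0// => ? _; rewrite sumr_ge0.
Qed.

Lemma gauss_seq_shift_decay (c q : R) (N : nat) : 0 < c -> exists2 M : R, 0 <= M &
  forall m j t, (m <= N)%N -> (j <= N)%N -> `|t| ^+ m * `|gauss_seq c j (t + q)| <= M.
Proof.
move=> c0; have [M M0 hM] := gauss_seq_decay_le N c0.
have q0 : 0 <= `|q| by [].
pose B := 2 ^+ N * (1 + `|q|) ^+ N.
have B0 : 0 <= B by rewrite mulr_ge0 ?exprn_ge0 ?addr_ge0.
exists (B * (M + M)) => [|m j t mN jN]; first by rewrite mulr_ge0 ?addr_ge0.
have tm : `|t| ^+ m <= B * (`|t + q| ^+ m + 1).
  have t1 : `|t| <= 2 * Num.max `|t + q| (1 + `|q|).
    have : `|t| <= `|t + q| + `|q|.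
      by rewrite -[leLHS]/(`|t|) -{1}(addrK q t); exact: ler_normB.
    have : `|t + q| <= Num.max `|t + q| (1 + `|q|) by rewrite le_max lexx.
    have : 1 + `|q| <= Num.max `|t + q| (1 + `|q|) by rewrite le_max lexx orbT.
    by lra.
  apply: (@le_trans _ _ ((2 * Num.max `|t + q| (1 + `|q|)) ^+ m)).
    by apply: lerXn2r => //; rewrite nnegrE mulr_ge0// le_max normr_ge0.
  have B1 : 1 <= 2 ^+ N * (1 + `|q|) ^+ N.
    by rewrite -[leLHS]mulr1; apply: ler_pM => //; rewrite exprn_ege1 ?ler1n// lerDl.
  have B2 : 2 ^+ m <= 2 ^+ N :> R by rewrite ler_weXn2l ?ler1n.
  have B3 : (1 + `|q|) ^+ m <= (1 + `|q|) ^+ N by rewrite ler_weXn2l ?lerDl.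
  have B4 : 1 <= (1 + `|q|) ^+ N by rewrite exprn_ege1 ?lerDl.
  rewrite /B exprMn -[leRHS]mulrA; apply: ler_pM => //.
  have [h|h] := leP `|t + q| (1 + `|q|).
    apply: (le_trans B3); rewrite ler_peMr ?exprn_ge0 ?addr_ge0//.
    by rewrite lerDr exprn_ge0.
  apply: (@le_trans _ _ (`|t + q| ^+ m + 1)); first by rewrite lerDl.
  by rewrite ler_peMl// addr_ge0// exprn_ge0.
apply: (@le_trans _ _ (B * (`|t + q| ^+ m + 1) * `|gauss_seq c j (t + q)|)).
  exact: ler_wpM2r.
rewrite -mulrA; apply: ler_wpM2l => //; rewrite mulrDl mul1r; apply: lerD.
  exact: hM.
by have := hM 0%N j (t + q) isT jN; rewrite expr0 mul1r.
Qed.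

Definition gauss2 (c : R) (q x : R * R) : R :=
  expR (- (c * (x.1 + q.1) ^+ 2)) * expR (- (c * (x.2 + q.2) ^+ 2)).

Lemma rschwartz_gauss2 (c : R) q : 0 < c -> rschwartz (gauss2 c q).
Proof.
move=> c0.
have sG := gauss_seq_smooth c.
have E : gauss2 c q =
    fun x => ridge (gauss_seq c) 1 0 q.1 0 x * ridge (gauss_seq c) 0 1 q.2 0 x.
  by apply/funext => x; rewrite /gauss2 /ridge !gauss_seq0 !mul1r !mul0r !addr0 add0r.
rewrite E; split; first by apply: smooth2_mul; exact: (smooth2_ridge _).
move=> N; have [M1 M10 hM1] := gauss_seq_shift_decay q.1 (N + N) c0.
have [M2 M20 hM2] := gauss_seq_shift_decay q.2 (N + N) c0.
exists (2 ^+ (N + N) * (M1 * M2)) => m n a b x mN nN aN bN.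
have := @mixed_partial_mul_le _ a b (ridge (gauss_seq c) 1 0 q.1 0) (ridge (gauss_seq c) 0 1 q.2 0) x
  (`|x.1| ^+ m) (`|x.2| ^+ n) M1 M2 (smooth2_ridge sG _ _ _ _) (smooth2_ridge sG _ _ _ _).
move=> H; apply: le_trans (H _ _ _ _) _; try exact: exprn_ge0.
- move=> i j ia jb; rewrite (mixed_partial_ridge sG) expr1n mul1r add0n.
  rewrite /ridge mul1r mul0r addr0 normrM normrX normr0 mulrCA.
  rewrite expr0n; case: j jb => [|j] jb /=; rewrite ?mul0r// mul1r addn0.
  apply: hM1; first by rewrite (leq_trans mN)// leq_addr.
  by rewrite (leq_trans (leq_trans ia aN))// leq_addr.
- move=> i j ia jb; rewrite (mixed_partial_ridge sG) expr1n mulr1 add0n.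
  rewrite /ridge mul1r mul0r add0r normrM normrX normr0 mulrCA.
  rewrite expr0n; case: i ia => [|i] ia /=; rewrite ?mul0r// mul1r add0n.
  apply: hM2; first by rewrite (leq_trans nN)// leq_addr.
  by rewrite (leq_trans (leq_trans jb bN))// leq_addr.
by apply: ler_wpM2r; [exact: mulr_ge0|rewrite ler_eXn2l ?ltr1n// leq_add].
Qed.

Lemma bsmooth_add g h : bsmooth g -> bsmooth h -> bsmooth (fun x => g x + h x).
Proof.
move=> [sg bg] [sh bh]; split; first exact: smooth2_add.
move=> N; have [A gA] := bg N; have [M hM] := bh N.
exists (A + M) => a b x aN bN; rewrite mixed_partial_add//.
by apply: le_trans (ler_normD _ _) _; apply: lerD; [exact: gA|exact: hM].
Qed.

Lemma bsmooth_cst (C : R) : bsmooth (fun=> C).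
Proof.
pose U (j : nat) (t : R) : R := if j is 0%N then C else 0.
have sU : smooth_seq U by case=> [|j] t; exact: is_derive_cst.
have -> : (fun=> C) = ridge U 0 0 0 0 by [].
apply: bsmooth_ridge => // N; exists `|C| => // -[|j] t _ /=; first exact: lexx.
by rewrite normr0.
Qed.

(** ** Complex-valued Schwartz functions *)

Definition cpair u v (x : R * R) : R[i] := (u x +i* v x)%C.

Lemma cabs_le (z : R[i]) : cabs z <= `|complex.Re z| + `|complex.Im z|.
Proof.
case: z => a b; rewrite /cabs /= -[leRHS]ger0_norm ?addr_ge0// -sqrtr_sqr.
apply: ler_wsqrtr; rewrite sqrrD !real_normK ?num_real//.
by rewrite addrAC lerDl mulrn_wge0// mulr_ge0.
Qed.

Lemma schwartz_cpair u v : rschwartz u -> rschwartz v -> schwartz (cpair u v).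
Proof.
move=> [su bu] [sv bv]; split; first by move=> k; split; [exact: su|exact: sv].
move=> N; have [M hM] := bu N; have [M' hM'] := bv N.
exists (M + M') => m n a b x mN nN aN bN.
apply: (@le_trans _ _ (`|x.1| ^+ m * `|x.2| ^+ n *
  (`|mixed_partial a b u x| + `|mixed_partial a b v x|))).
  by apply: ler_wpM2l; [rewrite mulr_ge0|exact: cabs_le].
by rewrite mulrDr; apply: lerD; [exact: hM|exact: hM'].
Qed.

Lemma seminorms_le_cpair N (M : R) u v :
  (forall m n a b x, (m <= N)%N -> (n <= N)%N -> (a <= N)%N -> (b <= N)%N ->
    `|x.1| ^+ m * `|x.2| ^+ n * `|mixed_partial a b u x| <= M) ->
  (forall m n a b x, (m <= N)%N -> (n <= N)%N -> (a <= N)%N -> (b <= N)%N ->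
    `|x.1| ^+ m * `|x.2| ^+ n * `|mixed_partial a b v x| <= M) ->
  seminorms_le N (M + M) (cpair u v).
Proof.
move=> hu hv m n a b x mN nN aN bN.
apply: (@le_trans _ _ (`|x.1| ^+ m * `|x.2| ^+ n *
  (`|mixed_partial a b u x| + `|mixed_partial a b v x|))).
  by apply: ler_wpM2l; [rewrite mulr_ge0|exact: cabs_le].
by rewrite mulrDr; apply: lerD; [exact: hu|exact: hv].
Qed.
End schwartz_functions.

(** * Tempered distributions of compact support *)
Section cabs_theory.
Context {R : realType}.
Implicit Types z w : R[i].

Lemma cabsD z w : cabs (z + w) <= cabs z + cabs w.
Proof.
have : ((cabs (z + w))%:C <= (cabs z)%:C + (cabs w)%:C)%C := ler_normD z w.
by rewrite -rmorphD lecR.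
Qed.

Lemma cabsM z w : cabs (z * w) = cabs z * cabs w.
Proof. exact: ComplexField.Normc.normcM. Qed.

Lemma cabs0 : cabs (0 : R[i]) = 0.
Proof. exact: ComplexField.Normc.normc0. Qed.

Lemma cabs_eq0 z : cabs z = 0 -> z = 0.
Proof. exact: ComplexField.Normc.eq0_normc. Qed.

Lemma cabs_ge0 z : 0 <= cabs z.
Proof. by case: z => a b; exact: sqrtr_ge0. Qed.

Lemma cabsR (r : R) : cabs (r%:C)%C = `|r|.
Proof. by rewrite /cabs /= expr0n/= addr0 sqrtr_sqr. Qed.

Lemma cabsN z : cabs (- z) = cabs z.
Proof. by case: z => a b; rewrite /cabs /= !sqrrN. Qed.

Lemma cabsB z w : cabs (z - w) <= cabs z + cabs w.
Proof. by rewrite -(cabsN w); exact: cabsD. Qed.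

Lemma cabs_cis (t : R) : cabs (cis t) = 1.
Proof. by rewrite /cabs /cis /= cos2Dsin2 sqrtr1. Qed.

Lemma cabs_Re z : `|complex.Re z| <= cabs z.
Proof.
case: z => a b; rewrite /cabs /= -sqrtr_sqr; apply: ler_wsqrtr.
by rewrite lerDl sqr_ge0.
Qed.

Lemma cabs_Im z : `|complex.Im z| <= cabs z.
Proof.
case: z => a b; rewrite /cabs /= -sqrtr_sqr; apply: ler_wsqrtr.
by rewrite lerDr sqr_ge0.
Qed.

Lemma cabs_i : cabs ('i%C : R[i]) = 1.
Proof. by rewrite /cabs /= expr0n/= add0r expr1n sqrtr1. Qed.

Lemma complex_eqP z w : complex.Re z = complex.Re w -> complex.Im z = complex.Im w ->
  z = w.
Proof. by case: z w => a b [c d] /= -> ->. Qed.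

Lemma cisD (s t : R) : cis (s + t) = cis s * cis t.
Proof.
by apply: complex_eqP; rewrite /cis /= ?cosD ?sinD// addrC.
Qed.

End cabs_theory.

Section tempered.
Context {R : realType}.
Implicit Types (g h u v : R * R -> R).
Variable T : (R * R -> R[i]) -> R[i].
Hypothesis tT : tempered_distribution T.

Lemma rschwartz0 : rschwartz (fun=> 0 : R).
Proof.
have := rschwartz_mul (bsmooth_cst 0) (rschwartz_gauss2 (0, 0) (@ltr01 R)).
by under eq_fun do rewrite mul0r.
Qed.

(** A distribution is determined by its values on real-valued functions; working
    with these avoids derivatives of complex-valued functions. *)
Definition real_part_functional u : R[i] := T (cpair u (fun=> 0)).
Local Notation Tr := real_part_functional.

Lemma schwartz_real u : rschwartz u -> schwartz (cpair u (fun=> 0)).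
Proof. by move=> su; apply: schwartz_cpair => //; exact: rschwartz0. Qed.

Lemma distr0 : T (cpair (fun=> 0) (fun=> 0)) = 0.
Proof.
have s0 := schwartz_real rschwartz0.
have := tT.1 1 _ _ s0 s0; rewrite mul1r.
set F := fun x => _; have -> : F = cpair (fun=> 0) (fun=> 0).
  by apply/funext => x; apply: complex_eqP; rewrite /F /=; ring.
by move=> /esym/eqP; rewrite -subr_eq0 addrK => /eqP.
Qed.

Lemma TrD u v : rschwartz u -> rschwartz v -> Tr (fun x => u x + v x) = Tr u + Tr v.
Proof.
move=> su sv; have := tT.1 1 _ _ (schwartz_real su) (schwartz_real sv).
rewrite mul1r => <-; congr T; apply/funext => x.
by apply: complex_eqP; rewrite /=; ring.
Qed.

Lemma TrZ (c : R) u : rschwartz u -> Tr (fun x => c * u x) = (c%:C)%C * Tr u.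
Proof.
move=> su; have := tT.1 (c%:C)%C _ _ (schwartz_real su) (schwartz_real rschwartz0).
rewrite distr0 addr0 => <-; congr T; apply/funext => x.
by apply: complex_eqP; rewrite /=; ring.
Qed.

Lemma distr_cpair u v : rschwartz u -> rschwartz v ->
  T (cpair u v) = Tr u + 'i%C * Tr v.
Proof.
move=> su sv; have := tT.1 'i%C _ _ (schwartz_real sv) (schwartz_real su).
rewrite addrC => <-; congr T; apply/funext => x.
by apply: complex_eqP; rewrite /=; ring.
Qed.

(** Continuity makes a tempered distribution of finite order. *)
Lemma distr_order : exists N : nat, exists2 C : R, 0 < C &
  forall u (M : R), rschwartz u -> 0 < M ->
   (forall m n a b x, (m <= N)%N -> (n <= N)%N -> (a <= N)%N -> (b <= N)%N ->
     `|x.1| ^+ m * `|x.2| ^+ n * `|mixed_partial a b u x| <= M) ->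
   cabs (Tr u) <= C * M.
Proof.
have [N [d d0 hd]] := tT.2 _ (schwartz_real rschwartz0) 1 ltr01.
exists N, (2 / d); first by rewrite divr_gt0.
move=> u M su M0 uM.
pose c := d / 2 / M.
have c0 : 0 < c by rewrite !divr_gt0.
have cE : c^-1 = 2 / d * M by rewrite /c; field; rewrite !gt_eqF.
have cM : c^-1 * (d / 2) = M by rewrite cE; field; rewrite gt_eqF.
have scu : rschwartz (fun x => c * u x) by exact: (rschwartz_mul (bsmooth_cst c)).
have := hd _ (schwartz_real scu).
set F := fun x => _ - _; have -> : F = cpair (fun x => c * u x) (fun=> 0).
  by apply/funext => x; apply: complex_eqP; rewrite /F /= subr0.
rewrite distr0 subr0 -/(Tr _) TrZ// cabsM cabsR gtr0_norm// => H.
have : c * cabs (Tr u) < 1.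
  apply: H; rewrite [d]splitr; apply: seminorms_le_cpair => m n a b x mN nN aN bN.
    rewrite (_ : mixed_partial a b _ x = c * mixed_partial a b u x).
      rewrite normrM gtr0_norm// mulrCA -ler_pdivlMl//.
      by rewrite cM; exact: uM.
    have su2 := su.1.
    rewrite /mixed_partial.
    have -> : iter b (fun h => 'D_Defs.e2 h) (fun x => c * u x) =
        fun x => c * iter b (fun h => 'D_Defs.e2 h) u x.
      elim: b {bN} => //= b ->; apply/funext => y; apply: deriveZ.
      by apply: smooth2_derivable2; exact: smooth2_iter2.
    elim: a {aN} x => //= a IH x.
    have -> : iter a (fun h => 'D_Defs.e1 h) (fun x => c * iter b (fun h => 'D_Defs.e2 h) u x) =
      fun x => c * iter a (fun h => 'D_Defs.e1 h) (iter b (fun h => 'D_Defs.e2 h) u) x.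
      by apply/funext => y; exact: IH.
    apply: deriveZ.
    by apply: smooth2_derivable1; apply: smooth2_iter1; exact: smooth2_iter2.
  have z0 := @mixed_partial_eq0 R setT (fun=> 0) a b openT (fun _ _ => erefl) x I.
  by rewrite z0 normr0 mulr0 divr_ge0// ltW.
by rewrite -ltr_pdivlMl// mulr1 cE => /ltW.
Qed.
End tempered.

Section support.
Context {R : realType}.
Implicit Types (g h u v : R * R -> R).

(** Bounds for all derivatives by an explicit sequence, so that families of
    functions can be bounded uniformly. *)
Definition bounded_by (A : nat -> R) g := smooth2 g /\
  forall N a b x, (a <= N)%N -> (b <= N)%N -> `|mixed_partial a b g x| <= A N.

Lemma bounded_by_bsmooth A g : bounded_by A g -> bsmooth g.
Proof. by move=> [sg gA]; split => // N; exists (A N) => *; exact: gA. Qed.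

Lemma bsmooth_bounded_by g : bsmooth g -> exists A, bounded_by A g.
Proof.
move=> [sg bg]; exists (fun N => sval (cid (bg N))).
by split => // N a b x aN bN; case: cid => /= A; apply.
Qed.

Lemma bounded_by_mul A B g h : bounded_by A g -> bounded_by B h ->
  bounded_by (fun N => 2 ^+ (N + N) * (A N * B N)) (fun x => g x * h x).
Proof.
move=> [sg gA] [sh hB]; split; first exact: smooth2_mul.
move=> N a b x aN bN.
have := @seminorm_mul_le R N g h x (A N) (B N) 0 0 a b sg sh.
rewrite !expr0 !mul1r; apply => // i j iN jN; first exact: gA.
by rewrite mul1r; exact: hB.
Qed.

Lemma bounded_by_add A B g h : bounded_by A g -> bounded_by B h ->
  bounded_by (fun N => A N + B N) (fun x => g x + h x).
Proof.
move=> [sg gA] [sh hB]; split; first exact: smooth2_add.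
move=> N a b x aN bN; rewrite mixed_partial_add//.
by apply: le_trans (ler_normD _ _) _; apply: lerD; [exact: gA|exact: hB].
Qed.

Lemma setX_preimage (A B : set R) : A `*` B = fst @^-1` A `&` snd @^-1` B.
Proof. by apply/seteqP; split => -[x y]. Qed.

Lemma closed_setX (A B : set R) : closed A -> closed B -> closed (A `*` B).
Proof.
move=> cA cB; rewrite setX_preimage; apply: closedI.
- by apply: (continuous_closedP fst).1 => // x; exact: cvg_fst.
- by apply: (continuous_closedP snd).1 => // x; exact: cvg_snd.
Qed.

Lemma open_setX (A B : set R) : open A -> open B -> open (A `*` B).
Proof.
move=> cA cB; rewrite setX_preimage; apply: openI.
- by apply: (continuousP fst).1 => // x; exact: cvg_fst.
- by apply: (continuousP snd).1 => // x; exact: cvg_snd.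
Qed.

Lemma bounded_by_cst (C : R) : bounded_by (fun=> `|C|) (fun=> C).
Proof.
pose U (j : nat) (t : R) : R := if j is 0%N then C else 0.
have sU : smooth_seq U by case=> [|j] t; exact: is_derive_cst.
split; first exact: (bsmooth_cst C).1.
move=> N a b x aN bN.
have := @ridge_deriv_le R U 0 0 0 1 N sU (lexx 1) _ _ x `|C|.
rewrite expr1n mul1r normr0; apply => // -[|j] _ /=; first exact: lexx.
by rewrite normr0.
Qed.

(** The support condition only concerns compactly supported functions; these
    cutoffs, with derivatives bounded independently of the size of the box,
    extend it to Schwartz functions. *)
Lemma box_cutoff : exists A : nat -> R, forall r : R, 1 <= r ->
  exists g, [/\ bounded_by A g,
    forall x, `|x.1| < r -> `|x.2| < r -> g x = 1 &
    forall x, g x != 0 -> `|x.1| <= 2 * r /\ `|x.2| <= 2 * r].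
Proof.
have [V [sV V1 V0 _ bV]] := @cutoff_exists R 1 2 (ltr1n _ 2).
pose M N := sval (cid2 (bV (N + N)%N)).
have MP N j t : (j <= N + N)%N -> `|V j t| <= M N.
  by rewrite /M; case: cid2 => /= ? _; apply.
have rb al be : `|al| <= 1 -> `|be| <= 1 -> bounded_by M (ridge V al be 0 0).
  move=> al1 be1; split; first exact: (smooth2_ridge _).
  move=> N a b x aN bN.
  have := @ridge_deriv_le R V al be 0 1 N sV (lexx 1) al1 be1 x (M N).
  by rewrite expr1n mul1r; apply => // j jN; exact: MP.
eexists => r r1.
have r0 : 0 < r by exact: lt_le_trans r1.
have rV1 : `|r^-1| <= 1 by rewrite gtr0_norm ?invr_gt0// invf_le1.
have rNV1 : `|- r^-1| <= 1 by rewrite normrN.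
have z1 : `|0 : R| <= 1 by rewrite normr0.
exists (fun x => ridge V r^-1 0 0 0 x * ridge V (- r^-1) 0 0 0 x *
   (ridge V 0 r^-1 0 0 x * ridge V 0 (- r^-1) 0 0 x)); split.
- by apply: bounded_by_mul; apply: bounded_by_mul; exact: rb.
- move=> x; rewrite /ridge !mul0r !addr0 !add0r => x1 x2.
  have := ltr_normlW x1; have := ltr_normlW x2.
  have := ltrNnormlW x1; have := ltrNnormlW x2 => ? ? ? ?.
  rewrite !V1 ?mulr1//.
  + by rewrite mulNr lerNl ler_pdivlMl// mulrN1 ltW.
  + by rewrite ler_pdivrMl// mulr1 ltW.
  + by rewrite mulNr lerNl ler_pdivlMl// mulrN1 ltW.
  + by rewrite ler_pdivrMl// mulr1 ltW.
- move=> x; rewrite /ridge !mul0r !addr0 !add0r.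
  rewrite !mulf_eq0 !negb_or => /andP[/andP[h1 h2] /andP[h3 h4]].
  have key t : V 0%N (r^-1 * t) != 0 -> V 0%N (- r^-1 * t) != 0 -> `|t| <= 2 * r.
    move=> k1 k2; rewrite ler_norml; apply/andP; split.
      rewrite leNgt; apply/negP => tr; move/eqP: k2; apply; apply: V0.
      by rewrite mulNr lerNr ler_pdivrMl// mulrN mulrC ltW.
    rewrite leNgt; apply/negP => tr; move/eqP: k1; apply; apply: V0.
    by rewrite ler_pdivlMl// mulrC ltW.
  by split; exact: key.
Qed.

Variables (T : (R * R -> R[i]) -> R[i]) (Omega : set (R * R)).
Hypotheses (tT : tempered_distribution T) (sT : distr_supported_by T Omega).
Local Notation Tr := (real_part_functional T).

(** Approximate the function by its products with larger and larger cutoffs: the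
    remainders tend to 0 in every Schwartz seminorm because the function decays. *)
Lemma distr_support_rschwartz u (U : set (R * R)) : rschwartz u -> open U ->
  Omega `<=` U -> (forall x, U x -> u x = 0) -> Tr u = 0.
Proof.
move=> su oU OU uU.
have [N [C C0 hC]] := distr_order tT.
have [A hA] := box_cutoff.
have [M hM] := su.2 N.+1.
pose B k := `|1 : R| + 2 ^+ (k + k) * (`|-1 : R| * A k).
pose K := 2 ^+ (N + N) * (B N * M).
have Kr r : 1 <= r -> cabs (Tr u) <= C * ((`|K| + 1) / r).
  move=> r1; have r0 : 0 < r by exact: lt_le_trans r1.
  have [g [bg g1 g0]] := hA r r1.
  have bh : bounded_by B (fun x => 1 + (-1) * g x).
    apply: bounded_by_add; first exact: bounded_by_cst.
    by apply: bounded_by_mul => //; exact: bounded_by_cst.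
  have sgu := rschwartz_mul (bounded_by_bsmooth bg) su.
  have shu := rschwartz_mul (bounded_by_bsmooth bh) su.
  have -> : Tr u = Tr (fun x => g x * u x) + Tr (fun x => (1 + (-1) * g x) * u x).
    by rewrite -TrD//; congr Tr; apply/funext => x; ring.
  have -> : Tr (fun x => g x * u x) = 0.
    have clsub : supp (cpair (fun x => g x * u x) (fun=> 0)) `<=`
        (`[- (2 * r), 2 * r]%classic `*` `[- (2 * r), 2 * r]%classic) `&` ~` U.
      have cl : closed ((`[- (2 * r), 2 * r]%classic `*` `[- (2 * r), 2 * r]%classic) `&` ~` U).
        apply: closedI; last exact: open_closedC.
        by apply: closed_setX; exact: interval_closed.
      rewrite [X in _ `<=` X](closure_id _).1//; apply: closureS => x /= x0.
      have : g x * u x != 0.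
        by apply: contra x0 => /eqP gu; apply/eqP/complex_eqP.
      rewrite mulf_eq0 negb_or => /andP[/g0[gx1 gx2] ux].
      split; last by move=> /uU /eqP; apply/negP.
      by rewrite /= !in_itv/= -!ler_norml.
    apply: sT.
    - exact: (schwartz_real sgu).1.
    - apply: (subclosed_compact _ _ (subset_trans clsub (@subIsetl _ _ _))).
        exact: closed_closure.
      by apply: compact_setX; exact: segment_compact.
    - by move=> x /clsub [_ nU] /OU.
  rewrite add0r; apply: (hC _ _ shu).
    by rewrite divr_gt0// ltr_wpDl.
  move=> m n a b x mN nN aN bN.
  have M0 : 0 <= M.
    by apply: le_trans (hM 0%N 0%N 0%N 0%N x isT isT isT isT); rewrite !mulr_ge0.
  have B0 : 0 <= B N by apply: le_trans (bh.2 N 0%N 0%N x isT isT).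
  have K0 : 0 <= K by rewrite /K mulr_ge0 ?exprn_ge0 ?mulr_ge0.
  have W0 k l : 0 <= `|x.1| ^+ k * `|x.2| ^+ l by rewrite mulr_ge0.
  have big : r <= `|x.1| \/ r <= `|x.2| ->
      `|x.1| ^+ m * `|x.2| ^+ n * `|mixed_partial a b
         (fun x0 => (1 + -1 * g x0) * u x0) x| <= (`|K| + 1) / r.
    move=> hx; apply: (@le_trans _ _ (2 ^+ (N + N) * (B N * (M / r)))); last first.
      rewrite (ger0_norm K0) /K !mulrA -[leLHS]addr0 mulrDl lerD2l.
      by rewrite mul1r invr_ge0 ltW.
    apply: seminorm_mul_le => //; first exact: bh.1.
    + exact: su.1.
    + by move=> i j iN jN; exact: bh.2.
    move=> i j iN jN; rewrite ler_pdivlMr//.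
    case: hx => hx.
    + apply: le_trans (hM m.+1 n i j x mN (leqW nN) (leqW iN) (leqW jN)).
      rewrite [leRHS](_ : _ = `|x.1| ^+ m * `|x.2| ^+ n * `|mixed_partial i j u x| * `|x.1|).
        by apply: ler_wpM2l => //; rewrite mulr_ge0.
      by rewrite exprS; ring.
    + apply: le_trans (hM m n.+1 i j x (leqW mN) nN (leqW iN) (leqW jN)).
      rewrite [leRHS](_ : _ = `|x.1| ^+ m * `|x.2| ^+ n * `|mixed_partial i j u x| * `|x.2|).
        by apply: ler_wpM2l => //; rewrite mulr_ge0.
      by rewrite exprS; ring.
  have [hx1|hx1] := leP r `|x.1|; first by apply: big; left.
  have [hx2|hx2] := leP r `|x.2|; first by apply: big; right.
  pose D : set (R * R) := (`]- r, r[%classic `*` `]- r, r[%classic).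
  have oD : open D by apply: open_setX; exact: interval_open.
  have z : forall y, D y -> (1 + -1 * g y) * u y = 0.
    move=> y [/=]; rewrite !in_itv/= -!ltr_norml => y1 y2.
    by rewrite g1// mulr1 subrr mul0r.
  rewrite (mixed_partial_eq0 a b oD z); last first.
    by split; rewrite /= in_itv/= -ltr_norml.
  by rewrite normr0 mulr0 divr_ge0 ?addr_ge0// ltW.
apply: cabs_eq0; apply/eqP; rewrite eq_le cabs_ge0 andbT.
apply/ler_addgt0Pr => e e0; rewrite add0r.
pose r := 1 + C * (`|K| + 1) / e.
have CK : 0 < C * (`|K| + 1) by rewrite mulr_gt0// ltr_wpDl.
have r1 : 1 <= r by rewrite /r lerDl divr_ge0// ltW.
apply: le_trans (Kr r r1) _; rewrite mulrA ler_pdivrMr ?(lt_le_trans ltr01)//.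
rewrite [leRHS](_ : _ = e + C * (`|K| + 1)); first by rewrite lerDr ltW.
by rewrite /r; field; rewrite gt_eqF.
Qed.
End support.

Section ridge_estimate.
Context {R : realType}.
Implicit Types (g h u v : R * R -> R).

Lemma rschwartz_add u v : rschwartz u -> rschwartz v -> rschwartz (fun x => u x + v x).
Proof.
move=> [su bu] [sv bv]; split; first exact: smooth2_add.
move=> N; have [A uA] := bu N; have [M vM] := bv N.
exists (A + M) => m n a b x mN nN aN bN; rewrite mixed_partial_add//.
apply: (@le_trans _ _ (`|x.1| ^+ m * `|x.2| ^+ n *
  (`|mixed_partial a b u x| + `|mixed_partial a b v x|))).
  by apply: ler_wpM2l; [rewrite mulr_ge0|exact: ler_normD].
by rewrite mulrDr; apply: lerD; [exact: uA|exact: vM].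
Qed.

Variables (T : (R * R -> R[i]) -> R[i]) (Omega : set (R * R)).
Hypotheses (tT : tempered_distribution T) (sT : distr_supported_by T Omega).
Local Notation Tr := (real_part_functional T).
Variables (d : R * R) (c0 rho1 rho2 : R).
Hypothesis rho12 : rho1 < rho2.
Hypothesis Omega_strip : forall xi, Omega xi -> `|dot xi d - c0| <= rho1.

Lemma dotE xi : dot xi d - c0 = d.1 * xi.1 + d.2 * xi.2 + - c0.
Proof. by rewrite /dot; ring. Qed.

Lemma continuous_tau : continuous (fun xi : R * R => d.1 * xi.1 + d.2 * xi.2 + - c0).
Proof.
move=> x; apply: cvgD; last exact: cvg_cst.
by apply: cvgD; apply: cvgM; [exact: cvg_cst|exact: cvg_fst|exact: cvg_cst|exact: cvg_snd].
Qed.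

(** Multiplying a Schwartz function by a ridge function and applying the
    distribution only sees the ridge function on the strip around the support:
    the rest is removed by a cutoff. *)
Lemma ridge_estimate : exists N : nat, forall h, rschwartz h ->
  exists2 C : R, 0 < C & forall (U : nat -> R -> R) (e : R), smooth_seq U ->
    (forall N, exists2 M : R, 0 <= M & forall j t, (j <= N)%N -> `|U j t| <= M) ->
    0 < e -> (forall j t, (j <= N)%N -> `|t| <= rho2 -> `|U j t| <= e) ->
    cabs (Tr (fun x => ridge U d.1 d.2 (- c0) 0 x * h x)) <= C * e.
Proof.
have [N [C C0 hC]] := distr_order tT.
exists (N + N)%N => h sh.
pose r := (rho1 + rho2) / 2.
have r1 : rho1 < r by have := midf_lt rho12; case.
have r2 : r < rho2 by have := midf_lt rho12; case.
have [V [sV V1 V0 _ bV]] := cutoff_exists r2.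
pose chi x := ridge V d.1 d.2 (- c0) 0 x * ridge V (- d.1) (- d.2) c0 0 x.
have bchi : bsmooth chi by apply: bsmooth_mul; exact: bsmooth_ridge.
have [A bA] := bsmooth_bounded_by bchi.
have [M hM] := sh.2 N.
pose B := 1 + `|d.1| + `|d.2|.
have B1 : 1 <= B by rewrite /B -addrA lerDl addr_ge0.
have Bd1 : `|d.1| <= B by rewrite /B addrAC lerDr addr_ge0.
have Bd2 : `|d.2| <= B by rewrite /B lerDr addr_ge0.
pose K := 2 ^+ (N + N) * (2 ^+ (N + N) * (A N * B ^+ (N + N)) * M).
exists (C * (`|K| + 1)) => [|U e sU bU e0 Ue]; first by rewrite mulr_gt0// ltr_wpDl.
pose g := ridge U d.1 d.2 (- c0) 0.
have bg : bsmooth g by exact: bsmooth_ridge.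
have sgh := rschwartz_mul bg sh.
have bchi' : bsmooth (fun x => 1 + (-1) * chi x).
  apply: bsmooth_add; first exact: bsmooth_cst.
  by apply: bsmooth_mul => //; exact: bsmooth_cst.
have -> : Tr (fun x => g x * h x) = Tr (fun x => (chi x * g x) * h x) +
    Tr (fun x => (1 + (-1) * chi x) * (g x * h x)).
  rewrite -TrD//.
  - by congr Tr; apply/funext => x; ring.
  - by apply: rschwartz_mul => //; exact: bsmooth_mul.
  - exact: rschwartz_mul.
rewrite [X in _ + X](@distr_support_rschwartz _ _ _ tT sT _
   ((fun xi : R * R => d.1 * xi.1 + d.2 * xi.2 + - c0) @^-1` `]- r, r[%classic)).
- rewrite addr0 -mulrA; apply: hC; last first.
  + move=> m n a b x mN nN aN bN.
    have A0 : 0 <= A N by apply: le_trans (bA.2 N 0%N 0%N x isT isT).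
    have M0 : 0 <= M.
      by apply: le_trans (hM 0%N 0%N 0%N 0%N x isT isT isT isT); rewrite !mulr_ge0.
    have Bn0 : 0 <= B ^+ (N + N) by rewrite exprn_ge0// (le_trans ler01).
    have K0 : 0 <= K by rewrite /K; repeat apply: mulr_ge0 => //.
    apply: (@le_trans _ _ (2 ^+ (N + N) * (2 ^+ (N + N) * (A N * (B ^+ (N + N) * e)) * M))); last first.
      rewrite [leLHS](_ : _ = K * e); last by rewrite /K; ring.
      by rewrite ler_pM2r// (ger0_norm K0) lerDl.
    have scg : smooth2 (fun x => chi x * g x) by apply: smooth2_mul; [exact: bchi.1|exact: bg.1].
    apply: seminorm_mul_le => //; first exact: sh.1.
      move=> i j iN jN.
      pose t := d.1 * x.1 + d.2 * x.2 + - c0.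
      have [tr|tr] := leP `|t| rho2.
        have := @mixed_partial_mul_le _ i j chi g x 1 1 (A N) (B ^+ (N + N) * e) bchi.1 bg.1 ler01 ler01.
        rewrite !mul1r => H; apply: le_trans (H _ _) _.
        - by move=> i' j' ii' jj'; rewrite mul1r; apply: bA.2; [exact: leq_trans iN|exact: leq_trans jN].
        - move=> i' j' ii' jj'; rewrite mul1r.
          apply: ridge_deriv_le => //.
          + by move=> k kN; apply: Ue.
          + exact: leq_trans iN.
          + exact: leq_trans jN.
        apply: ler_wpM2r; first by rewrite mulr_ge0// mulr_ge0// ltW.
        by rewrite ler_weXn2l ?ler1n// leq_add.
      pose D := (fun xi : R * R => d.1 * xi.1 + d.2 * xi.2 + - c0) @^-1` (~` `[- rho2, rho2]%classic).
      have oD : open D.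
        apply: (continuousP _).1; first exact: continuous_tau.
        by apply: closed_openC; exact: interval_closed.
      have zD y : D y -> chi y * g y = 0.
        rewrite /D /= in_itv/= => /negP; rewrite negb_and -!ltNge => ty.
        rewrite /chi /ridge; set ty' := (_ + - c0) in ty *.
        have -> : - d.1 * y.1 + - d.2 * y.2 + c0 = - ty' by rewrite /ty'; ring.
        case/orP : ty => h1.
          by rewrite [V 0%N (- ty')]V0 ?mulr0 ?mul0r// lerNr ltW.
        by rewrite [V 0%N ty']V0 ?mul0r// ltW.
      rewrite (mixed_partial_eq0 _ _ oD zD); last first.
        by rewrite /D /= in_itv/= -ler_norml; apply/negP; rewrite -ltNge.
      by rewrite normr0; repeat apply: mulr_ge0 => //; rewrite ?exprn_ge0// ltW.
    by move=> i j iN jN; exact: hM.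
  + by rewrite mulr_gt0// ltr_wpDl.
  + by apply: rschwartz_mul => //; exact: bsmooth_mul.
- exact: rschwartz_mul.
- apply: (continuousP _).1; first exact: continuous_tau.
  exact: interval_open.
- move=> xi Oxi /=; rewrite in_itv/= -ltr_norml -dotE.
  exact: le_lt_trans (Omega_strip Oxi) r1.
- move=> xi /=; rewrite in_itv/= => /andP[t1 t2].
  rewrite /chi /ridge !V1 ?mulr1 ?subrr ?mul0r//; last exact: ltW.
  rewrite (_ : _ + c0 = - (d.1 * xi.1 + d.2 * xi.2 + - c0)); last by ring.
  by rewrite lerNl ltW.
Qed.

End ridge_estimate.

(** * Exponential sums that vanish near the spectrum *)
Section annihilator.
Context {R : realType}.
Notation mu := (@lebesgue_measure R).
Notation mu2 := (mu \x mu)%E.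
Implicit Types (S : seq (R * R)) (p xi : R * R).

(** A list of pairs (coefficient, point) stands for a discrete measure on the
    line; [cosum] is the [j]-th derivative of its Fourier transform, rotated by
    the phase [th]. *)
Definition cosum S (th : R) (j : nat) (t : R) : R :=
  \sum_(q <- S) q.1 * (2 * pi * q.2) ^+ j * cos (2 * pi * q.2 * t + th).

Definition cosum_seq S (th : R) (j : nat) (t : R) : R :=
  cosum S (th + j%:R * (pi / 2)) j t.

Lemma cosum_smooth S th : smooth_seq (cosum_seq S th).
Proof.
move=> j t; rewrite /cosum_seq /cosum.
elim: S => [|q S IH].
  rewrite big_nil (_ : (fun _ : R => _) = cst 0); first exact: is_derive_cst.
  by apply/funext => s; rewrite big_nil.
rewrite big_cons.
rewrite (_ : (fun s : R => _) = fun s => q.1 * (2 * pi * q.2) ^+ j *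
   cos (2 * pi * q.2 * s + (th + j%:R * (pi / 2))) +
   \sum_(j0 <- S) j0.1 * (2 * pi * j0.2) ^+ j *
     cos (2 * pi * j0.2 * s + (th + j%:R * (pi / 2)))); last first.
  by apply/funext => s; rewrite big_cons.
apply: is_deriveD.
apply: is_derive_eq.
rewrite /GRing.scale/= exprS.
have -> : 2 * pi * q.2 * t + (th + j.+1%:R * (pi / 2)) =
  (2 * pi * q.2 * t + (th + j%:R * (pi / 2))) + pi / 2 by rewrite -natr1; ring.
rewrite [cos (_ + pi / 2)]cosD cos_pihalf sin_pihalf; ring.
Qed.

Lemma cosum_bounded S th N : exists2 M : R, 0 <= M &
  forall j t, (j <= N)%N -> `|cosum_seq S th j t| <= M.
Proof.
exists (\sum_(j < N.+1) \sum_(q <- S) `|q.1 * (2 * pi * q.2) ^+ j|).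
  by apply: sumr_ge0 => j _; apply: sumr_ge0.
move=> j t jN; rewrite (bigD1 (@Ordinal N.+1 j jN))//=.
apply: ler_wpDr; first by apply: sumr_ge0 => i _; apply: sumr_ge0.
apply: le_trans (ler_norm_sum _ _ _) _; apply: ler_sum => q _.
by rewrite normrM ler_piMr// norm_cos_le1.
Qed.

Definition mollify (f : R * R -> R[i]) (s : R) p : R[i] :=
  cintegral (fun x => f x * ((gauss_kernel s p x)%:C)%C).

Lemma cintegralE (u v : R * R -> R) : cintegral (cpair u v) =
  ((\int[mu2]_x u x) +i* (\int[mu2]_x v x))%C.
Proof. by []. Qed.

Lemma inv_fourier_gauss_kernel (s : R) p : s != 0 ->
  inv_fourier (cpair (gauss_kernel s p) (fun=> 0)) =
  fun xi => cis (2 * pi * dot xi p) *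
    ((gauss2 (2 * pi ^+ 2 * s ^+ 2) (0, 0) xi)%:C)%C.
Proof.
move=> s0; apply/funext => xi; rewrite /inv_fourier.
rewrite (_ : (fun x => _) = cpair
  (fun x => gauss_kernel s p x * cos (2 * pi * xi.1 * x.1 + 2 * pi * xi.2 * x.2 + 0))
  (fun x => gauss_kernel s p x * cos (2 * pi * xi.1 * x.1 + 2 * pi * xi.2 * x.2 + - (pi / 2)))); last first.
  apply/funext => x.
  have -> : 2 * pi * dot xi x = 2 * pi * xi.1 * x.1 + 2 * pi * xi.2 * x.2.
    by rewrite /dot; ring.
  apply: complex_eqP; rewrite /cis /=.
    by rewrite mulr0 subr0 addr0 mulrC.
  by rewrite mulr0 add0r cosD cosN sinN cos_pihalf sin_pihalf; ring.
rewrite cintegralE !gauss_kernel_fourier//.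
have -> : 2 * pi * xi.1 * p.1 + 2 * pi * xi.2 * p.2 = 2 * pi * dot xi p.
  by rewrite /dot; ring.
have E (t : R) : expR (- (s ^+ 2 * (2 * pi * t) ^+ 2 / 2)) =
    expR (- (2 * pi ^+ 2 * s ^+ 2 * (t + 0) ^+ 2)).
  by congr (expR (- _)); field.
rewrite !E -/(gauss2 (2 * pi ^+ 2 * s ^+ 2) (0, 0) xi) addr0.
apply: complex_eqP; rewrite /cis /=.
  by rewrite mulr0 subr0 mulrC.
by rewrite mulr0 add0r cosD cosN sinN cos_pihalf sin_pihalf; ring.
Qed.

Lemma rschwartz_gauss_kernel (s : R) p : 0 < s -> rschwartz (gauss_kernel s p).
Proof.
move=> s0; have sn0 : s != 0 by rewrite gt_eqF.
pose c := (s ^+ 2 *+ 2)^-1.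
have c0 : 0 < c by rewrite invr_gt0 pmulrn_lgt0// exprn_gt0.
have := rschwartz_mul (bsmooth_cst (normal_peak s * normal_peak s))
  (rschwartz_gauss2 (- p.1, - p.2) c0).
rewrite (_ : (fun x => _) = gauss_kernel s p)//; apply/funext => x.
rewrite /gauss_kernel !normal_pdfE// /gauss2 /normal_fun /c /=.
have E (t q : R) : - (t - q) ^+ 2 / (s ^+ 2 *+ 2) = - ((s ^+ 2 *+ 2)^-1 * (t - q) ^+ 2).
  by rewrite mulNr mulrC.
by rewrite !E; ring.
Qed.

Lemma rschwartz_cos p (th : R) h : rschwartz h ->
  rschwartz (fun xi => cos (2 * pi * dot xi p + th) * h xi).
Proof.
move=> sh; apply: rschwartz_mul => //.
pose S := [:: (1, 1)] : seq (R * R).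
have := bsmooth_ridge p.1 p.2 0 (cosum_smooth S th) (cosum_bounded S th).
rewrite (_ : ridge _ _ _ _ _ = fun xi => cos (2 * pi * dot xi p + th))//.
apply/funext => xi; rewrite /ridge /cosum_seq /cosum big_seq1 /= expr0 !mulr1 mul1r.
by congr cos; rewrite /dot; ring.
Qed.

Variables (f : R * R -> R[i]) (T : (R * R -> R[i]) -> R[i]) (Omega : set (R * R)).
Hypotheses (tT : tempered_distribution T) (sT : distr_supported_by T Omega).
Hypothesis fT : is_inv_fourier_distr f T.
Local Notation Tr := (real_part_functional T).
Variables (d x0 : R * R) (c0 rho1 rho2 : R).
Hypothesis rho12 : rho1 < rho2.
Hypothesis Omega_strip : forall xi, Omega xi -> `|dot xi d - c0| <= rho1.

(** The Fourier transform of a Gaussian is Gaussian, so a Gaussian average of [f]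
    is the value of the distribution at an explicit Schwartz function. *)
Lemma mollify_distr (s : R) p : 0 < s ->
  mollify f s p = T (fun xi => cis (2 * pi * dot xi p) *
    ((gauss2 (2 * pi ^+ 2 * s ^+ 2) (0, 0) xi)%:C)%C).
Proof.
move=> s0; rewrite -inv_fourier_gauss_kernel ?gt_eqF//.
by rewrite -fT//; apply: schwartz_real; exact: rschwartz_gauss_kernel.
Qed.

(** If the Fourier transform of a discrete measure, together with sufficiently
    many derivatives, is small on a neighbourhood of the projected spectrum,
    then that measure almost annihilates the mollifications of [f] along the
    direction [d]. *)
Lemma mollified_annihilator (s : R) : 0 < s -> exists N : nat, exists2 C : R, 0 < C &
  forall S (e : R), 0 < e ->
    (forall j th t, (j <= N)%N -> `|t| <= rho2 -> `|cosum S th j t| <= e) ->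
    cabs (\sum_(q <- S) (q.1%:C)%C * cis (- (2 * pi * c0 * q.2)) *
            mollify f s (x0 + q.2 *: d)) <= C * e.
Proof.
move=> s0.
have [N hN] := ridge_estimate tT sT rho12 Omega_strip.
pose G := gauss2 (2 * pi ^+ 2 * s ^+ 2) (0, 0).
have cG : 0 < 2 * pi ^+ 2 * s ^+ 2 :> R by rewrite !mulr_gt0 ?exprn_gt0 ?pi_gt0.
have sG : rschwartz G := rschwartz_gauss2 (0, 0) cG.
pose hc xi := cos (2 * pi * dot xi x0 + 0) * G xi.
pose hs xi := cos (2 * pi * dot xi x0 + - (pi / 2)) * G xi.
have shc : rschwartz hc by exact: rschwartz_cos.
have shs : rschwartz hs by exact: rschwartz_cos.
have [Cc Cc0 HCc] := hN _ shc; have [Cs Cs0 HCs] := hN _ shs.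
exists N, (2 * (Cc + Cs)) => [|S e e0 He]; first by rewrite mulr_gt0 ?addr_gt0.
pose E th S := ridge (cosum_seq S th) d.1 d.2 (- c0) 0.
have bE th S' : bsmooth (E th S').
  by apply: bsmooth_ridge; [exact: cosum_smooth|exact: cosum_bounded].
pose U S' xi : R := E 0 S' xi * hc xi + (- 1) * (E (- (pi / 2)) S' xi * hs xi).
pose V S' xi : R := E 0 S' xi * hs xi + E (- (pi / 2)) S' xi * hc xi.
have sEc th S' : rschwartz (fun xi => E th S' xi * hc xi) by exact: rschwartz_mul.
have sEs th S' : rschwartz (fun xi => E th S' xi * hs xi) by exact: rschwartz_mul.
have sNEs th S' : rschwartz (fun xi => (-1) * (E th S' xi * hs xi)).
  by apply: rschwartz_mul => //; exact: bsmooth_cst.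
have sU S' : rschwartz (U S') by exact: rschwartz_add.
have sV S' : rschwartz (V S') by exact: rschwartz_add.
have cosS (t : R) : cos (t + - (pi / 2)) = sin t.
  by rewrite cosD cosN sinN cos_pihalf sin_pihalf; ring.
have term q xi : (q.1%:C)%C * cis (- (2 * pi * c0 * q.2)) *
    (cis (2 * pi * dot xi (x0 + q.2 *: d)) * ((G xi)%:C)%C) =
    cpair (U [:: q]) (V [:: q]) xi.
  pose al := 2 * pi * dot xi x0.
  pose be := 2 * pi * q.2 * (d.1 * xi.1 + d.2 * xi.2 + - c0).
  have -> : (q.1%:C)%C * cis (- (2 * pi * c0 * q.2)) *
      (cis (2 * pi * dot xi (x0 + q.2 *: d)) * ((G xi)%:C)%C) =
      (q.1%:C)%C * (cis (al + be) * ((G xi)%:C)%C).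
    rewrite -mulrA (mulrA (cis _)) -cisD; congr (_ * (cis _ * _)).
    by rewrite /al /be /dot /=; rewrite /GRing.scale/=; ring.
  have E0 : E 0 [:: q] xi = q.1 * cos be.
    rewrite /E /ridge /cosum_seq /cosum big_seq1 expr0 mulr1; congr (_ * cos _).
    by rewrite mul0r !addr0.
  have E1 : E (- (pi / 2)) [:: q] xi = q.1 * sin be.
    rewrite /E /ridge /cosum_seq /cosum big_seq1 expr0 mulr1 -cosS.
    by congr (_ * cos _); rewrite mul0r addr0.
  have Hc : hc xi = cos al * G xi by rewrite /hc addr0.
  have Hs : hs xi = sin al * G xi by rewrite /hs cosS.
  apply: complex_eqP; rewrite /cis /= /U /V E0 E1 Hc Hs cosD sinD; ring.
have UVcons q S' xi : cpair (U (q :: S')) (V (q :: S')) xi =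
    1 * cpair (U [:: q]) (V [:: q]) xi + cpair (U S') (V S') xi.
  rewrite mul1r; apply: complex_eqP; rewrite /U /V /E /ridge /cosum_seq /cosum /=;
    by rewrite !big_cons !big_nil; ring.
have main S' : \sum_(q <- S') (q.1%:C)%C * cis (- (2 * pi * c0 * q.2)) *
            mollify f s (x0 + q.2 *: d) = T (cpair (U S') (V S')).
  elim: S' => [|q S' IH].
    rewrite big_nil -(distr0 tT); congr T; apply/funext => xi.
    by apply: complex_eqP; rewrite /U /V /E /ridge /cosum_seq /cosum /= !big_nil; ring.
  rewrite big_cons IH (funext (UVcons q S')).
  rewrite (tT.1 1 _ _ (schwartz_cpair (sU _) (sV _)) (schwartz_cpair (sU _) (sV _))) mul1r.
  congr (_ + _); rewrite mollify_distr// -/G.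
  have sq : schwartz (fun xi => cis (2 * pi * dot xi (x0 + q.2 *: d)) * ((G xi)%:C)%C).
    rewrite (_ : (fun xi => _) = cpair
      (fun xi => cos (2 * pi * dot xi (x0 + q.2 *: d) + 0) * G xi)
      (fun xi => cos (2 * pi * dot xi (x0 + q.2 *: d) + - (pi / 2)) * G xi)).
      by apply: schwartz_cpair; exact: rschwartz_cos.
    apply/funext => xi; apply: complex_eqP; rewrite /cis /= ?addr0 ?cosS; ring.
  have := tT.1 ((q.1%:C)%C * cis (- (2 * pi * c0 * q.2))) _ _ sq (schwartz_real rschwartz0).
  rewrite (distr0 tT) addr0 => <-; congr T; apply/funext => xi.
  by rewrite term; apply: complex_eqP; rewrite /=; ring.
rewrite main (distr_cpair tT (sU S) (sV S)).
rewrite /U /V (TrD tT (sEc 0 S) (sNEs _ S)) (TrD tT (sEs 0 S) (sEc _ S)) (TrZ tT)//.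
have b th h (C : R) (HC : forall (U : nat -> R -> R) (e : R), smooth_seq U ->
    (forall N, exists2 M : R, 0 <= M & forall j t, (j <= N)%N -> `|U j t| <= M) ->
    0 < e -> (forall j t, (j <= N)%N -> `|t| <= rho2 -> `|U j t| <= e) ->
    cabs (Tr (fun x => ridge U d.1 d.2 (- c0) 0 x * h x)) <= C * e) :
    cabs (Tr (fun xi => E th S xi * h xi)) <= C * e.
  apply: HC => //; first exact: cosum_smooth.
    exact: cosum_bounded.
  by move=> j t jN tr; exact: He.
apply: le_trans (cabsD _ _) _; rewrite cabsM cabs_i mul1r.
apply: (@le_trans _ _ ((Cc * e + Cs * e) + (Cs * e + Cc * e))); last first.
  by rewrite le_eqVlt; apply/orP; left; apply/eqP; ring.
apply: lerD; apply: le_trans (cabsD _ _) _; apply: lerD; try exact: b.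
by rewrite cabsM cabsR normrN normr1 mul1r; exact: b.
Qed.

End annihilator.

(** * Limits of trigonometric polynomials *)
Section trig.
Context {R : realType}.
Implicit Types (s : seq (R * R * R)) (rho B t : R) (F G : R -> R).

(** A trigonometric polynomial is encoded as a list of triples (coefficient,
    frequency, phase). *)
Definition cospoly s t : R :=
  \sum_(q <- s) q.1.1 * cos (2 * pi * q.1.2 * t + q.2).

Definition spectrum_in rho s := forall q, q \in s -> `|q.1.2| <= rho.
Definition cosmass s : R := \sum_(q <- s) `|q.1.1|.

(** Pointwise limits of trigonometric polynomials with frequencies at most [rho]
    and absolute coefficient sum at most [B]: the functions with a
    Fourier transform that is a measure of mass at most [B] on [-rho, rho]. *)
Definition trig rho B F := exists P : nat -> seq (R * R * R),
  [/\ forall n, spectrum_in rho (P n), forall n, cosmass (P n) <= B &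
      forall t, cospoly (P n) t @[n --> \oo] --> F t].

Lemma cospoly_le s t : `|cospoly s t| <= cosmass s.
Proof.
apply: le_trans (ler_norm_sum _ _ _) _; apply: ler_sum => q _.
by rewrite normrM ler_piMr// norm_cos_le1.
Qed.

Lemma trig_ext rho B F G : F =1 G -> trig rho B F -> trig rho B G.
Proof. by move=> /funext ->. Qed.

Lemma trig_mass_ge0 rho B F : trig rho B F -> 0 <= B.
Proof.
by move=> [P [_ hB _]]; apply: le_trans (hB 0%N); apply: sumr_ge0.
Qed.

(** A bound on exponentials for a finite combination of point evaluations is
    inherited by the whole class. *)
Lemma trig_functional (A : seq (R * R)) rho B e F : 0 <= e ->
  (forall xi th, `|xi| <= rho ->
     `|\sum_(q <- A) q.1 * cos (2 * pi * xi * q.2 + th)| <= e) ->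
  trig rho B F -> `|\sum_(q <- A) q.1 * F q.2| <= B * e.
Proof.
move=> e0 hA [P [hs hB hP]].
have lim1 : `|\sum_(q <- A) q.1 * cospoly (P n) q.2| @[n --> \oo] -->
            `|\sum_(q <- A) q.1 * F q.2|.
  apply: cvg_norm; elim: A {hA} => [|q A IH].
    rewrite big_nil (_ : (fun n => _) = cst 0); first exact: cvg_cst.
    by apply/funext => n; rewrite big_nil.
  rewrite big_cons (_ : (fun n => _) = (fun n => q.1 * cospoly (P n) q.2 +
     \sum_(j <- A) j.1 * cospoly (P n) j.2)); last first.
    by apply/funext => n; rewrite big_cons.
  by apply: cvgD => //; apply: cvgMl_tmp; exact: hP.
have lim2 : (fun _ : nat => B * e) @ \oo --> B * e by exact: cvg_cst.
apply: (ler_cvg_to lim1 lim2); apply: nearW => n.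
have -> : \sum_(q <- A) q.1 * cospoly (P n) q.2 =
    \sum_(p <- P n) p.1.1 * \sum_(q <- A) q.1 * cos (2 * pi * p.1.2 * q.2 + p.2).
  under eq_bigr do rewrite mulr_sumr; rewrite exchange_big /=.
  by apply: eq_bigr => p _; rewrite mulr_sumr; apply: eq_bigr => q _; ring.
apply: le_trans (ler_norm_sum _ _ _) _.
apply: (@le_trans _ _ (\sum_(p <- P n) `|p.1.1| * e)).
  rewrite big_seq [leRHS]big_seq; apply: ler_sum => p pP.
  by rewrite normrM; apply: ler_wpM2l => //; apply: hA; exact: (hs n).
rewrite -mulr_suml; apply: ler_wpM2r => //; exact: hB.
Qed.

Lemma trig_bound rho B F t : trig rho B F -> `|F t| <= B.
Proof.
move=> tF; have := @trig_functional [:: (1, t)] rho B 1 F ler01.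
rewrite big_seq1 mul1r mulr1; apply => // xi th _.
by rewrite big_seq1 mul1r norm_cos_le1.
Qed.

Lemma trig_weaken rho rho' B B' F : rho <= rho' -> B <= B' ->
  trig rho B F -> trig rho' B' F.
Proof.
move=> rr BB [P [hs hB hP]]; exists P; split => // [n q qP|n].
  by apply: le_trans rr; exact: (hs n).
exact: le_trans BB.
Qed.

Lemma trig_cos (xi th : R) : trig `|xi| 1 (fun t => cos (2 * pi * xi * t + th)).
Proof.
exists (fun=> [:: ((1, xi), th)]); split => [n q|n|t].
- by rewrite inE => /eqP ->.
- by rewrite /cosmass big_seq1 normr1.
- rewrite /cospoly (_ : (fun _ : nat => _) = cst (cos (2 * pi * xi * t + th))).
    exact: cvg_cst.
  by apply/funext => n; rewrite big_seq1 mul1r.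
Qed.

Lemma trig_add rho B B' F G : trig rho B F -> trig rho B' G ->
  trig rho (B + B') (fun t => F t + G t).
Proof.
move=> [P [hs hB hP]] [Q [hs' hB' hQ]].
exists (fun n => P n ++ Q n); split => [n q|n|t].
- by rewrite mem_cat => /orP[/hs|/hs'].
- by rewrite /cosmass big_cat/=; apply: lerD; [exact: hB|exact: hB'].
- rewrite (_ : (fun n => _) = fun n => cospoly (P n) t + cospoly (Q n) t).
    by apply: cvgD; [exact: hP|exact: hQ].
  by apply/funext => n; rewrite /cospoly big_cat.
Qed.

Lemma trig_scale rho B (c : R) F : trig rho B F -> trig rho (`|c| * B) (fun t => c * F t).
Proof.
move=> [P [hs hB hP]].
exists (fun n => [seq ((c * q.1.1, q.1.2), q.2) | q <- P n]); split => [n q|n|t].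
- by move=> /mapP[p pP ->] /=; exact: (hs n).
- rewrite /cosmass big_map /=; under eq_bigr do rewrite normrM.
  by rewrite -mulr_sumr; apply: ler_wpM2l => //; exact: hB.
- rewrite (_ : (fun n => _) = fun n => c * cospoly (P n) t).
    by apply: cvgMl_tmp; exact: hP.
  apply/funext => n; rewrite /cospoly big_map mulr_sumr /=.
  by apply: eq_bigr => q _; rewrite mulrA.
Qed.

Lemma trig_affine rho B (a b : R) F : trig rho B F ->
  trig (`|a| * rho) B (fun t => F (a * t + b)).
Proof.
move=> [P [hs hB hP]].
exists (fun n => [seq ((q.1.1, a * q.1.2), 2 * pi * q.1.2 * b + q.2) | q <- P n]).
split => [n q|n|t].
- by move=> /mapP[p pP ->] /=; rewrite normrM ler_wpM2l//; exact: (hs n).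
- by rewrite /cosmass big_map /=; exact: hB.
- rewrite (_ : (fun n => _) = fun n => cospoly (P n) (a * t + b)).
    exact: hP.
  apply/funext => n; rewrite /cospoly big_map /=.
  by apply: eq_bigr => q _; congr (_ * cos _); ring.
Qed.

(** Product-to-sum formula; the masses multiply and the frequencies add. *)
Lemma trig_mul rho rho' B B' F G : trig rho B F -> trig rho' B' G ->
  trig (rho + rho') (B * B') (fun t => F t * G t).
Proof.
move=> [P [hs hB hP]] [Q [hs' hB' hQ]].
pose pr (p q : R * R * R) := [:: ((p.1.1 * q.1.1 / 2, p.1.2 + q.1.2), p.2 + q.2);
   ((p.1.1 * q.1.1 / 2, p.1.2 - q.1.2), p.2 - q.2)].
exists (fun n => flatten [seq pr p q | p <- P n, q <- Q n]); split => [n q|n|t].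
- move=> /flattenP[l /allpairsP[[p p'] /= [/hs h1 /hs' h2 ->]]].
  rewrite !inE => /orP[] /eqP -> /=.
    by apply: le_trans (ler_normD _ _) _; exact: lerD.
  by apply: le_trans (ler_normB _ _) _; exact: lerD.
- rewrite /cosmass big_flatten /= big_allpairs_dep /=.
  rewrite (_ : \sum_(i1 <- _) _ = cosmass (P n) * cosmass (Q n)).
    apply: ler_pM; [exact: sumr_ge0|exact: sumr_ge0|exact: hB|exact: hB'].
  rewrite /cosmass mulr_suml; apply: eq_bigr => p _.
  rewrite mulr_sumr; apply: eq_bigr => q _.
  rewrite /pr !big_cons big_nil /= addr0 !normrM.
  by rewrite (@ger0_norm _ (2^-1 : R)) ?invr_ge0// -splitr.
- rewrite (_ : (fun n => _) = fun n => cospoly (P n) t * cospoly (Q n) t).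
    by apply: cvgM; [exact: hP|exact: hQ].
  apply/funext => n; rewrite /cospoly big_flatten /= big_allpairs_dep /=.
  rewrite mulr_suml; apply: eq_bigr => p _.
  rewrite mulr_sumr; apply: eq_bigr => q _.
  rewrite /pr !big_cons big_nil /= addr0.
  set a := 2 * pi * p.1.2 * t + p.2; set b := 2 * pi * q.1.2 * t + q.2.
  have -> : 2 * pi * (p.1.2 + q.1.2) * t + (p.2 + q.2) = a + b by rewrite /a /b; ring.
  have -> : 2 * pi * (p.1.2 - q.1.2) * t + (p.2 - q.2) = a - b by rewrite /a /b; ring.
  by rewrite cosD cosB; field.
Qed.

Lemma trig1 : trig 0 1 (fun=> 1).
Proof.
have := trig_cos 0 0; rewrite normr0; apply: trig_ext => t.
by rewrite mulr0 mul0r addr0 cos0.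
Qed.

Lemma trig_exp rho B F n : trig rho B F -> trig (rho *+ n) (B ^+ n) (fun t => F t ^+ n).
Proof.
move=> tF; elim: n => [|n IH]; first by rewrite mulr0n expr0; exact: trig1.
have := trig_mul tF IH; rewrite -mulrS -exprS; apply: trig_ext => t.
by rewrite exprS.
Qed.

(** ** The cardinal sine *)

Definition sinc (t : R) : R := if t == 0 then 1 else sin (pi * t) / (pi * t).

Lemma sinc0 : sinc 0 = 1. Proof. by rewrite /sinc eqxx. Qed.

Lemma sincE t : t != 0 -> sinc t = sin (pi * t) / (pi * t).
Proof. by rewrite /sinc => /negPf ->. Qed.

Lemma pi_neq0 : pi != 0 :> R. Proof. by rewrite gt_eqF// pi_gt0. Qed.

Lemma mul_sinc t : pi * t * sinc t = sin (pi * t).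
Proof.
have [->|t0] := eqVneq t 0; first by rewrite mulr0 mul0r sin0.
by rewrite sincE// mulrC divfK// mulf_neq0// pi_neq0.
Qed.

Lemma sin_pi_nat n : sin (pi * n%:R) = 0 :> R.
Proof.
elim: n => [|n IH]; first by rewrite mulr0 sin0.
by rewrite -natr1 mulrDr mulr1 sinDpi IH oppr0.
Qed.

Lemma cos_pi_nat n : cos (pi * n%:R) = (-1) ^+ n :> R.
Proof.
elim: n => [|n IH]; first by rewrite mulr0 cos0 expr0.
by rewrite -natr1 mulrDr mulr1 cosDpi IH exprS mulN1r.
Qed.

Lemma sinc_nat n : (0 < n)%N -> sinc n%:R = 0.
Proof.
by move=> n0; rewrite sincE ?pnatr_eq0 ?lt0n_neq0// sin_pi_nat mul0r.
Qed.

Lemma sincN t : sinc (- t) = sinc t.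
Proof.
have [->|t0] := eqVneq t 0; first by rewrite oppr0.
by rewrite !sincE ?oppr_eq0// mulrN sinN invrN mulrNN.
Qed.

Lemma sinc_le t : t != 0 -> `|sinc t| <= (pi * `|t|)^-1.
Proof.
move=> t0; rewrite sincE// normrM normfV normrM (gtr0_norm (@pi_gt0 R)).
by rewrite ler_piMl ?norm_sin_le1// invr_ge0 mulr_ge0// pi_ge0.
Qed.

Lemma sinc_cvg (t : R) : sinc (t / n.+1%:R) @[n --> \oo] --> (1 : R).
Proof.
have [->|t0] := eqVneq t 0.
  rewrite (_ : (fun n : nat => _) = cst (1 : R)); first exact: cvg_cst.
  by apply/funext => n; rewrite mul0r sinc0.
have := @is_derive_sin R 0; rewrite cos0 => -[+ dsin] => /cvg_ex[l hl].
have l1 : l = 1 by rewrite -dsin; apply/esym/cvg_lim.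
rewrite {}l1 in hl.
pose a (n : nat) : R := pi * (t / n.+1%:R).
have a0 n : a n != 0.
  by rewrite /a !mulf_neq0 ?pi_neq0 ?invr_eq0 ?pnatr_eq0.
have alim : a @ \oo --> (0 : R).
  rewrite /a -[X in _ --> X](mulr0 pi); apply: cvgMl_tmp.
  by rewrite -[X in _ --> X](mulr0 t); apply: cvgMl_tmp; exact: cvg_harmonic.
have := (cvgr_dnbhsP _ _ _).1 hl a (conj a0 alim).
apply: cvg_trans; apply: near_eq_cvg; apply: nearW => n.
rewrite /= sin0 subr0 addr0 /GRing.scale/= mulr1 sincE; last first.
  by rewrite mulf_neq0// invr_eq0 pnatr_eq0.
by rewrite mulrC.
Qed.

(** Telescoping after multiplication by the sine of the half step. *)
Lemma dirichlet_sum (al : R) n :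
  2 * sin al * \sum_(j < n) cos ((2 * j%:R + 1) * al - n%:R * al) = 2 * sin (n%:R * al).
Proof.
rewrite mulr_sumr.
pose g (j : nat) := sin (2 * j%:R * al - n%:R * al).
rewrite (eq_bigr (fun j : 'I_n => g j.+1 - g j)); last first.
  move=> j _; rewrite /g -[j.+1%:R]natr1.
  set x := (2 * j%:R + 1) * al - n%:R * al.
  have -> : 2 * (j%:R + 1) * al - n%:R * al = x + al by rewrite /x; ring.
  have -> : 2 * j%:R * al - n%:R * al = x - al by rewrite /x; ring.
  by rewrite (sinD x al) (sinB x al); ring.
rewrite -(big_mkord xpredT (fun j => g j.+1 - g j)) telescope_sumr// /g.
rewrite mulr0 mul0r sub0r sinN opprK.
have -> : 2 * n%:R * al - n%:R * al = n%:R * al by ring.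
by ring.
Qed.

(** The cardinal sine is the average of the characters of frequency at most 1/2;
    the midpoint Riemann sums of that average are explicit. *)
Lemma trig_sinc : trig (1 / 2) 1 sinc.
Proof.
pose P (n : nat) : seq (R * R * R) :=
  [seq ((n.+1%:R^-1, (2 * j%:R + 1 - n.+1%:R) / (2 * n.+1%:R)), 0) | j <- iota 0 n.+1].
exists P; split => [n q|n|t].
- move=> /mapP[j]; rewrite mem_iota add0n => /andP[_ jn] -> /=.
  have n0 : 0 < n.+1%:R :> R by rewrite ltr0n.
  have j1 : j%:R + 1 <= n.+1%:R :> R by rewrite natr1 ler_nat.
  have j0 : 0 <= j%:R :> R by [].
  rewrite normrM [`|(2 * _)^-1|]gtr0_norm ?invr_gt0 ?mulr_gt0//.
  rewrite ler_pdivrMr ?mulr_gt0//.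
  have -> : 1 / 2 * (2 * n.+1%:R) = n.+1%:R :> R by field.
  by rewrite ler_norml; apply/andP; split; lra.
- rewrite /cosmass /P big_map.
  under eq_bigr do rewrite /= ger0_norm ?invr_ge0//.
  rewrite big_const_seq count_predT size_iota iter_addr_0.
  by rewrite -(mulr_natr (n.+1%:R^-1)) mulVf// pnatr_eq0.
have PE n : sinc (t / n.+1%:R) * cospoly (P n) t = sinc t.
  have n0 : n.+1%:R != 0 :> R by rewrite pnatr_eq0.
  have n1 : 1 + n%:R != 0 :> R by rewrite addrC natr1.
  have [->|t0] := eqVneq t 0.
    rewrite mul0r sinc0 mul1r /cospoly /P big_map /=.
    rewrite (eq_bigr (fun=> n.+1%:R^-1)) => [|j _]; last by rewrite mulr0 addr0 cos0 mulr1.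
    rewrite big_const_seq count_predT [size _]/= size_iota iter_addr_0.
    by rewrite -(mulr_natr (n.+1%:R^-1)) mulVf.
  pose al := pi * t / n.+1%:R.
  have := dirichlet_sum al n.+1.
  have -> : n.+1%:R * al = pi * t by rewrite /al; field.
  have -> : sin al = al * sinc (t / n.+1%:R) by rewrite /al -[pi * t / _]mulrA mul_sinc.
  rewrite -mul_sinc => H.
  have -> : cospoly (P n) t = n.+1%:R^-1 *
      \sum_(j < n.+1) cos ((2 * j%:R + 1) * al - pi * t).
    rewrite /cospoly /P big_map mulr_sumr /=.
    rewrite -(big_mkord xpredT (fun j => n.+1%:R^-1 * cos ((2 * j%:R + 1) * al - pi * t))).
    apply: eq_bigr => j _; congr (_ * cos _).
    by rewrite /al; field; exact: n1.
  have pt0 : 2 * (pi * t) != 0 by rewrite !mulf_neq0 ?pi_neq0 ?pnatr_eq0.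
  apply: (mulfI pt0); rewrite -[RHS]mulrA -H /al; field; exact: n1.
rewrite (_ : (fun n => _) = fun n => sinc t / sinc (t / n.+1%:R) + (cospoly (P n) t - sinc t / sinc (t / n.+1%:R))); last first.
  by apply/funext => n; rewrite addrC subrK.
rewrite -[X in _ --> X]addr0; apply: cvgD.
  rewrite -[X in _ --> X]mulr1 -[X in _ * X]invr1; apply: cvgMl_tmp.
  by apply: cvgV; [exact: oner_neq0|exact: sinc_cvg].
apply: cvg_near_cst; near=> n.
have s0 : sinc (t / n.+1%:R) != 0.
  have : `|1 - sinc (t / n.+1%:R)| < 1.
    by near: n; have /cvgrPdist_lt := sinc_cvg t; apply.
  by apply: contraTneq => ->; rewrite subr0 normr1 ltxx.
by rewrite -{1}(PE n) mulrAC divff// mul1r subrr.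
Unshelve. all: by end_near. Qed.

(** Since [t * sinc t = sin (pi * t) / pi]; in a product with powers of [sinc],
    this absorbs polynomial factors. *)
Lemma trig_mul_sinc : trig (1 / 2) pi^-1 (fun t => t * sinc t).
Proof.
have := trig_scale pi^-1 (trig_cos (1 / 2) (- (pi / 2))).
rewrite (@ger0_norm _ (1 / 2 : R))// mulr1 (@ger0_norm _ (pi^-1)) ?invr_ge0 ?pi_ge0//.
apply: trig_ext => t; rewrite cosD cosN sinN cos_pihalf sin_pihalf.
have -> : 2 * pi * (1 / 2) * t = pi * t by field.
by rewrite mulr0 add0r mulrN1 opprK -mul_sinc !mulrA mulVf ?mul1r// pi_neq0.
Qed.
End trig.

(** * Cardinal series with Fejer weights *)
Section fejer.
Context {R : realType}.
Implicit Types (g F : R -> R) (y xi th : R) (K : nat).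

Definition fejer_points K : seq (R * R) :=
  (1, 0) :: flatten [seq [:: ((1 - k%:R / K%:R) * (-1) ^+ k, k%:R);
                             ((1 - k%:R / K%:R) * (-1) ^+ k, - k%:R)] | k <- iota 1 K.-1].

Definition fejer_sum K g : R := \sum_(q <- fejer_points K) q.1 * g q.2.

Lemma fejer_sumE K g : fejer_sum K g =
  g 0 + \sum_(1 <= k < K) (1 - k%:R / K%:R) * (-1) ^+ k * (g k%:R + g (- k%:R)).
Proof.
rewrite /fejer_sum /fejer_points big_cons mul1r; congr (_ + _).
rewrite big_flatten big_map /= /index_iota subn1.
by apply: eq_bigr => k _; rewrite !big_cons big_nil addr0 mulrDr.
Qed.

Lemma fejer_sumZ K (c : R) g : fejer_sum K (fun t => c * g t) = c * fejer_sum K g.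
Proof. by rewrite /fejer_sum mulr_sumr; apply: eq_bigr => q _; ring. Qed.

Lemma fejer_sumB K g h : fejer_sum K (fun t => g t - h t) = fejer_sum K g - fejer_sum K h.
Proof. by rewrite /fejer_sum -sumrB; apply: eq_bigr => q _; rewrite mulrBr. Qed.

(** ** The Fejer kernel *)

Definition dirichlet K (al : R) : R := 1 + 2 * \sum_(1 <= k < K.+1) cos (k%:R * al).

Lemma dirichletE K al : sin (al / 2) * dirichlet K al = sin (K%:R * al + al / 2).
Proof.
rewrite /dirichlet; elim: K => [|K IH].
  by rewrite big_geq// mulr0 addr0 mulr1 mul0r add0r.
rewrite big_nat_recr//=; set S := \sum_(1 <= k < K.+1) _ in IH *.
have -> (c : R) : sin (al / 2) * (1 + 2 * (S + c)) =
    sin (al / 2) * (1 + 2 * S) + 2 * sin (al / 2) * c by ring.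
rewrite IH.
have E1 : K%:R * al + al / 2 = K.+1%:R * al - al / 2 by rewrite -[K.+1%:R]natr1; field.
rewrite E1 (sinB (K.+1%:R * al)) (sinD (K.+1%:R * al)); ring.
Qed.

Definition fejer_kernel K (al : R) : R :=
  K%:R + 2 * \sum_(1 <= k < K) (K%:R - k%:R) * cos (k%:R * al).

Lemma fejer_kernelS K al : fejer_kernel K.+1 al = fejer_kernel K al + dirichlet K al.
Proof.
rewrite /fejer_kernel /dirichlet -[K.+1%:R]natr1.
case: K => [|K]; first by rewrite !big_geq//; ring.
rewrite (@big_nat_recr _ _ _ K.+1)//= [X in _ = _ + (_ + 2 * X)]big_nat_recr//=.
rewrite (eq_bigr (fun k : nat => (K.+1%:R - k%:R) * cos (k%:R * al) + cos (k%:R * al))).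
  by rewrite big_split /=; ring.
by move=> k _; ring.
Qed.

Lemma fejer_kernelE K al : sin (al / 2) ^+ 2 * fejer_kernel K al = sin (K%:R * al / 2) ^+ 2.
Proof.
elim: K => [|K IH].
  by rewrite /fejer_kernel big_geq// mul0r mul0r sin0 mulr0 addr0 mulr0 expr0n.
rewrite fejer_kernelS mulrDr IH [sin (al / 2) ^+ 2]expr2.
rewrite -[sin (al / 2) * _ * dirichlet _ _]mulrA dirichletE.
have E1 : K.+1%:R * al / 2 = K%:R * al / 2 + al / 2 by rewrite -[K.+1%:R]natr1; field.
have E2 : K%:R * al + al / 2 = (K%:R * al / 2) + (K%:R * al / 2 + al / 2) by field.
rewrite E1 E2; set a := K%:R * al / 2; set b := al / 2.
rewrite (sinD a (a + b)) (sinD a b) (cosD a b).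
apply/eqP; rewrite -subr_eq0; apply/eqP.
transitivity (sin a ^+ 2 * (1 - (cos b ^+ 2 + sin b ^+ 2))); first by ring.
by rewrite cos2Dsin2 subrr mulr0.
Qed.

(** The Fejer kernel is bounded uniformly in [K] away from the multiples of
    [2 * pi], whereas the number of its terms grows; hence the gain of a factor
    [1 / K] below. *)
Lemma fejer_kernel_le K xi rho : (0 < K)%N -> rho < 1 / 2 -> `|xi| <= rho ->
  `|fejer_kernel K (2 * pi * xi + pi)| <= (cos (pi * rho) ^+ 2)^-1.
Proof.
move=> K0 r1 xr.
have pi0 : 0 < pi :> R by exact: pi_gt0.
have r0 : 0 <= rho by exact: le_trans xr.
have cr : 0 < cos (pi * rho).
  apply: cos_gt0_pihalf; apply/andP; split.
    by rewrite (@lt_le_trans _ _ 0)// ?oppr_lt0 ?divr_gt0// mulr_ge0// ltW.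
  by rewrite (_ : pi / 2 = pi * (1 / 2)) ?ltr_pM2l//; field.
have cx : cos (pi * rho) <= cos (pi * xi).
  have -> : cos (pi * xi) = cos (pi * `|xi|).
    by have [_|_] := ler0P xi; rewrite ?mulrN ?cosN.
  have in1 : pi * `|xi| \in `[0, pi].
    rewrite in_itv/=; apply/andP; split; first by rewrite mulr_ge0// ltW.
    rewrite -[leRHS]mulr1 ler_pM2l// (le_trans xr)// (le_trans (ltW r1))//.
    by rewrite ler_pdivrMr// mul1r ler1n.
  have in2 : pi * rho \in `[0, pi].
    rewrite in_itv/=; apply/andP; split; first by rewrite mulr_ge0// ltW.
    rewrite -[leRHS]mulr1 ler_pM2l// (le_trans (ltW r1))//.
    by rewrite ler_pdivrMr// mul1r ler1n.
  rewrite leNgt ltr_cos// -leNgt ler_pM2l//.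
have E := fejer_kernelE K (2 * pi * xi + pi).
have sE : sin ((2 * pi * xi + pi) / 2) = cos (pi * xi).
  have -> : (2 * pi * xi + pi) / 2 = pi * xi + pi / 2 by field.
  by rewrite sinD cos_pihalf sin_pihalf mulr0 add0r mulr1.
rewrite {}sE in E.
have cx0 : 0 < cos (pi * xi) by exact: lt_le_trans cx.
have c20 : 0 < cos (pi * xi) ^+ 2 by rewrite exprn_gt0.
have -> : fejer_kernel K (2 * pi * xi + pi) =
    sin (K%:R * (2 * pi * xi + pi) / 2) ^+ 2 / cos (pi * xi) ^+ 2.
  by rewrite -E [RHS]mulrC mulKf// gt_eqF.
rewrite normrM normfV (gtr0_norm c20) -[leRHS]mul1r.
apply: ler_pM => //; first by rewrite invr_ge0 ltW.
  by rewrite normrX exprn_ile1// norm_sin_le1.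
rewrite lef_pV2 ?posrE ?exprn_gt0//.
by apply: lerXn2r => //; rewrite nnegrE ltW.
Qed.

(** ** The cardinal series *)

Lemma cos_shift_pi_nat n (x : R) : cos (x + pi * n%:R) = (-1) ^+ n * cos x.
Proof. by rewrite cosD cos_pi_nat sin_pi_nat mulr0 subr0 mulrC. Qed.

Lemma sin_pi_nat_neq0 y : sin (pi * y) != 0 -> forall n : nat,
  y - n%:R != 0 /\ y + n%:R != 0.
Proof.
move=> sy n; split; apply: contra sy.
  by rewrite subr_eq0 => /eqP ->; rewrite sin_pi_nat.
by rewrite addr_eq0 => /eqP ->; rewrite mulrN sinN sin_pi_nat oppr0.
Qed.

Lemma is_derive_sum_list (S : seq (R * R)) (g dg : R -> R -> R) (x : R) :
  (forall q, q \in S -> is_derive x 1 (g q.2) (dg q.2 x)) ->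
  is_derive x 1 (fun z => \sum_(q <- S) q.1 * g q.2 z) (\sum_(q <- S) q.1 * dg q.2 x).
Proof.
elim: S => [|q S IH] H.
  rewrite big_nil (_ : (fun z : R => _) = cst 0); first exact: is_derive_cst.
  by apply/funext => z; rewrite big_nil.
rewrite big_cons (_ : (fun z : R => _) = fun z => q.1 * g q.2 z +
    \sum_(j <- S) j.1 * g j.2 z); last by apply/funext => z; rewrite big_cons.
have h1 := H q (mem_head _ _).
have h2 : is_derive x 1 (fun z => \sum_(j <- S) j.1 * g j.2 z) (\sum_(j <- S) j.1 * dg j.2 x).
  by apply: IH => j jS; apply: H; rewrite inE jS orbT.
apply: is_deriveD; exact: (@is_deriveZ _ _ _ (g q.2) q.1).
Qed.

Lemma fejer_points_neq0 K y : sin (pi * y) != 0 ->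
  forall q, q \in fejer_points K -> y - q.2 != 0.
Proof.
move=> sy q; rewrite inE => /predU1P[->|].
  by have [+ _] := sin_pi_nat_neq0 sy 0.
move=> /flattenP[l /mapP[k _ ->]]; rewrite !inE => /orP[]/eqP -> /=.
  by have [] := sin_pi_nat_neq0 sy k.
by rewrite opprK; have [] := sin_pi_nat_neq0 sy k.
Qed.

(** As a function of the frequency, the sum has derivative a Fejer kernel times a
    sine, divided by [K].  So on the frequencies at most [rho < 1/2] it is almost
    constant, equal to its value at frequency 0. *)
Lemma fejer_const K y th xi rho : (0 < K)%N -> sin (pi * y) != 0 ->
  rho < 1 / 2 -> `|xi| <= rho ->
  `|fejer_sum K (fun t => cos (2 * pi * xi * (t - y) + th) / (y - t)) -
    cos th * fejer_sum K (fun t => (y - t)^-1)| <=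
  2 * pi * (cos (pi * rho) ^+ 2)^-1 / K%:R.
Proof.
move=> K0 sy r1 xr.
have Kp : 0 < K%:R :> R by rewrite ltr0n.
pose u z := fejer_sum K (fun t => cos (2 * pi * z * (t - y) + th) / (y - t)).
pose v z := fejer_sum K (fun t => 2 * pi * sin (2 * pi * z * (t - y) + th)).
have du (z : R) : is_derive z 1 u (v z).
  apply: (@is_derive_sum_list _ (fun t z => cos (2 * pi * z * (t - y) + th) / (y - t))
    (fun t z => 2 * pi * sin (2 * pi * z * (t - y) + th))) => q qK.
  have yq := fejer_points_neq0 sy qK.
  apply: is_derive_eq; rewrite /GRing.scale/=; field; exact: yq.
have vE z : v z = 2 * pi / K%:R * sin (th - 2 * pi * z * y) * fejer_kernel K (2 * pi * z + pi).
  rewrite /v fejer_sumE /fejer_kernel sub0r.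
  have -> : 2 * pi * z * - y + th = th - 2 * pi * z * y by ring.
  set b := th - _; rewrite [RHS]mulrDr; congr (_ + _); first by field; rewrite gt_eqF.
  rewrite !mulr_sumr; apply: eq_big_nat => k /andP[k1 kK].
  have -> : 2 * pi * z * (k%:R - y) + th = b + 2 * pi * z * k%:R by rewrite /b; ring.
  have -> : 2 * pi * z * (- k%:R - y) + th = b - 2 * pi * z * k%:R by rewrite /b; ring.
  have -> : k%:R * (2 * pi * z + pi) = 2 * pi * z * k%:R + pi * k%:R by ring.
  rewrite cos_shift_pi_nat (sinD b) (sinB b); field; rewrite gt_eqF//.
have u0 : u 0 = cos th * fejer_sum K (fun t => (y - t)^-1).
  rewrite /u -fejer_sumZ; congr fejer_sum; apply/funext => t.
  by rewrite mulr0 mul0r add0r.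
rewrite -/(u xi) -u0.
have vle z : `|z| <= rho -> `|v z| <= 2 * pi * (cos (pi * rho) ^+ 2)^-1 / K%:R.
  move=> zr; rewrite vE !normrM.
  rewrite (@ger0_norm _ (2 : R))// (gtr0_norm (@pi_gt0 R)) normfV (gtr0_norm Kp).
  rewrite [leRHS]mulrAC; apply: ler_pM => //; last exact: fejer_kernel_le.
    by rewrite !mulr_ge0 ?pi_ge0// invr_ge0 ltW.
  by rewrite ler_piMr ?norm_sin_le1// !mulr_ge0 ?pi_ge0// invr_ge0 ltW.
set C := 2 * pi * _ / _ in vle *.
have C0 : 0 <= C.
  by rewrite /C !mulr_ge0 ?pi_ge0 ?invr_ge0 ?sqr_ge0// ltW.
have cu : continuous u by exact: is_derive_continuous du.
have mvt a b : a <= b -> (forall c, a <= c -> c <= b -> `|c| <= rho) ->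
    `|u b - u a| <= C * (b - a).
  move=> ab hc; have [|c + ->] := @MVT_segment _ u v a b ab (fun z _ => du z).
    exact: continuous_subspaceT.
  rewrite in_itv/= => /andP[ac cb]; rewrite normrM (@ger0_norm _ (b - a)) ?subr_ge0//.
  by apply: ler_wpM2r; [rewrite subr_ge0|apply: vle; exact: hc].
have r01 : rho <= 1 by rewrite (le_trans (ltW r1))// ler_pdivrMr// mul1r ler1n.
have xi1 : `|xi| <= 1 by exact: le_trans r01.
have [x0|x0] := leP 0 xi.
  have := mvt 0 xi x0; rewrite subr0 => H; apply: le_trans (H _) _.
    move=> c c0 cx; rewrite ger0_norm//; apply: le_trans xr.
    by rewrite ger0_norm.
  by rewrite ler_piMr// -(ger0_norm x0).
have := mvt xi 0 (ltW x0); rewrite sub0r distrC => H; apply: le_trans (H _) _.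
  move=> c c0 cx; rewrite ler0_norm//; apply: le_trans xr.
  by rewrite ltr0_norm// lerN2.
by rewrite ler_piMr// -(ltr0_norm x0).
Qed.

Definition fejer_unit K y : R := fejer_sum K (fun t => (y - t)^-1).

Lemma fejer_const_cos K y xi th rho : (0 < K)%N -> sin (pi * y) != 0 ->
  rho < 1 / 2 -> `|xi| <= rho ->
  `|fejer_sum K (fun t => cos (2 * pi * xi * t + th) / (y - t)) -
    cos (2 * pi * xi * y + th) * fejer_unit K y| <=
  2 * pi * (cos (pi * rho) ^+ 2)^-1 / K%:R.
Proof.
move=> K0 sy r1 xr; have := fejer_const (2 * pi * xi * y + th) K0 sy r1 xr.
have -> // : (fun t => cos (2 * pi * xi * (t - y) + (2 * pi * xi * y + th)) / (y - t)) =
  (fun t => cos (2 * pi * xi * t + th) / (y - t)).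
by apply/funext => t; congr (cos _ / _); ring.
Qed.

Lemma big_even (h : nat -> R) (M : nat) : (forall j, h (2 * j).+1%N = 0) ->
  \sum_(1 <= k < (2 * M)%N) h k = \sum_(1 <= j < M) h (2 * j)%N.
Proof.
move=> h0; elim: M => [|M IH]; first by rewrite !big_geq.
case: M IH => [|M] IH; first by rewrite muln1 big_nat1 (h0 0%N) big_geq.
rewrite [in RHS]big_nat_recr//= -IH.
have -> : (2 * M.+2 = (2 * M.+1).+2)%N by rewrite mulnS.
rewrite big_nat_recr ?muln_gt0//= h0 addr0 big_nat_recr ?muln_gt0//.
Qed.

Lemma fejer_half (M : nat) y : (0 < M)%N -> sin (pi * y) != 0 ->
  fejer_sum (2 * M)%N (fun t => cos (2 * pi * (1 / 4) * t + 0) / (y - t)) =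
  fejer_unit M (y / 2) / 2.
Proof.
move=> M0 sy; rewrite /fejer_unit !fejer_sumE.
have M1 : M%:R != 0 :> R by rewrite pnatr_eq0 -lt0n.
have cE (k : nat) : cos (2 * pi * (1 / 4) * k%:R + 0) = cos (pi / 2 * k%:R) :> R.
  by congr cos; field.
have cNE (k : nat) : cos (2 * pi * (1 / 4) * - k%:R + 0) = cos (pi / 2 * k%:R) :> R.
  by rewrite -cosN; congr cos; field.
have c2 (j : nat) : cos (pi / 2 * (2 * j)%N%:R) = (-1) ^+ j :> R.
  by rewrite -cos_pi_nat natrM; congr cos; field.
have c3 (j : nat) : cos (pi / 2 * (2 * j)%N.+1%:R) = 0 :> R.
  have -> : pi / 2 * (2 * j)%N.+1%:R = pi / 2 + pi * j%:R :> R.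
    by rewrite -[(2 * j)%N.+1%:R]natr1 natrM; field.
  by rewrite cos_shift_pi_nat cos_pihalf mulr0.
rewrite [RHS]mulrDl; congr (_ + _).
  have := cE 0%N; rewrite !mulr0 addr0 cos0 mul1r !subr0 => _.
  by rewrite invfM invrK mulfK// pnatr_eq0.
pose h (k : nat) := (1 - k%:R / (2 * M)%N%:R) * (-1) ^+ k *
  (cos (pi / 2 * k%:R) / (y - k%:R) + cos (pi / 2 * k%:R) / (y - - k%:R)) : R.
rewrite (@eq_big_nat _ _ _ _ _ _ h); last by move=> k _; rewrite /h cE cNE.
rewrite mulr_suml.
rewrite big_even; last first.
  by move=> j; rewrite /h c3 !mul0r addr0 mulr0.
apply: eq_big_nat => j /andP[j1 jM]; rewrite /h c2 exprM sqrrN !expr1n.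
have [h1 h2] := sin_pi_nat_neq0 sy (2 * j)%N.
have [h3 h4] : y / 2 - j%:R != 0 /\ y / 2 + j%:R != 0.
  have -> : y / 2 - j%:R = (y - (2 * j)%N%:R) / 2 by rewrite natrM; field.
  have -> : y / 2 + j%:R = (y + (2 * j)%N%:R) / 2 by rewrite natrM; field.
  by rewrite !mulf_neq0 ?invr_eq0 ?pnatr_eq0.
rewrite !natrM in h1 h2 *; field; rewrite ?M1 ?h1 ?h2 ?h3 ?h4/=.
have e1 : y + - (1 *- j) * 2 = y + 2 * j%:R by rewrite opprK mulrC.
have e2 : y + 1 *- j * 2 = y - 2 * j%:R by rewrite mulNr mulrC.
by rewrite e1 e2 h1 h2.
Qed.

Lemma norm_sin_le (x : R) : `|sin x| <= `|x|.
Proof.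
wlog x0 : x / 0 <= x.
  move=> H; have [/H//|x0] := leP 0 x.
  by rewrite -normrN -sinN -[leRHS]normrN; apply: H; rewrite oppr_ge0 ltW.
have [|c _] := @MVT_segment _ sin cos 0 x x0 (fun z _ => is_derive_sin z).
  exact/continuous_subspaceT/continuous_sin.
rewrite sin0 !subr0 => E; rewrite E normrM ler_piMl ?norm_cos_le1//.
Qed.

Lemma sinc_near1 (t : R) : `|sinc t - 1| <= (pi * t) ^+ 2 / 2.
Proof.
wlog t0 : t / 0 < t.
  move=> H; have [/H//|t0|<-] := ltgtP 0 t.
    by rewrite -sincN -sqrrN -mulrN; apply: H; rewrite oppr_gt0.
  by rewrite sinc0 subrr normr0 mulr0 expr0n/= mul0r.
have pt0 : 0 < pi * t by rewrite mulr_gt0 ?pi_gt0.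
have [|c + E] := @MVT_segment _ sin cos 0 (pi * t) (ltW pt0) (fun z _ => is_derive_sin z).
  exact/continuous_subspaceT/continuous_sin.
rewrite in_itv/= => /andP[c0 ct].
have -> : sinc t = cos c.
  by rewrite sincE ?gt_eqF//; move: E; rewrite sin0 !subr0 => ->; rewrite mulfK// gt_eqF.
have -> : cos c - 1 = - (2 * sin (c / 2) ^+ 2).
  have -> : cos c = cos (c / 2 + c / 2) by rewrite -splitr.
  have h := cos2Dsin2 (c / 2).
  by rewrite cosD; lra.
rewrite normrN normrM normrX (@ger0_norm _ (2 : R))//.
apply: (@le_trans _ _ (2 * (c / 2) ^+ 2)).
  rewrite ler_pM2l// -[(c / 2) ^+ 2]ger0_norm ?sqr_ge0// normrX.
  by apply: lerXn2r; rewrite ?nnegrE// norm_sin_le.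
have -> : 2 * (c / 2) ^+ 2 = c ^+ 2 / 2 by field.
by rewrite ler_pM2r// ler_sqr ?nnegrE// ltW.
Qed.

(** Normalised so that the limit, which is to be determined, is 1. *)
Definition scaled_unit K y : R := sin (pi * y) / pi * fejer_unit K y.

Definition doubling_const : R := 2 * pi * (cos (pi * (1 / 4)) ^+ 2)^-1.

Lemma doubling_const_ge0 : 0 <= doubling_const.
Proof. by rewrite /doubling_const mulr_ge0 ?invr_ge0 ?sqr_ge0// mulr_ge0 ?pi_ge0. Qed.

Lemma sin_half_neq0 y : sin (pi * y) != 0 -> sin (pi * (y / 2)) != 0.
Proof.
apply: contra => /eqP h.
have -> : pi * y = pi * (y / 2) + pi * (y / 2) by field.
by rewrite sinD h mul0r mulr0 addr0.
Qed.

(** Applying the almost constancy to cos(pi t / 2), which vanishes at the odd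
    integers, relates the sums at [y] and at [y / 2]. *)
Lemma scaled_unit_half M y : (0 < M)%N -> sin (pi * y) != 0 ->
  `|scaled_unit (2 * M) y - scaled_unit M (y / 2)| <= doubling_const / M%:R.
Proof.
move=> M0 sy.
have r1 : 1 / 4 < 1 / 2 :> R by rewrite ltr_pM2l// ltf_pV2 ?posrE// ltr_nat.
have r2 : `|1 / 4 : R| <= 1 / 4 by rewrite ger0_norm.
have M20 : (0 < 2 * M)%N by rewrite muln_gt0.
have := fejer_const_cos 0 M20 sy r1 r2; rewrite fejer_half//.
have -> : 2 * pi * (1 / 4) * y + 0 = pi * (y / 2) by field.
rewrite -/doubling_const => H.
have sE : sin (pi * y) = 2 * (sin (pi * (y / 2)) * cos (pi * (y / 2))).
  have -> : pi * y = pi * (y / 2) + pi * (y / 2) by field.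
  by rewrite sinD; ring.
have -> : scaled_unit (2 * M) y - scaled_unit M (y / 2) =
   - (2 / pi * sin (pi * (y / 2))) *
   (fejer_unit M (y / 2) / 2 - cos (pi * (y / 2)) * fejer_unit (2 * M) y).
  rewrite /scaled_unit sE; have p0 := @pi_neq0 R; set S := sin _; set C := cos _.
  move: (fejer_unit _ _) (fejer_unit _ _) S C p0; move: (pi : R) => p u u' S C p0.
  by field.
rewrite normrM -[leRHS]mul1r; apply: ler_pM => //.
  have q1 : 2 / pi <= 1 :> R by rewrite ler_pdivrMr ?pi_gt0// mul1r pi_ge2.
  have q0 : 0 <= 2 / pi :> R by rewrite divr_ge0// pi_ge0.
  by rewrite normrN normrM (ger0_norm q0) mulr_ile1// norm_sin_le1.
apply: le_trans H _; apply: ler_wpM2l; first exact: doubling_const_ge0.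
by rewrite lef_pV2 ?posrE ?ltr0n// ler_nat leq_pmull.
Qed.

(** Iterating the comparison of [y] with [y / 2] along a geometric series
    reduces the computation of the limit to points close to 0. *)
Lemma scaled_unit_iter n M y : (0 < M)%N -> sin (pi * y) != 0 ->
  `|scaled_unit (2 ^ n * M) y - scaled_unit M (y / 2 ^+ n)| <=
   doubling_const / M%:R * (2 - 2 / 2 ^+ n).
Proof.
elim: n y => [|n IH] y M0 sy.
  by rewrite expr0 expn0 mul1n !divr1 subrr normr0 subrr mulr0.
have nM : (0 < 2 ^ n * M)%N by rewrite muln_gt0 expn_gt0.
have h1 := scaled_unit_half nM sy; have h2 := IH _ M0 (sin_half_neq0 sy).
have e1 : y / 2 ^+ n.+1 = y / 2 / 2 ^+ n by rewrite exprS invfM mulrA.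
rewrite expnS -mulnA e1 -[X in `|X - _|](subrK (scaled_unit (2 ^ n * M) (y / 2))) -addrA.
apply: le_trans (ler_normD _ _) _; apply: le_trans (lerD h1 h2) _.
rewrite natrM natrX exprS le_eqVlt; apply/orP; left; apply/eqP; field.
by rewrite pnatr_eq0 -lt0n M0 expf_neq0.
Qed.

Lemma inv_sq_sum_le K (y : R) : `|y| <= 1 / 2 ->
  \sum_(1 <= k < K) `|(k%:R ^+ 2 - y ^+ 2)^-1| <= 2.
Proof.
move=> y1.
have y2 : y ^+ 2 <= 1 / 4.
  have -> : (1 / 4 : R) = (1 / 2) ^+ 2 by field.
  by rewrite -(real_normK (num_real y)) lerXn2r ?nnegrE.
pose g (k : nat) : R := - (k%:R - 1 / 2)^-1.
case: K => [|K]; first by rewrite big_geq.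
apply: (@le_trans _ _ (\sum_(1 <= k < K.+1) (g k.+1 - g k))).
  apply: ler_sum_nat => k /andP[k1 kK].
  have k1' : 1 <= k%:R :> R by rewrite ler1n.
  have k2 : 1 <= k%:R ^+ 2 :> R by rewrite exprn_ege1.
  have p1 : 0 < k%:R ^+ 2 - y ^+ 2 by lra.
  rewrite gtr0_norm ?invr_gt0// /g -[k.+1%:R]natr1 opprK.
  have p2 : 0 < k%:R - 1 / 2 :> R by lra.
  have p3 : 0 < k%:R + 1 - 1 / 2 :> R by lra.
  have -> : - (k%:R + 1 - 1 / 2)^-1 + (k%:R - 1 / 2)^-1 =
      ((k%:R + 1 - 1 / 2) * (k%:R - 1 / 2))^-1 :> R.
    by field; rewrite !gt_eqF//; lra.
  rewrite lef_pV2 ?posrE ?mulr_gt0//.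
  by have -> : (k%:R + 1 - 1 / 2) * (k%:R - 1 / 2) = k%:R ^+ 2 - 1 / 4 :> R; [field|lra].
rewrite telescope_sumr// /g opprK.
have -> : (1%:R - 1 / 2 : R)^-1 = 2 by field.
rewrite gerDr oppr_le0 invr_ge0 -natr1.
by have : 0 <= K%:R :> R by []; lra.
Qed.

(** Near 0 the term of index 0 dominates. *)
Lemma scaled_unit_near1 K y : (0 < K)%N -> sin (pi * y) != 0 -> `|y| <= 1 / 2 ->
  `|scaled_unit K y - 1| <= `|sinc y - 1| + 4 * y ^+ 2.
Proof.
move=> K0 sy y1.
have Kp : 0 < K%:R :> R by rewrite ltr0n.
have y0 : y != 0 by apply: contra sy => /eqP ->; rewrite mulr0 sin0.
have E : fejer_unit K y = y^-1 + \sum_(1 <= k < K)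
    (1 - k%:R / K%:R) * (-1) ^+ k * (2 * y * - (k%:R ^+ 2 - y ^+ 2)^-1).
  rewrite /fejer_unit fejer_sumE subr0; congr (_ + _); apply: eq_big_nat => k _.
  have [h1 h2] := sin_pi_nat_neq0 sy k; congr (_ * _); rewrite opprK.
  have h3 : k%:R ^+ 2 - y ^+ 2 != 0.
    by rewrite -oppr_eq0 opprB subr_sqr mulf_neq0.
  by field; rewrite h1 h2 h3.
have -> : scaled_unit K y - 1 = (sinc y - 1) + sin (pi * y) / pi *
    (fejer_unit K y - y^-1).
  by rewrite /scaled_unit mulrBr sincE// invfM; have := @pi_neq0 R; move: (fejer_unit _ _) => u;
    move: (pi : R) => p p0; field; rewrite p0 y0.
apply: le_trans (ler_normD _ _) _; rewrite lerD2l E [_ + _ - _]addrAC subrr add0r.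
apply: (@le_trans _ _ (`|y| * (2 * `|y| * 2))); last first.
  by rewrite -(real_normK (num_real y)) le_eqVlt; apply/orP; left; apply/eqP; ring.
rewrite normrM; apply: ler_pM => //.
  rewrite normrM normfV (gtr0_norm (@pi_gt0 R)) ler_pdivrMr ?pi_gt0//.
  by apply: le_trans (norm_sin_le _) _; rewrite normrM (gtr0_norm (@pi_gt0 R)) mulrC.
apply: le_trans (ler_norm_sum _ _ _) _.
apply: le_trans (ler_wpM2l _ (inv_sq_sum_le K y1)); last by rewrite mulr_ge0.
rewrite mulr_sumr; apply: ler_sum_nat => k /andP[k1 kK].
rewrite !normrM normrN normrX normrN1 expr1n mulr1 (@ger0_norm _ (2 : R))//.
rewrite -[leRHS]mul1r; apply: ler_pM => //; rewrite ?mulr_ge0//.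
have kK1 : k%:R / K%:R <= 1 :> R by rewrite ler_pdivrMr// mul1r ler_nat ltnW.
have kK0 : 0 <= k%:R / K%:R :> R by rewrite divr_ge0.
by rewrite ler_norml; apply/andP; split; lra.
Qed.

(** A power of 4, so that half of the doublings bring [y] close to 0 while the
    remaining order still tends to infinity. *)
Definition fejer_order (n : nat) : nat := (2 ^ n * 2 ^ n)%N.

Lemma cvg_half_pow : ((2 : R) ^+ n)^-1 @[n --> \oo] --> (0 : R).
Proof.
rewrite (_ : (fun n : nat => _) = (fun n : nat => (2^-1 : R) ^+ n)); last first.
  by apply/funext => n; rewrite exprVn.
by apply: cvg_expr; rewrite ger0_norm// invf_lt1// ltr1n.
Qed.

Lemma fejer_unit_cvg y : sin (pi * y) != 0 ->
  fejer_unit (fejer_order n) y @[n --> \oo] --> pi / sin (pi * y).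
Proof.
move=> sy.
suff H : scaled_unit (fejer_order n) y @[n --> \oo] --> (1 : R).
  rewrite (_ : (fun n : nat => _) = fun n => pi / sin (pi * y) * scaled_unit (fejer_order n) y).
    by rewrite -[X in _ --> X]mulr1; apply: cvgMl_tmp.
  apply/funext => n; rewrite /scaled_unit; move: sy (@pi_neq0 R) (fejer_unit _ _).
  move: (sin (pi * y)) => S; move: (pi : R) => p S0 p0 u.
  by field; rewrite p0 S0.

have sn n : sin (pi * (y / 2 ^+ n)) != 0.
  elim: n => [|n IH]; first by rewrite expr0 divr1.
  have -> : y / 2 ^+ n.+1 = y / 2 ^+ n / 2 by rewrite exprSr invfM mulrA.
  exact: sin_half_neq0.
pose c := 2 * doubling_const + (pi * y) ^+ 2 / 2 + 4 * y ^+ 2.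
have c0 : 0 <= c.
  have := doubling_const_ge0; have := sqr_ge0 (pi * y); have := sqr_ge0 y.
  by rewrite /c; lra.
have [n0 _ n0P] : \forall n \near \oo, `|y| * ((2 : R) ^+ n)^-1 <= 1 / 2.
  have h : `|y| * ((2 : R) ^+ n)^-1 @[n --> \oo] --> (0 : R).
    by rewrite -[X in _ --> X](mulr0 `|y|); apply: cvgMl_tmp; exact: cvg_half_pow.
  by apply: (cvgr_le 0 h); lra.
apply/cvgrPdist_le => e e0.
have [n1 _ n1P] : \forall n \near \oo, c * ((2 : R) ^+ n)^-1 <= e.
  have h : c * ((2 : R) ^+ n)^-1 @[n --> \oo] --> (0 : R).
    by rewrite -[X in _ --> X](mulr0 c); apply: cvgMl_tmp; exact: cvg_half_pow.
  exact: (cvgr_le 0 h).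
exists (maxn n0 n1) => // n /=; rewrite geq_max => /andP[nn0 nn1].
apply: le_trans (n1P n nn1).
have pn0 : 0 < (2 : R) ^+ n by rewrite exprn_gt0.
have yn : `|y / 2 ^+ n| <= 1 / 2.
  by rewrite normrM normfV (gtr0_norm pn0); exact: n0P.
have P0 : (0 < 2 ^ n)%N by rewrite expn_gt0.
have h1 := scaled_unit_iter n P0 sy.
have h2 := scaled_unit_near1 P0 (sn n) yn.
have h3 := sinc_near1 (y / 2 ^+ n).
rewrite distrC -[X in `|X - 1|](subrK (scaled_unit (2 ^ n) (y / 2 ^+ n))) -addrA.
apply: le_trans (ler_normD _ _) _; apply: le_trans (lerD h1 h2) _.
apply: le_trans (lerD (lexx _) (lerD h3 (lexx _))) _.
set q := ((2 : R) ^+ n)^-1.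
have q0 : 0 <= q by rewrite invr_ge0 ltW.
have q1 : q <= 1 by rewrite invf_le1// exprn_ege1// ler1n.
have qq : q ^+ 2 <= q by rewrite expr2 ler_piMr.
rewrite natrX -/q.
have -> : pi * (y * q) = (pi * y) * q by rewrite mulrA.
rewrite (exprMn_comm 2 (mulrC (pi * y) q)) (exprMn_comm 2 (mulrC y q)).
have d0 := doubling_const_ge0.
have u1 : doubling_const * q * (2 - 2 * q) <= 2 * doubling_const * q.
  have := mulr_ge0 d0 (mulr_ge0 q0 q0).
  have -> : doubling_const * q * (2 - 2 * q) =
     2 * doubling_const * q - 2 * (doubling_const * (q * q)) by ring.
  by lra.
have u2 := ler_wpM2l (sqr_ge0 (pi * y)) qq.
have u3 := ler_wpM2l (sqr_ge0 y) qq.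
move: u1 u2 u3; rewrite /c; move: ((pi * y) ^+ 2) => X u1 u2 u3.
have -> : (2 * doubling_const + X / 2 + 4 * y ^+ 2) * q =
   2 * doubling_const * q + X * q / 2 + 4 * (y ^+ 2 * q) by ring.
by lra.
Qed.

(** ** Sampling formula *)

(** For characters this is [fejer_const_cos] together with the limit
    [fejer_unit_cvg]; both sides are combinations of point evaluations, so the
    estimate passes to all limits of trigonometric polynomials. *)
Lemma fejer_sampling y rho : sin (pi * y) != 0 -> rho < 1 / 2 ->
  exists2 eps : nat -> R, eps n @[n --> \oo] --> (0 : R) &
  forall B F, trig rho B F -> forall n,
    `|fejer_sum (fejer_order n) (fun t => F t / (y - t)) - F y * (pi / sin (pi * y))| <=
    B * eps n.
Proof.
move=> sy r1.
pose c := 2 * pi * (cos (pi * rho) ^+ 2)^-1 : R.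
have c0 : 0 <= c by rewrite /c mulr_ge0 ?invr_ge0 ?sqr_ge0// mulr_ge0 ?pi_ge0.
exists (fun n => c / (fejer_order n)%:R +
   `|fejer_unit (fejer_order n) y - pi / sin (pi * y)|).
  rewrite -[X in _ --> X](addr0 0); apply: cvgD.
    rewrite -[X in _ --> X](mulr0 c); apply: cvgMl_tmp.
    rewrite (_ : (fun n : nat => _) = fun n => ((2 : R) ^+ n)^-1 * ((2 : R) ^+ n)^-1).
      rewrite -[X in _ --> X](mulr0 0); apply: cvgM; exact: cvg_half_pow.
    by apply/funext => n; rewrite /fejer_order natrM natrX invfM.
  have h := fejer_unit_cvg sy.
  apply/norm_cvg0P; rewrite -[X in _ --> X](subrr (pi / sin (pi * y))).
  by apply: cvgB h _; apply: cvg_cst.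
move=> B F tF n; set K := fejer_order n.
have K0 : (0 < K)%N by rewrite muln_gt0 !expn_gt0.
pose A := (- (pi / sin (pi * y)), y) :: [seq (q.1 / (y - q.2), q.2) | q <- fejer_points K].
have AE g : \sum_(q <- A) q.1 * g q.2 =
    fejer_sum K (fun t => g t / (y - t)) - g y * (pi / sin (pi * y)).
  rewrite /A big_cons addrC; congr (_ + _); last by rewrite /= mulNr mulrC.
  rewrite big_map /fejer_sum; apply: eq_bigr => q _ /=.
  by rewrite mulrAC mulrA.
rewrite -AE; apply: (trig_functional _ _ tF).
  by rewrite addr_ge0// divr_ge0.
move=> xi th xr; rewrite (AE (fun t => cos (2 * pi * xi * t + th))).
set g := fejer_sum _ _; set C := cos _.
rewrite -[X in `|X - _|](subrK (C * fejer_unit K y)) -addrA -mulrBr.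
apply: le_trans (ler_normD _ _) _; apply: lerD.
  exact: (fejer_const_cos th K0 sy r1 xr).
by rewrite normrM ler_piMl// norm_cos_le1.
Qed.

End fejer.

(** * A weak Bernstein inequality *)
Section lipschitz.
Context {R : realType}.
Implicit Types (y t h : R) (K n : nat) (F : R -> R) (rho B M : R).

Lemma le_of_cvg0 (x a : R) (u : nat -> R) : u n @[n --> \oo] --> (0 : R) ->
  (forall n, x <= a + u n) -> x <= a.
Proof.
move=> u0 H.
have h : a + u n @[n --> \oo] --> a.
  by rewrite -[X in _ --> X]addr0; apply: cvgD => //; exact: cvg_cst.
by apply: (cvgr_to_ge h); near=> n; exact: H.
Unshelve. all: by end_near. Qed.

(** The difference of two terms has a denominator of degree two, so the series
    converges absolutely, with a bound that only involves the supremum of [F]. *)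
Lemma fejer_diff_le K F M y : (forall t, `|F t| <= M) -> `|y - 1 / 2| <= 1 / 4 ->
  `|fejer_sum K (fun t => F t / (y - t)) - fejer_sum K (fun t => F t / (1 / 2 - t))| <=
  40 * M * `|y - 1 / 2|.
Proof.
move=> FM yh; rewrite -fejer_sumB fejer_sumE.
have M0 : 0 <= M by apply: le_trans (FM 0).
have P (t : R) (d : R) : 0 < d -> d <= `|1 / 2 - t| -> 1 / 2 <= `|1 / 2 - t| ->
    `|F t / (y - t) - F t / (1 / 2 - t)| <= 2 * M * `|y - 1 / 2| * (d ^+ 2)^-1.
  move=> d0 dt t2.
  have t0 : 0 < `|1 / 2 - t| by lra.
  have e1 : `|1 / 2 - t| / 2 <= `|y - t|.
    have : `|1 / 2 - t| <= `|y - t| + `|y - 1 / 2|.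
      have -> : 1 / 2 - t = (y - t) - (y - 1 / 2) by ring.
      exact: ler_normB.
    by lra.
  have yt0 : 0 < `|y - t| by lra.
  have -> : F t / (y - t) - F t / (1 / 2 - t) =
      - (F t * (y - 1 / 2) * ((y - t) * (1 / 2 - t))^-1).
    have n1 : y - t != 0 by rewrite -normr_gt0.
    have n2 : 1 / 2 - t != 0 by rewrite -normr_gt0.
    field; rewrite n1 andbT; move: n2; apply: contra => /eqP h; apply/eqP.
    by lra.
  have -> : 2 * M * `|y - 1 / 2| * (d ^+ 2)^-1 = M * `|y - 1 / 2| * (d ^+ 2 / 2)^-1.
    by field; rewrite gt_eqF.
  rewrite normrN !normrM normfV normrM; apply: ler_pM.
  - by rewrite mulr_ge0.
  - by rewrite invr_ge0 mulr_ge0.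
  - exact: ler_wpM2r.
  rewrite lef_pV2 ?posrE ?mulr_gt0 ?exprn_gt0//.
  have -> : d ^+ 2 / 2 = d / 2 * d by rewrite expr2; ring.
  by apply: ler_pM => //; lra.
pose c := 2 * M * `|y - 1 / 2|.
have c0 : 0 <= c by rewrite /c !mulr_ge0.
have -> : 40 * M * `|y - 1 / 2| = 4 * c + 16 * c by rewrite /c; ring.
apply: le_trans (ler_normD _ _) _; apply: lerD.
  have := @P 0 (1 / 2); rewrite !subr0 -/c => H.
  have e4 : ((1 / 2 : R) ^+ 2)^-1 = 4 by field.
  have h0 : `|1 / 2 : R| = 1 / 2 by rewrite ger0_norm.
  have h1 : 0 < 1 / 2 :> R by lra.
  by move: H; rewrite h0 e4 [c * 4]mulrC; apply.
apply: le_trans (ler_norm_sum _ _ _) _.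
have y0 : `|0 : R| <= 1 / 2 by rewrite normr0; lra.
have -> : 16 * c = 8 * c * 2 by ring.
have c8 : 0 <= 8 * c by rewrite mulr_ge0.
apply: le_trans (ler_wpM2l c8 (inv_sq_sum_le K y0)); rewrite mulr_sumr.
apply: ler_sum_nat => k /andP[k1 kK].
have kp : 1 <= k%:R :> R by rewrite ler1n.
have Kp : 0 < K%:R :> R by rewrite ltr0n; apply: leq_trans kK.
rewrite expr0n subr0 normrM -[leRHS]mul1r; apply: ler_pM => //.
  rewrite normrM normrX normrN1 expr1n mulr1.
  have kK1 : k%:R / K%:R <= 1 :> R by rewrite ler_pdivrMr// mul1r ler_nat ltnW.
  have kK0 : 0 <= k%:R / K%:R :> R by rewrite divr_ge0.
  by rewrite ler_norml; apply/andP; split; lra.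
apply: le_trans (ler_normD _ _) _.
have -> : 8 * c * `|(k%:R ^+ 2)^-1| = c * ((k%:R / 2) ^+ 2)^-1 + c * ((k%:R / 2) ^+ 2)^-1.
  rewrite ger0_norm ?invr_ge0 ?sqr_ge0//; field.
  by rewrite gt_eqF//; lra.
apply: lerD; apply: P.
- by lra.
- by rewrite distrC ger0_norm; lra.
- by rewrite distrC ger0_norm; lra.
- by lra.
- by rewrite opprK ger0_norm; lra.
- by rewrite opprK ger0_norm; lra.
Qed.

Lemma lipschitz_at_half rho B M F y : rho < 1 / 2 -> trig rho B F ->
  (forall t, `|F t| <= M) -> `|y - 1 / 2| <= 1 / 4 ->
  `|F y - F (1 / 2)| <= 40 * M * `|y - 1 / 2|.
Proof.
move=> r1 tF FM yh; set h := y - 1 / 2 in yh *.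
have M0 : 0 <= M by apply: le_trans (FM 0).
have piE : pi * y = pi / 2 + pi * h by rewrite /h; field.
have sE : sin (pi * y) = cos (pi * h) by rewrite piE addrC sinDpihalf.
have s2 : sin (pi * (1 / 2)) = 1 :> R.
  by have -> : pi * (1 / 2) = pi / 2 :> R; [ring|exact: sin_pihalf].
have p0 := @pi_gt0 R.
have cp : 0 < cos (pi * h).
  have ph : `|pi * h| <= pi / 4.
    have h4 : `|h| <= 4^-1 by apply: le_trans yh _; rewrite div1r.
    by rewrite normrM (gtr0_norm p0) (ler_wpM2l (ltW p0) h4).
  apply: cos_gt0_pihalf; move: ph; rewrite ler_norml => /andP[h1 h2].
  by apply/andP; split; lra.
have sy : sin (pi * y) != 0 by rewrite sE gt_eqF.
have sh : sin (pi * (1 / 2)) != 0 :> R by rewrite s2 oner_neq0.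
have [e1 e10 e1P] := fejer_sampling sy r1.
have [e2 e20 e2P] := fejer_sampling sh r1.
have D : `|F y * (pi / sin (pi * y)) - F (1 / 2) * pi| <= 40 * M * `|h|.
  apply: (@le_of_cvg0 _ _ (fun n => B * e1 n + B * e2 n)).
    by rewrite -[X in _ --> X](addr0 0); apply: cvgD;
      rewrite -[X in _ --> X](mulr0 B); apply: cvgMl_tmp.
  move=> n; have h1 := e1P _ _ tF n; have := e2P _ _ tF n.
  have := fejer_diff_le (fejer_order n) FM yh.
  rewrite s2 divr1 => h2 h3.
  move: h1 h2 h3; set a := fejer_sum _ _; set b := fejer_sum _ _.
  rewrite -/h; move: (F y * _) (F (1 / 2) * _) => u v h1 h2 h3.
  have -> : u - v = - (a - u) + ((a - b) + (b - v)) by ring.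
  apply: le_trans (ler_normD _ _) _; rewrite normrN.
  apply: le_trans (lerD (lexx _) (ler_normD _ _)) _.
  by apply: le_trans (lerD h1 (lerD h2 h3)) _; lra.
have -> : F y - F (1 / 2) = cos (pi * h) / pi * (F y * (pi / sin (pi * y)) - F (1 / 2) * pi)
   - (1 - cos (pi * h)) * F (1 / 2).
  rewrite sE; move: (cos (pi * h)) cp => C C0; move: (pi : R) p0 => p p1.
  by field; rewrite (gt_eqF C0) (gt_eqF p1).
have c1 : cos (pi * h) / pi <= 1 / 2.
  by rewrite ler_pdivrMr//; have := cos_le1 (pi * h); have := @pi_ge2 R; lra.
have c2 : 0 <= cos (pi * h) / pi by rewrite divr_ge0// ltW.
have c3 : 0 <= 1 - cos (pi * h) by rewrite subr_ge0 cos_le1.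
have c4 : 1 - cos (pi * h) <= 8 * `|h|.
  have cE : 1 - cos (pi * h) = 2 * sin (pi * h / 2) ^+ 2.
    have e : pi * h = pi * h / 2 + pi * h / 2 by field.
    by have f := cos2Dsin2 (pi * h / 2); rewrite [in LHS]e cosD; lra.
  have s1 := norm_sin_le (pi * h / 2); have s3 := norm_sin_le1 (pi * h / 2).
  have p4 : pi <= 4 :> R by have := @pihalf_lt2 R; lra.
  rewrite cE -(real_normK (num_real (sin _))).
  have ph : `|pi * h / 2| <= 2 * `|h|.
    rewrite normrM normfV normrM (gtr0_norm p0) (@ger0_norm _ (2 : R))//.
    by have := ler_wpM2r (normr_ge0 h) p4; lra.
  have : `|sin (pi * h / 2)| ^+ 2 <= `|sin (pi * h / 2)| by rewrite expr2 ler_piMr.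
  have := le_trans s1 ph; have := normr_ge0 h.
  by move: (`|sin _|) (`|h|) => X Y; lra.
apply: le_trans (ler_normB _ _) _.
rewrite [leLHS](congr2 _ (normrM _ _) (normrM _ _)) (ger0_norm c2) (ger0_norm c3).
have u1 := ler_pM c2 (normr_ge0 _) c1 D.
have u2 := ler_pM c3 (normr_ge0 _) c4 (FM (1 / 2)).
apply: le_trans (lerD u1 u2) _.
have := mulr_ge0 M0 (normr_ge0 h).
have -> : 1 / 2 * (40 * M * `|h|) + 8 * `|h| * M = 28 * (M * `|h|) by field.
by rewrite -mulrA; move: (M * `|h|) => X; lra.
Qed.

(** A bounded function with bounded spectrum is Lipschitz, with a constant that
    only depends on the supremum and on the spectrum, not on the mass [B].  By
    translation and dilation it is enough to compare with the value at 1/2. *)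
Lemma trig_lipschitz rho B M F t t' : 0 <= rho -> trig rho B F ->
  (forall t, `|F t| <= M) -> `|F t - F t'| <= 40 * (2 * rho + 1) * M * `|t - t'|.
Proof.
move=> r0 tF FM.
have M0 : 0 <= M by apply: le_trans (FM 0).
pose a := 2 * rho + 1; have a0 : 0 < a by rewrite /a; lra.
have tG := trig_affine a^-1 (t' - a^-1 * (1 / 2)) tF.
set G := (fun s : R => _) in tG.
have r1 : `|a^-1| * rho < 1 / 2.
  by rewrite gtr0_norm ?invr_gt0// mulrC ltr_pdivrMr// /a; lra.
have GM s : `|G s| <= M by exact: FM.
pose y := 1 / 2 + a * (t - t').
have Gy : G y = F t.
  rewrite /G /y; congr F; rewrite mulrDr mulrA mulVf ?gt_eqF//; ring.
have Gh : G (1 / 2) = F t' by rewrite /G; congr F; ring.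
have yh : `|y - 1 / 2| = a * `|t - t'|.
  by rewrite /y addrAC subrr add0r normrM gtr0_norm.
have -> : 40 * a * M * `|t - t'| = 40 * M * `|y - 1 / 2| by rewrite yh; ring.
rewrite -Gy -Gh.
have [h|h] := leP `|y - 1 / 2| (1 / 4); first exact: lipschitz_at_half r1 tG GM h.
apply: le_trans (ler_normB _ _) _.
apply: le_trans (lerD (GM _) (GM _)) _.
by have := ler_wpM2l M0 (ltW h); move: (`|y - 1 / 2|) => X; rewrite -mulrA; lra.
Qed.

End lipschitz.

(** * Partial fractions and shifted lattices *)
Section partial_fractions.
Local Open Scope ring_scope.

Lemma partial_fractions (F : fieldType) (n : nat) (y : 'I_n -> F) (p : {poly F}) (z : F) :
  injective y -> (size p <= n)%N -> (forall i, z != y i) ->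
  p.[z] / \prod_i (z - y i) =
  \sum_i p.[y i] / \prod_(j | j != i) (y i - y j) / (z - y i).
Proof.
move=> yinj sp zy.
pose c i := p.[y i] / \prod_(j | j != i) (y i - y j).
pose q := p - \sum_i c i *: \prod_(j | j != i) ('X - (y j)%:P).
have qE x : q.[x] = p.[x] - \sum_i c i * \prod_(j | j != i) (x - y j).
  rewrite /q hornerD hornerN horner_sum; congr (_ - _); apply: eq_bigr => i _.
  by rewrite hornerZ horner_prod; congr (_ * _); apply: eq_bigr => j _; rewrite hornerXsubC.
have q0 : q = 0.
  apply: (@roots_geq_poly_eq0 _ _ [seq y i | i <- enum 'I_n]).
  - apply/allP => x /mapP[i _ ->]; apply/eqP; rewrite qE.
    have s0 : \sum_(k | k != i) c k * \prod_(j | j != k) (y i - y j) = 0.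
      apply: big1 => k ki; rewrite (bigD1 i) 1?eq_sym//= subrr mul0r mulr0//.
    rewrite (bigD1 i)//= s0 addr0 /c divfK ?subrr//; apply/prodf_neq0 => j ji.
    by rewrite subr_eq0; apply: contra ji => /eqP/yinj ->.
  - by rewrite map_inj_uniq ?enum_uniq.
  rewrite size_map size_enum_ord; apply: leq_trans (size_polyD _ _) _.
  rewrite size_polyN geq_max sp; apply: leq_trans (size_sum _ _ _) _.
  apply/bigmax_leqP => i _; apply: leq_trans (size_scale_leq _ _) _.
  rewrite (eq_bigl (mem (predC1 i)))// -big_enum/= size_prod_XsubC -cardE cardC1 card_ord.
  by case: n i {y p z yinj sp zy c q qE} => [[]|].
have := qE z; rewrite q0 horner0 => /esym/eqP; rewrite subr_eq0 => /eqP ->.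
rewrite mulr_suml; apply: eq_bigr => i _; rewrite [X in _ / X](bigD1 i)//=.
have h1 : z - y i != 0 by rewrite subr_eq0.
have h2 : \prod_(j | j != i) (z - y j) != 0.
  by apply/prodf_neq0 => j _; rewrite subr_eq0.
rewrite -/(c i); move: (\prod_(j | j != i) _) (z - y i) (c i) h1 h2 => u w k h1 h2.
by field; rewrite h1 h2.
Qed.

End partial_fractions.

Section shift.
Context {R : realType}.
Implicit Types (x y s t : R).

Lemma sin_pi_ge x : `|x| <= 1 / 4 -> `|x| <= `|sin (pi * x)|.
Proof.
move=> x4; rewrite -mul_sinc normrM normrM (gtr0_norm (@pi_gt0 R)).
have p2 := @pi_ge2 R.
have p4 : pi <= 4 :> R by have := @pihalf_lt2 R; lra.
have s1 : `|sinc x - 1| <= 1 / 2.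
  apply: le_trans (sinc_near1 x) _.
  have h : `|pi * x| <= 1.
    rewrite normrM (gtr0_norm (@pi_gt0 R)).
    by have := ler_pM (@pi_ge0 R) (normr_ge0 x) p4 x4; lra.
  rewrite -(real_normK (num_real (pi * x))) ler_pM2r//.
  by rewrite expr_le1.
have s2 : 1 / 2 <= `|sinc x|.
  have := ler_normB 1 (1 - sinc x); rewrite distrC in s1.
  have -> : 1 - (1 - sinc x) = sinc x by ring.
  have := lerB_normD 1 (- (1 - sinc x)); rewrite normrN normr1.
  have -> : 1 - (1 - sinc x) = sinc x by ring.
  by move: (`|sinc x|) (`|1 - sinc x|) s1 => X Y; lra.
have := ler_pM _ _ p2 s2; have h0 : 0 <= (1 : R) / 2 by lra.
move=> /(_ (ltac:(by [])) h0) h.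
have : 1 * `|x| <= pi * `|sinc x| * `|x| by apply: ler_wpM2r => //; lra.
by rewrite mul1r mulrAC.
Qed.

(** Pigeonhole principle: among [n.+1] equally spaced shifts, each of the [n]
    points excludes at most one, because two excluded shifts would be too close. *)
Lemma good_shift n (y : 'I_n -> R) : exists s, [/\ 0 < s, s <= 1 / 4 &
  forall i, (8 * n.+1%:R)^-1 <= `|sin (pi * (y i - s))|].
Proof.
pose sh (i : 'I_n.+1) : R := i.+1%:R / (4 * n.+1%:R).
have n0 : 0 < n.+1%:R :> R by rewrite ltr0n.
apply: contrapT => H.
have bad (i : 'I_n.+1) : exists j, `|sin (pi * (y j - sh i))| < (8 * n.+1%:R)^-1.
  apply: contrapT => H'; apply: H; exists (sh i); split.
  - by rewrite divr_gt0// ?ltr0n// mulr_gt0.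
  - rewrite /sh ler_pdivrMr ?mulr_gt0//.
    have : i.+1%:R <= n.+1%:R :> R by rewrite ler_nat.
    by lra.
  move=> j; rewrite leNgt; apply/negP => h; apply: H'; by exists j.
have [f fP] := choice bad.
have [i [i' [ii' ff]]] : exists i i', i != i' /\ f i = f i'.
  apply: contrapT => K.
  have finj : injective f.
    move=> i i' ff; apply: contrapT => ii'; apply: K; exists i, i'; split => //.
    exact/eqP.
  by have := leq_card f finj; rewrite !card_ord ltnn.
have h1 := fP i; have h2 := fP i'; rewrite -ff in h2.
have d1 : (4 * n.+1%:R)^-1 <= `|sh i - sh i'|.
  have q0 : 0 <= (4 * n.+1%:R)^-1 :> R by rewrite invr_ge0 mulr_ge0 1?ltW.
  rewrite /sh -mulrBl normrM (ger0_norm q0) -[leLHS]mul1r; apply: ler_wpM2r => //.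
  have iN : (i : nat) != i' by rewrite (inj_eq val_inj).
  move: iN; rewrite neq_ltn => /orP[] lt.
    have : i.+1%:R + 1 <= i'.+1%:R :> R by rewrite natr1 ler_nat.
    by rewrite distrC => h; apply: le_trans (ler_norm _); lra.
  have : i'.+1%:R + 1 <= i.+1%:R :> R by rewrite natr1 ler_nat.
  by move=> h; apply: le_trans (ler_norm _); lra.
have d2 : `|sh i - sh i'| <= 1 / 4.
  have hs (k : 'I_n.+1) : 0 <= sh k /\ sh k <= 1 / 4.
    split; first by rewrite divr_ge0// mulr_ge0.
    rewrite /sh ler_pdivrMr ?mulr_gt0//.
    have : k.+1%:R <= n.+1%:R :> R by rewrite ler_nat.
    by lra.
  have [a1 a2] := hs i; have [b1 b2] := hs i'.
  by rewrite ler_norml; apply/andP; split; lra.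
have := le_trans d1 (sin_pi_ge d2).
have -> : pi * (sh i - sh i') = pi * (y (f i) - sh i') - pi * (y (f i) - sh i) by ring.
rewrite sinB => h.
have := le_trans h (ler_normB _ _); rewrite !normrM.
have c1 := norm_cos_le1 (pi * (y (f i) - sh i)); have c2 := norm_cos_le1 (pi * (y (f i) - sh i')).
have u1 := ler_wpM2l (normr_ge0 (sin (pi * (y (f i) - sh i')))) c1.
have u2 := ler_wpM2r (normr_ge0 (sin (pi * (y (f i) - sh i)))) c2.
have -> : (4 * n.+1%:R)^-1 = 2 * (8 * n.+1%:R)^-1 :> R by field; rewrite gt_eqF//; lra.
move: h1 h2 u1 u2; rewrite mulr1 mul1r.
move=> h1 h2 u1 u2 h3.
have := lt_le_trans (le_lt_trans (le_trans h3 (lerD u1 u2)) (ltrD h2 h1)) (lexx _).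
by move: ((8 * _)^-1) => X; lra.
Qed.

Lemma norm_sin_shift x k : `|sin (pi * (x + k%:R))| = `|sin (pi * x)|.
Proof. by rewrite mulrDr sinD sin_pi_nat cos_pi_nat mulr0 addr0 normrM normrX normrN1 expr1n mulr1. Qed.

Lemma norm_sin_shiftN x k : `|sin (pi * (x - k%:R))| = `|sin (pi * x)|.
Proof. by rewrite -(norm_sin_shift (x - k%:R) k) subrK. Qed.

Lemma norm_sin_pi_le x : `|sin (pi * x)| <= 4 * `|x|.
Proof.
apply: le_trans (norm_sin_le _) _; rewrite normrM (gtr0_norm (@pi_gt0 R)).
apply: ler_wpM2r => //; by have := @pihalf_lt2 R; lra.
Qed.

(** The sine controls the distance to all the integers shifted by [s] at once. *)
Lemma lattice_dist y s k : `|sin (pi * (y - s))| <= 4 * `|k%:R + s - y|.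
Proof.
apply: le_trans (norm_sin_pi_le _); rewrite -[k%:R + s - y]opprK mulrN sinN normrN.
have -> : - (k%:R + s - y) = y - s - k%:R by ring.
by rewrite norm_sin_shiftN.
Qed.

Lemma lattice_distN y s k : `|sin (pi * (y - s))| <= 4 * `|- k%:R + s - y|.
Proof.
apply: le_trans (norm_sin_pi_le _); rewrite -[- k%:R + s - y]opprK mulrN sinN normrN.
have -> : - (- k%:R + s - y) = y - s + k%:R by ring.
by rewrite norm_sin_shift.
Qed.

End shift.

Section blocks.
Context {R : realType}.

Lemma prod_divn (L n : nat) (f : nat -> R) : (0 < L)%N ->
  \prod_(0 <= m < n * L) f (m %/ L)%N = (\prod_(0 <= p < n) f p) ^+ L.
Proof.
move=> L0; elim: n => [|n IH]; first by rewrite mul0n !big_geq// expr1n.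
rewrite big_nat_recr//= exprMn -IH mulSnr (@big_cat_nat _ _ _ (n * L)%N)//=; last exact: leq_addr.
congr (_ * _).
rewrite (@eq_big_nat _ _ _ _ _ _ (fun=> f n)) ?prodr_const_nat ?addKn// => m /andP[h1 h2].
by rewrite -(subnKC h1) divnMDl// divn_small ?addn0// ltn_subLR.
Qed.

Lemma tele_up (d : nat -> R) a b : (a <= b)%N -> (forall k, 0 < d k) ->
  \prod_(a <= k < b) (d k.+1 / d k) = d b / d a.
Proof.
move=> ab d0; move: ab; elim: b => [|b IH].
  by rewrite leqn0 => /eqP ->; rewrite big_geq// divff// gt_eqF.
rewrite leq_eqVlt => /orP[/eqP <-|]; first by rewrite big_geq// divff// gt_eqF.
rewrite ltnS => ab; rewrite big_nat_recr//= IH//.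
by rewrite mulrC mulrA divfK// gt_eqF.
Qed.

Lemma tele_down (d : nat -> R) a b : (a <= b)%N -> (forall k, 0 < d k) ->
  \prod_(a <= k < b) (d k / d k.+1) = d a / d b.
Proof.
move=> ab d0; rewrite -[RHS]invf_div -(tele_up ab d0) -prodfV.
by apply: eq_bigr => k _; rewrite invf_div.
Qed.

End blocks.

(** * Products over blocks *)
Section block_products.
Context {R : realType}.
Implicit Types (L N m p : nat) (h lam : nat -> R) (t kap : R).

(** Left end of the block of index [p], when the window of [2 * N] blocks of
    length [L] is centred at 0. *)
Definition block L N p : R := (p%:R - N%:R) * L%:R.

Definition in_blocks L N h := forall m, (m < 2 * N * L)%N ->
  block L N (m %/ L) <= h m /\ h m <= block L N (m %/ L).+1.

Lemma block_le L N p q : (p <= q)%N -> block L N p <= block L N q.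
Proof. by move=> pq; apply: ler_wpM2r => //; rewrite lerD2r ler_nat. Qed.

Lemma ratio_le (x y u w : R) : 0 <= x -> x <= u -> 0 < w -> w <= y -> x / y <= u / w.
Proof.
move=> x0 xu w0 wy; have y0 := lt_le_trans w0 wy.
by apply: ler_pM => //; rewrite ?invr_ge0 ?(ltW y0)// lef_pV2.
Qed.

(** The points are listed block by block, so the block of the point of index [m]
    is [m %/ L]. *)
Lemma prod_block_le L n (g f : nat -> R) : (0 < L)%N ->
  (forall m, (m < n * L)%N -> 0 <= g m /\ g m <= f (m %/ L)%N) ->
  \prod_(0 <= m < n * L) g m <= (\prod_(0 <= p < n) f p) ^+ L.
Proof.
move=> L0 H; rewrite -prod_divn// big_nat [leRHS]big_nat; apply: ler_prod => m /andP[_ mn].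
by have [h1 h2] := H m mn; rewrite h1.
Qed.

(** Replacing a point by another one of the same block changes a distance to [t]
    by at most one block length; the resulting bounds, block by block, form a
    telescoping product. *)
Lemma far_block_product L N h lam t kap : (0 < L)%N -> (0 < N)%N ->
  in_blocks L N h -> in_blocks L N lam -> 0 < kap -> kap <= 1 ->
  (forall m, (m < 2 * N * L)%N -> kap <= `|t - h m|) -> (N * L)%:R <= `|t| ->
  \prod_(0 <= m < 2 * N * L) (`|t - lam m| / `|t - h m|) <= (2 * `|t| / kap) ^+ L.
Proof.
move=> L0 N0 hb lb k0 k1 hk tM.
have M1 : 1 <= (N * L)%:R :> R by rewrite ler1n muln_gt0 N0.
have t1 : 1 <= `|t| by apply: le_trans tM.
pose d p := Num.max `|t - block L N p| kap.
have d0 p : 0 < d p by rewrite lt_max k0 orbT.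
have dk p : kap <= d p by rewrite le_max lexx orbT.
have b0 : block L N 0 = - (N * L)%:R by rewrite /block sub0r mulNr natrM.
have b2 : block L N (2 * N) = (N * L)%:R by rewrite /block natrM natrM; ring.
have dt p : (p <= 2 * N)%N -> d p <= 2 * `|t|.
  move=> p2; rewrite /d ge_max; apply/andP; split; last by lra.
  apply: le_trans (ler_normB _ _) _.
  have : `|block L N p| <= (N * L)%:R.
    rewrite ler_norml -b0 -b2; apply/andP; split; exact: block_le.
  by move: (`|block _ _ _|) => X; lra.
have pL m : (m < 2 * N * L)%N -> (m %/ L < 2 * N)%N by move=> mN; rewrite ltn_divLR.
have [t0|t0] := leP 0 t.
  rewrite (ger0_norm t0) in tM t1 *.
  apply: le_trans (prod_block_le (f := fun p => d p / d p.+1) L0 _) _.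
    move=> m mN; split; first by rewrite divr_ge0.
    have [h1 h2] := hb m mN; have [l1 l2] := lb m mN.
    have b3 : block L N (m %/ L).+1 <= t by apply: le_trans tM; rewrite -b2; apply: block_le; exact: pL.
    apply: ratio_le => //.
      rewrite le_max; apply/orP; left; rewrite !ger0_norm ?subr_ge0.
      - by rewrite lerD2l lerN2.
      - by apply: le_trans b3; exact: block_le.
      - exact: le_trans l2 b3.
    rewrite ge_max hk// andbT !ger0_norm ?subr_ge0//.
    - by rewrite lerD2l lerN2.
    - exact: le_trans h2 b3.
  rewrite tele_down//.
  have D : d 0%N / d (2 * N)%N <= 2 * t / kap.
    apply: ratio_le => //; first exact: ltW.
    by have := dt 0%N isT; rewrite ger0_norm.
  have D0 : 0 <= d 0%N / d (2 * N)%N by rewrite divr_ge0// ltW.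
  by apply: lerXn2r => //; rewrite nnegrE//; exact: le_trans D.
rewrite (ltr0_norm t0) in tM t1 *.
apply: le_trans (prod_block_le (f := fun p => d p.+1 / d p) L0 _) _.
  move=> m mN; split; first by rewrite divr_ge0.
  have [h1 h2] := hb m mN; have [l1 l2] := lb m mN.
  have b3 : t <= block L N (m %/ L).
    by apply: (@le_trans _ _ (block L N 0)); [rewrite b0 lerNr|exact: block_le].
  apply: ratio_le => //.
    rewrite le_max; apply/orP; left; rewrite !ler0_norm ?subr_le0.
    - by rewrite lerN2 lerD2l lerN2.
    - by apply: le_trans b3 _; exact: block_le.
    - exact: le_trans b3 l1.
  rewrite ge_max hk// andbT !ler0_norm ?subr_le0//.
  - by rewrite lerN2 lerD2l lerN2.
  - exact: le_trans b3 h1.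
rewrite tele_up//.
have D : d (2 * N)%N / d 0%N <= 2 * - t / kap.
  apply: ratio_le => //; first exact: ltW.
  by have := dt (2 * N)%N (leqnn _); rewrite ltr0_norm.
have D0 : 0 <= d (2 * N)%N / d 0%N by rewrite divr_ge0// ltW.
by apply: lerXn2r => //; rewrite nnegrE//; exact: le_trans D.
Qed.

(** The same telescoping argument, on either side of the origin. *)
Lemma origin_block_product L N h lam kap : (0 < L)%N -> (0 < N)%N ->
  in_blocks L N h -> in_blocks L N lam -> 0 < kap -> kap <= 1 ->
  (forall m, (m < 2 * N * L)%N -> kap <= `|lam m|) ->
  \prod_(0 <= m < 2 * N * L) (`|h m| / `|lam m|) <= (((N * L)%:R / kap) ^+ 2) ^+ L.
Proof.
move=> L0 N0 hb lb k0 k1 hk.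
have M1 : 1 <= (N * L)%:R :> R by rewrite ler1n muln_gt0 N0.
pose d p := Num.max `|block L N p| kap.
have d0 p : 0 < d p by rewrite lt_max k0 orbT.
have b0 : block L N 0 = - (N * L)%:R by rewrite /block sub0r mulNr natrM.
have bN : block L N N = 0 by rewrite /block subrr mul0r.
have b2 : block L N (2 * N) = (N * L)%:R by rewrite /block natrM natrM; ring.
have kM : kap <= (N * L)%:R by apply: le_trans M1.
have d00 : d 0%N = (N * L)%:R by rewrite /d b0 normrN ger0_norm// max_l.
have dN : d N = kap by rewrite /d bN normr0 max_r// ltW.
have d2 : d (2 * N)%N = (N * L)%:R by rewrite /d b2 ger0_norm// max_l.
apply: le_trans (prod_block_le (f := fun p => if (N <= p)%N then d p.+1 / d p else d p / d p.+1) L0 _) _.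
  move=> m mN; split; first by rewrite divr_ge0.
  have [h1 h2] := hb m mN; have [l1 l2] := lb m mN.
  case: leqP => Np.
    have b3 : 0 <= block L N (m %/ L) by rewrite -bN block_le.
    have b4 : 0 <= block L N (m %/ L).+1 by apply: le_trans b3 _; exact: block_le.
    have h0 : 0 <= h m by apply: le_trans h1.
    have l0 : 0 <= lam m by apply: le_trans l1.
    apply: ratio_le => //.
      by rewrite le_max; apply/orP; left; rewrite !ger0_norm.
    by rewrite ge_max hk// andbT !ger0_norm.
  have b4 : block L N (m %/ L).+1 <= 0 by rewrite -bN block_le.
  have b3 : block L N (m %/ L) <= 0 by apply: le_trans b4; exact: block_le.
  have h0 : h m <= 0 by apply: le_trans h2 _.
  have l0 : lam m <= 0 by apply: le_trans l2 _.
  apply: ratio_le => //.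
    by rewrite le_max; apply/orP; left; rewrite !ler0_norm// lerN2.
  by rewrite ge_max hk// andbT !ler0_norm// lerN2.
apply: lerXn2r; rewrite ?nnegrE.
- by apply: prodr_ge0 => p _; case: ifP => _; rewrite divr_ge0// ltW.
- exact: sqr_ge0.
rewrite (@big_cat_nat _ _ _ N)//=; last by rewrite leq_pmull.
rewrite (@eq_big_nat _ _ _ 0 N _ (fun p => d p / d p.+1)); last first.
  by move=> p /andP[_ pN]; rewrite leqNgt pN.
rewrite (@eq_big_nat _ _ _ N (2 * N) _ (fun p => d p.+1 / d p)); last first.
  by move=> p /andP[pN _]; rewrite pN.
rewrite tele_down// tele_up//; last by rewrite leq_pmull.
by rewrite d00 dN d2 expr2.
Qed.

End block_products.

(** * Exchanging lattice points for nodes *)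
Section interpolation.
Context {R : realType}.
Implicit Types (rho B : R) (F : R -> R).

Lemma mem_fejer_points K (q : R * R) : q \in fejer_points K ->
  exists k : nat, q.2 = k%:R \/ q.2 = - k%:R.
Proof.
rewrite inE => /orP[/eqP ->|]; first by exists 0%N; left.
move=> /flattenP[s /mapP[k _ ->]]; rewrite !inE => /orP[] /eqP ->; exists k.
  by left.
by right.
Qed.

Lemma fejer_points_mass K (g : R -> R) : (forall t, 0 <= g t) ->
  \sum_(q <- fejer_points K) `|q.1| * g q.2 <=
  g 0 + \sum_(1 <= k < K) (g k%:R + g (- k%:R)).
Proof.
move=> g0; rewrite /fejer_points big_cons normr1 mul1r lerD2l.
rewrite big_flatten big_map /=.
have -> (f : nat -> R) : \sum_(j <- iota 1 K.-1) f j = \sum_(1 <= j < K) f j.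
  by rewrite /index_iota subn1.
apply: ler_sum_nat => k /andP[k1 kK]; rewrite !big_cons big_nil addr0 /= -mulrDr.
rewrite ler_piMl ?addr_ge0// normrM normrX normrN1 expr1n mulr1.
have Kp : 0 < K%:R :> R by rewrite ltr0n; apply: leq_trans kK.
have kK1 : k%:R / K%:R <= 1 :> R by rewrite ler_pdivrMr// mul1r ler_nat ltnW.
have kK0 : 0 <= k%:R / K%:R :> R by rewrite divr_ge0.
by rewrite ler_norml; apply/andP; split; lra.
Qed.

Lemma sum_inv_sq_tail (v : nat -> R) (c : R) M K : (1 < M)%N -> 0 <= c ->
  (forall k, (k < M)%N -> v k = 0) ->
  (forall k, (M <= k)%N -> v k <= c / k%:R ^+ 2) ->
  \sum_(1 <= k < K) v k <= c / M.-1%:R.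
Proof.
move=> M1 c0 v0 vc; have M0 : (0 < M)%N by apply: ltnW.
have Mp : 0 < M.-1%:R :> R by rewrite ltr0n -ltnS prednK.
have [KM|MK] := leqP K M.
  rewrite big_nat big1 ?divr_ge0 ?(ltW Mp)// => k /andP[_ kK].
  by apply: v0; apply: leq_trans KM.
rewrite (@big_cat_nat _ _ _ M)//=; last exact: ltnW.
rewrite big_nat big1 ?add0r; last by move=> k /andP[_ kM]; exact: v0.
pose g (k : nat) : R := - (c / k.-1%:R).
apply: (@le_trans _ _ (\sum_(M <= k < K) (g k.+1 - g k))).
  apply: ler_sum_nat => k /andP[k1 kK]; apply: le_trans (vc _ k1) _.
  have k0 : (0 < k)%N by apply: leq_trans k1.
  have k1' : (0 < k.-1)%N by rewrite -ltnS prednK//; apply: leq_trans k1.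
  rewrite /g /= -{1 2}(prednK k0); move: k1'; case: (k.-1) => // j _.
  rewrite -[j.+2%:R]natr1; have : 0 < j.+1%:R :> R by rewrite ltr0n.
  move: (j.+1%:R) => x x0.
  have -> : - (c / (x + 1)) - - (c / x) = c * (x * (x + 1))^-1.
    by field; rewrite !gt_eqF//; lra.
  apply: ler_wpM2l => //; rewrite lef_pV2 ?posrE ?mulr_gt0 ?exprn_gt0//; try lra.
rewrite telescope_sumr ?(ltnW MK)// /g opprK gerDr oppr_le0 divr_ge0//.
Qed.

Lemma lattice_block_ineq (q r n l s : R) : 0 < s -> s <= 1 / 4 -> r + 1 <= l -> 0 <= r ->
  (q - n) * l <= q * l + r - n * l + s /\ q * l + r - n * l + s <= (q + 1 - n) * l.
Proof.
move=> s0 s1 r1 r0; split.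
  by have -> : (q - n) * l = q * l - n * l; [ring|lra].
by have -> : (q + 1 - n) * l = q * l - n * l + l; [ring|lra].
Qed.

Lemma cancel_middle (A x u w : R) : x != 0 -> A * (x * u) / (x * w) = A * (u / w).
Proof.
move=> x0; rewrite invfM; transitivity (A * (x / x * (u / w))); first by ring.
by rewrite divff// mul1r.
Qed.

Definition growth_const : R := 256 * 128 ^+ 2.

Lemma growth_const_ge0 : 0 <= growth_const.
Proof. by apply: mulr_ge0 => //; apply: exprn_ge0. Qed.

Lemma growth_ineq (u x : R) : 1 <= x -> x <= u ->
  2 * u * (128 * x) * (x * (128 * x)) ^+ 2 <= growth_const * u ^+ 6.
Proof.
move=> x1 xu; have x0 : 0 <= x by lra.
have u0 : 0 <= u by lra.
have xx : x ^+ 5 <= u ^+ 5 by apply: lerXn2r.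
have -> : 2 * u * (128 * x) * (x * (128 * x)) ^+ 2 = growth_const * (u * x ^+ 5).
  by rewrite /growth_const; ring.
rewrite (exprS u 5); apply: ler_wpM2l; first exact: growth_const_ge0.
exact: ler_wpM2l.
Qed.

Lemma shifted_norm (k t : R) : 0 < t -> t <= 1 / 4 -> 1 <= k ->
  [/\ `|k + t| = k + t, `|- k + t| = k - t, k ^+ 2 <= (k + t) ^+ 2 &
      (k / 2) ^+ 2 <= (k - t) ^+ 2].
Proof.
move=> t0 t1 k1; split; first by rewrite ger0_norm//; lra.
- by rewrite ler0_norm; lra.
- by apply: lerXn2r; rewrite ?nnegrE; lra.
by apply: lerXn2r; rewrite ?nnegrE; lra.
Qed.

Lemma shifted_inv_sq (c k t : R) : 0 <= c -> 0 < t -> t <= 1 / 4 -> 1 <= k ->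
  c / `|k + t| ^+ 2 <= c / k ^+ 2 /\ c / `|- k + t| ^+ 2 <= 4 * c / k ^+ 2.
Proof.
move=> c0 t0 t1 k1; have [-> -> h1 h2] := shifted_norm t0 t1 k1.
have k0 : 0 < k by lra.
have k20 : 0 < k / 2 by lra.
have p1 : 0 < k ^+ 2 by exact: exprn_gt0.
have p2 : 0 < (k / 2) ^+ 2 by exact: exprn_gt0.
split; last have -> : 4 * c / k ^+ 2 = c / (k / 2) ^+ 2 by field; rewrite gt_eqF.
  apply: ler_wpM2l => //; rewrite lef_pV2// posrE; exact: lt_le_trans h1.
apply: ler_wpM2l => //; rewrite lef_pV2// posrE; exact: lt_le_trans h2.
Qed.

Lemma shifted_norm_ge (X k t : R) : 0 < t -> t <= 1 / 4 -> 1 <= X ->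
  (X <= k -> X <= `|k + t|) /\ (X + 1 <= k -> X <= `|- k + t|).
Proof.
move=> t0 t1 X1; split => kX.
  by rewrite ger0_norm; lra.
by rewrite ler0_norm; lra.
Qed.

Variables (L N : nat) (h : nat -> R) (s delta : R).
Let M := (2 * N * L)%N.
Let kap : R := (128 * (N * L)%:R)^-1.

Definition lattice_node (m : nat) : R := m%:R - (N * L)%:R + s.
Local Notation lam := lattice_node.

Definition node (i : 'I_M.+1) : R := if val i is k.+1 then h k else 0.

(** The rational function that exchanges the lattice points of the window for the
    nodes, normalised to be 1 at 0. *)
Definition swap_ratio (t : R) : R :=
  \prod_(0 <= m < M) ((t - lam m) / lam m * (h m / (t - h m))).
Local Notation U := swap_ratio.

Definition swap_poly : {poly R} :=
  \prod_(0 <= m < M) ((h m / lam m) *: ('X - (lam m)%:P)).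

(** The residue at [node i] of [swap_ratio] divided by the variable: the pole at
    0 stands for the point at which a function is to be recovered. *)
Definition residue (i : 'I_M.+1) : R :=
  swap_poly.[node i] / \prod_(j | j != i) (node i - node j).

Definition good_nodes := [/\ in_blocks L N h,
  (forall m m', (m < M)%N -> (m' < M)%N -> m != m' -> delta <= `|h m - h m'|),
  (forall m, (m < M)%N -> h m != 0) &
  [/\ 0 < s, s <= 1 / 4 & forall i, 4 * kap <= `|sin (pi * (node i - s))|]].

Hypotheses (L0 : (0 < L)%N) (N0 : (0 < N)%N) (d0 : 0 < delta) (G : good_nodes).

Lemma ML1 : 1 <= (N * L)%:R :> R. Proof. by rewrite ler1n muln_gt0 N0. Qed.

Lemma kap_gt0 : 0 < kap.
Proof. by rewrite invr_gt0 mulr_gt0//; apply: lt_le_trans ML1. Qed.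

Lemma kap_le1 : kap <= 1.
Proof. by rewrite invf_le1 ?mulr_gt0//; have := ML1; [lra|move=> ?; lra]. Qed.

Lemma node_gap (i : 'I_M.+1) (k : nat) :
  kap <= `|k%:R + s - node i| /\ kap <= `|- k%:R + s - node i|.
Proof.
have [_ _ _ [_ _ /(_ i) H]] := G.
by have := lattice_dist (node i) s k; have := lattice_distN (node i) s k; split; lra.
Qed.

Lemma lattice_nodeE m : exists k : nat, lam m = k%:R + s \/ lam m = - k%:R + s.
Proof.
rewrite /lam; have [h1|h1] := leqP (N * L) m.
  by exists (m - N * L)%N; left; rewrite natrB.
by exists (N * L - m)%N; right; rewrite natrB ?opprB// ltnW.
Qed.

Lemma lattice_node_gap (i : 'I_M.+1) m : kap <= `|lam m - node i|.
Proof.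
by have [k [->|->]] := lattice_nodeE m; have [? ?] := node_gap i k.
Qed.

Lemma lattice_node_ge m : kap <= `|lam m|.
Proof. by have := lattice_node_gap ord0 m; rewrite subr0. Qed.

Lemma lattice_node_neq0 m : lam m != 0.
Proof. by rewrite -normr_gt0; apply: lt_le_trans (lattice_node_ge m); exact: kap_gt0. Qed.

Lemma lattice_node_blocks : in_blocks L N lam.
Proof.
have [_ _ _ [s0 s1 _]] := G.
move=> m mM; rewrite /block /lam -[_.+1%:R]natr1 natrM.
have E : m%:R = (m %/ L)%:R * L%:R + (m %% L)%:R :> R.
  by rewrite -natrM -natrD -divn_eq.
have h1 : (m %% L)%:R + 1 <= L%:R :> R by rewrite natr1 ler_nat ltn_mod.
have h2 : 0 <= (m %% L)%:R :> R by [].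
rewrite E; exact: lattice_block_ineq.
Qed.

Lemma node_inj : injective node.
Proof.
have [_ hd h0 _] := G.
move=> [[|i] iM] [[|j] jM] => /= E; apply/val_inj => //=.
- by move: (h0 j jM); rewrite /node/= in E; rewrite -E eqxx.
- by move: (h0 i iM); rewrite /node/= in E; rewrite E eqxx.
congr _.+1; apply/eqP; apply: contraT => ij; have := hd i j iM jM ij.
by rewrite /node/= in E; rewrite E subrr normr0 leNgt d0.
Qed.

Lemma size_swap_poly : (size swap_poly <= M.+1)%N.
Proof.
rewrite /swap_poly; elim: M => [|n IH]; first by rewrite big_geq// size_polyC oner_neq0.
rewrite big_nat_recr//=; apply: leq_trans (size_polyMleq _ _) _.
have := size_scale_leq (h n / lam n) ('X - (lam n)%:P); rewrite size_XsubC => h2.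
by rewrite -ltnS; case: (size _ + _)%N (leq_add IH h2) => [|k]//=; rewrite addn2.
Qed.

Lemma swap_polyE z : swap_poly.[z] = \prod_(0 <= m < M) (h m / lam m * (z - lam m)).
Proof. by rewrite horner_prod; apply: eq_bigr => m _; rewrite hornerZ hornerXsubC. Qed.

Lemma prod_node (z : R) :
  \prod_i (z - node i) = z * \prod_(0 <= m < M) (z - h m).
Proof.
rewrite big_ord_recl /node/= subr0 big_mkord; congr (_ * _).
Qed.

Lemma swap_ratioE z : (forall i, z != node i) ->
  U z / z = \sum_i residue i / (z - node i).
Proof.
move=> zn; rewrite -(partial_fractions node_inj size_swap_poly zn) prod_node swap_polyE.
rewrite invfM mulrCA mulrC -prodfV -big_split/=; congr (_ * _).
by apply: eq_bigr => m _; ring.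
Qed.

Lemma residue0 : residue ord0 = 1.
Proof.
have [_ _ h0 _] := G.
rewrite /residue swap_polyE.
have -> : \prod_(j | j != ord0) (node ord0 - node j) = \prod_(0 <= m < M) (0 - h m).
  rewrite big_mkcond big_ord_recl/= mul1r big_mkord; apply: eq_bigr => j _.
  by rewrite /node.
rewrite -prodfV -big_split/= big_nat big1// => m /andP[_ mM].
have := h0 m mM; have := lattice_node_neq0 m => l0 hm0; rewrite {1}/node/=.
by field; rewrite l0 hm0.
Qed.

Lemma swap_ratio_norm t : `|U t| =
  (\prod_(0 <= m < M) (`|t - lam m| / `|t - h m|)) *
  (\prod_(0 <= m < M) (`|h m| / `|lam m|)).
Proof.
rewrite normr_prod -big_split/=; apply: eq_bigr => m _.
by rewrite !normrM !normfV; ring.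
Qed.

Lemma swap_ratio_eq0 m : (m < M)%N -> U (lam m) = 0.
Proof.
move=> mM; rewrite /U big_mkord (bigD1 (Ordinal mM))//= subrr mul0r mul0r mul0r//.
Qed.

(** The exponent does not depend on the window, so that a fixed power of [sinc]
    can compensate for the growth.  The gap [kap] is of the order of the inverse
    of the window, which is at most [`|t|], and only contributes powers of [t]. *)
Lemma swap_ratio_far t : (forall m, (m < M)%N -> kap <= `|t - h m|) ->
  (N * L)%:R <= `|t| ->
  `|U t| <= growth_const ^+ L * `|t| ^+ (6 * L).
Proof.
have [hb _ _ _] := G; move=> hk tM; rewrite swap_ratio_norm.
have lb := lattice_node_blocks.
have h1 := far_block_product L0 N0 hb lb kap_gt0 kap_le1 hk tM.
have h2 := origin_block_product L0 N0 hb lb kap_gt0 kap_le1 (fun m _ => lattice_node_ge m).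
apply: le_trans (ler_pM _ _ h1 h2) _.
- by apply: prodr_ge0 => m _; rewrite divr_ge0.
- by apply: prodr_ge0 => m _; rewrite divr_ge0.
have x1 := ML1; rewrite exprM -!exprMn_comm; try by rewrite /GRing.comm mulrC.
rewrite /kap !invrK; apply: lerXn2r; rewrite ?nnegrE; last exact: growth_ineq.
- apply: mulr_ge0; first by apply: mulr_ge0; apply: mulr_ge0.
  by apply: exprn_ge0; apply: mulr_ge0 => //; apply: mulr_ge0.
- by apply: mulr_ge0; [exact: growth_const_ge0|exact: exprn_ge0].
Qed.

Lemma in_blocks_norm (u : nat -> R) m : in_blocks L N u -> (m < M)%N -> `|u m| <= (N * L)%:R.
Proof.
move=> ub mM; have [u1 u2] := ub m mM.
have b0 : block L N 0 = - (N * L)%:R :> R by rewrite /block sub0r mulNr natrM.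
have b2 : block L N (2 * N) = (N * L)%:R :> R by rewrite /block natrM natrM; ring.
rewrite ler_norml -b0 -b2; apply/andP; split.
  by apply: le_trans u1; exact: block_le.
by apply: le_trans u2 _; apply: block_le; rewrite ltn_divLR.
Qed.

Lemma norm_residue_le (m : 'I_M) :
  `|residue (lift ord0 m)| <= (2 * (N * L)%:R / kap) ^+ M * (1 + (N * L)%:R / delta) ^+ M.
Proof.
have [hb hd h0 _] := G; have x1 := ML1; have x0 : 0 <= (N * L)%:R :> R by [].
have nE : node (lift ord0 m) = h m by [].
have -> : `|residue (lift ord0 m)| = (\prod_(k < M) (`|h m - lam k| / `|lam k|)) *
    \prod_(k < M | k != m) (`|h k| / `|h m - h k|).
  rewrite /residue nE swap_polyE normrM normfV.
  have -> : \prod_(j | j != lift ord0 m) (h m - node j) =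
      h m * \prod_(k < M | k != m) (h m - h k).
    rewrite big_mkcond big_ord_recl/= /node/= subr0; congr (_ * _).
    rewrite -big_mkcond/=; apply: eq_bigl => k.
    by rewrite (inj_eq (@lift_inj _ ord0)).
  rewrite normrM big_mkord !normr_prod.
  have -> : \prod_(k < M) `|h k / lam k * (h m - lam k)| =
     (\prod_(k < M) (`|h m - lam k| / `|lam k|)) * \prod_(k < M) `|h k|.
    by rewrite -big_split/=; apply: eq_bigr => k _; rewrite !normrM normfV; ring.
  rewrite [X in _ * X / _](bigD1 m)//= [X in _ = _ * X]big_split/= [X in _ = _ * (_ * X)]prodfV.
  have hm : `|h m| != 0 by rewrite normr_eq0 h0.
  exact: cancel_middle.
apply: ler_pM.
- by apply: prodr_ge0 => k _; rewrite divr_ge0.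
- by apply: prodr_ge0 => k _; rewrite divr_ge0.
- rewrite -[X in _ ^+ X]card_ord -prodr_const; apply: ler_prod => k _; rewrite divr_ge0//=.
  apply: ratio_le => //; [|exact: kap_gt0|exact: lattice_node_ge].
  apply: le_trans (ler_normB _ _) _.
  have := in_blocks_norm hb (ltn_ord m).
  have := in_blocks_norm lattice_node_blocks (ltn_ord k).
  by rewrite mulr2n mulrDl !mul1r => h1 h2; exact: lerD.
have q1 : 1 <= 1 + (N * L)%:R / delta by rewrite lerDl divr_ge0// ltW.
apply: (@le_trans _ _ (\prod_(k < M | k != m) (1 + (N * L)%:R / delta))).
  apply: ler_prod => k km; rewrite divr_ge0//=.
  apply: (@le_trans _ _ ((N * L)%:R / delta)); last by rewrite lerDr.
  apply: ratio_le => //; first exact: in_blocks_norm.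
  by apply: hd => //; rewrite eq_sym.
rewrite prodr_const; apply: ler_weXn2l => //.
by rewrite -[leqRHS]card_ord; exact: max_card.
Qed.

Definition node_weight (i : 'I_M.+1) : R := pi / sin (pi * (node i - s)).

Lemma node_weight_sin i : sin (pi * (node i - s)) != 0.
Proof.
have [_ _ _ [_ _ /(_ i) H]] := G; have k0 := kap_gt0.
by rewrite -normr_gt0; apply: lt_le_trans H; rewrite mulr_gt0.
Qed.

Lemma fejer_sum_swap K F :
  fejer_sum K (fun t => F (t + s) * (U (t + s) / (t + s))) =
  \sum_i residue i * fejer_sum K (fun t => F (t + s) / (t + s - node i)).
Proof.
rewrite /fejer_sum; under [RHS]eq_bigr do rewrite mulr_sumr.
rewrite exchange_big/=; apply: eq_big_seq => q /mem_fejer_points[k qk].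
have gap i : q.2 + s != node i.
  rewrite -subr_eq0 -normr_gt0; apply: lt_le_trans kap_gt0 _.
  by have [h1 h2] := node_gap i k; case: qk => ->.
rewrite swap_ratioE// !mulr_sumr; apply: eq_bigr => i _; ring.
Qed.

(** Expand into partial fractions and apply the cardinal series at every pole. *)
Lemma interpolation_cvg rho : rho < 1 / 2 ->
  exists2 E : nat -> R, E n @[n --> \oo] --> (0 : R) &
  forall B F, trig rho B F -> forall n,
    `|\sum_i residue i * (node_weight i * F (node i)) +
      fejer_sum (fejer_order n) (fun t => F (t + s) * (U (t + s) / (t + s)))| <= B * E n.
Proof.
move=> r1.
have A i : exists eps : nat -> R, eps n @[n --> \oo] --> (0 : R) /\
    forall B F, trig rho B F -> forall n,
    `|fejer_sum (fejer_order n) (fun t => F t / (node i - s - t)) -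
      F (node i - s) * node_weight i| <= B * eps n.
  by have [e e0 eP] := fejer_sampling (node_weight_sin i) r1; exists e.
have [eps epsP] := choice A.
exists (fun n => \sum_i `|residue i| * eps i n).
  have z : \sum_(i < M.+1) `|residue i| * 0 = 0 :> R by rewrite big1// => i _; rewrite mulr0.
  rewrite -[X in _ --> X]z.
  have ac : continuous (fun x : R * R => x.1 + x.2) by exact: add_continuous.
  refine (@cvg_big _ _ _ _ _ ac _ _ _ (fun i n => `|residue i| * eps i n) _ _ _) => i _.
  by apply: cvgMl_tmp; exact: (epsP i).1.
move=> B F tF n.
have tF' := trig_affine 1 s tF; rewrite normr1 mul1r in tF'.
rewrite fejer_sum_swap -big_split/= mulr_sumr.
apply: le_trans (ler_norm_sum _ _ _) _; apply: ler_sum => i _.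
rewrite -mulrDr normrM mulrCA; apply: ler_wpM2l => //.
have := (epsP i).2 _ _ tF' n; rewrite mul1r subrK -normrN opprB mulrC.
have -> : fejer_sum (fejer_order n) (fun t => F (t + s) / (t + s - node i)) =
   - fejer_sum (fejer_order n) (fun t => F (1 * t + s) / (node i - s - t)).
  rewrite -[RHS]mulN1r -fejer_sumZ; congr fejer_sum; apply/funext => t.
  by rewrite mul1r mulN1r -mulrN -invrN; congr (_ / _); ring.
by [].
Qed.

End interpolation.

(** * Sampling functionals *)
Section damping.
Context {R : realType}.
Implicit Types (a b t u th rho : R).

(** The first factor compensates for the growth of [swap_ratio]; its exponent has
    to be independent of the order of the distribution.  The second factor
    absorbs the polynomials that appear in the derivatives of the symbol. *)
Definition damping a M0 b M1 t : R := sinc (a * t) ^+ M0 * sinc (b * t) ^+ M1.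

Lemma norm_sinc_le1 t : `|sinc t| <= 1.
Proof. exact: trig_bound trig_sinc. Qed.

Lemma damping0 a M0 b M1 : damping a M0 b M1 0 = 1.
Proof. by rewrite /damping !mulr0 sinc0 !expr1n mulr1. Qed.

Lemma norm_damping_le1 a M0 b M1 t : `|damping a M0 b M1 t| <= 1.
Proof. by rewrite normrM !normrX mulr_ile1// exprn_ile1// norm_sinc_le1. Qed.

Lemma norm_damping_le a M0 b M1 t : 0 < a -> t != 0 ->
  `|damping a M0 b M1 t| <= ((pi * a * `|t|)^-1) ^+ M0.
Proof.
move=> a0 t0; rewrite normrM -[leRHS]mulr1; apply: ler_pM => //; last first.
  by rewrite normrX exprn_ile1// norm_sinc_le1.
have at0 : a * t != 0 by rewrite mulf_neq0// gt_eqF.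
rewrite normrX; have := sinc_le at0; rewrite normrM (gtr0_norm a0) mulrA => h.
apply: lerXn2r; rewrite ?nnegrE//; exact: le_trans h.
Qed.

Lemma trig_damping a M0 b M1 j t th rho : 0 < a -> 0 < b -> b <= 2 ->
  (j <= M1)%N -> `|t| <= rho ->
  trig (rho + (a / 2) *+ M0 + (b / 2) *+ M1) ((2 / b) ^+ M1)
    (fun u => (2 * pi * u) ^+ j * cos (2 * pi * u * t + th) * damping a M0 b M1 u).
Proof.
move=> a0 b0 b2 jM tr.
have q1 : 1 <= 2 / b by rewrite ler_pdivlMr// mul1r.
have hs := trig_affine b 0 (@trig_sinc R).
have hm := trig_exp j (trig_scale (2 * pi / b) (trig_affine b 0 (@trig_mul_sinc R))).
have h0 := trig_exp M0 (trig_affine a 0 (@trig_sinc R)).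
have hc := trig_cos t th.
have h1 := trig_mul (trig_mul hc h0) (trig_mul hm (trig_exp (M1 - j) hs)).
apply: trig_ext (trig_weaken _ _ h1).
- move=> u /=; rewrite !addr0 /damping -{2}(subnKC jM) exprD.
  have -> : 2 * pi / b * (b * u * sinc (b * u)) = 2 * pi * u * sinc (b * u).
    by move: (pi : R) => p; field; rewrite gt_eqF.
  rewrite [(_ * sinc (b * u)) ^+ j]exprMn_comm; last by rewrite /GRing.comm mulrC.
  have -> : 2 * pi * t * u = 2 * pi * u * t by ring.
  by ring.
- rewrite (gtr0_norm a0) (gtr0_norm b0) -mulrnDr subnKC// !mul1r.
  by apply: lerD => //; apply: lerD.
- rewrite !expr1n !mulr1 !mul1r.
  have -> : `|2 * pi / b| / pi = 2 / b :> R.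
    rewrite ger0_norm ?divr_ge0 ?mulr_ge0 ?pi_ge0 ?(ltW b0)//.
    have := @pi_neq0 R; move: (pi : R) => p p0; field; by rewrite p0 gt_eqF.
  exact: ler_weXn2l.
Qed.

End damping.

Section sampling_functional.
Context {R : realType}.
Implicit Types (rho delta eta t th : R) (L : nat).

Definition separated_by (delta : R) (H : set R) :=
  forall x y, H x -> H y -> x != y -> delta <= `|x - y|.

Definition rich L (H : set R) := forall x : R, exists s : seq R,
  [/\ uniq s, size s = L & forall y, y \in s -> [/\ H y, x <= y & y < x + L%:R]].

Definition coef_mass (A : seq (R * R)) : R := \sum_(q <- A) `|q.1|.

(** Choose [L] points in every block of the window. *)
Lemma rich_nodes L N delta (H : set R) : (0 < L)%N -> separated_by delta H -> rich L H ->
  exists h : nat -> R, [/\ forall m, H (h m), in_blocks L N h &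
   forall m m', m != m' -> delta <= `|h m - h m'|].
Proof.
move=> L0 Hd /choice[sq sqP].
pose blk p := sq (block L N p).
pose h m := nth 0 (blk (m %/ L)%N) (m %% L).
have hin m : h m \in blk (m %/ L)%N.
  by apply: mem_nth; have [_ -> _] := sqP (block L N (m %/ L)); rewrite ltn_mod.
have hP m : [/\ H (h m), block L N (m %/ L) <= h m & h m < block L N (m %/ L).+1].
  have [_ _ /(_ _ (hin m))[h1 h2 h3]] := sqP (block L N (m %/ L)); split => //.
  by rewrite /block -[_.+1%:R]natr1 addrAC mulrDl mul1r.
exists h; split => [m|m _|m m' mm'].
- by have [] := hP m.
- by have [_ h1 /ltW h2] := hP m.
apply: Hd; [by have [] := hP m|by have [] := hP m'|].
apply: contra mm' => /eqP hh; apply/eqP.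
have bb : (m %/ L = m' %/ L)%N.
  have [_ a1 a2] := hP m; have [_ b1 b2] := hP m'; rewrite hh in a1 a2.
  have lt p q : @block R L N p < block L N q.+1 -> (p <= q)%N.
    by move=> pq; rewrite leqNgt; apply/negP => qp; 
      move: (lt_le_trans pq (block_le L N qp)); rewrite ltxx.
  by apply/eqP; rewrite eqn_leq !lt//; [exact: le_lt_trans b1 a2|exact: le_lt_trans a1 b2].
have [us ss _] := sqP (block L N (m %/ L)).
rewrite (divn_eq m L) (divn_eq m' L) bb; congr (_ + _)%N; apply/eqP.
rewrite -(@nth_uniq _ 0 (blk (m %/ L)%N)) ?ss ?ltn_mod//.
by apply/eqP; move: hh; rewrite /h -bb.
Qed.

(** The mass [C] and the nodes depend neither on the number [J] of derivatives
    nor on the precision [eta].  This order of quantifiers matters: [J] is the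
    order of a distribution depending on the width of a mollification, which has
    to be chosen after the nodes. *)
Lemma sampling_functional L delta rho : (0 < L)%N -> 0 < delta -> 0 <= rho -> rho < 1 / 2 ->
  exists2 C : R, 0 <= C & forall H : set R, separated_by delta H -> rich L H ->
  exists2 nodes : seq R, (forall y, y \in nodes -> H y) &
  forall (J : nat) (eta : R), 0 < eta -> exists A B : seq (R * R),
  [/\ forall q, q \in A -> q.2 \in nodes, coef_mass A <= C, coef_mass B <= 1 / 8 &
   forall j th t, (j <= J)%N -> `|t| <= rho ->
     `|cosum ((1, 0) :: A ++ B) th j t| <= eta].
Proof.
move=> L0 d0 rho0 rho2.
pose gap : R := 1 / 2 - rho; have gap0 : 0 < gap by rewrite subr_gt0.
pose M0 := (6 * L + 2)%N.
pose a : R := gap / (2 * M0%:R).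
have M00 : 0 < M0%:R :> R by rewrite ltr0n /M0 addn2.
have a0 : 0 < a by rewrite divr_gt0// mulr_gt0.
have pa0 : 0 < pi * a by rewrite mulr_gt0// pi_gt0.
(* [Cc] bounds the coefficients at the lattice point [t] by [Cc / t ^+ 2]; it
   does not depend on the number [N] of blocks, which is then chosen to make
   their total mass small. *)
pose Cc : R := (@growth_const R) ^+ L * ((pi * a)^-1) ^+ M0.
have Cc0 : 0 <= Cc.
  apply: mulr_ge0; apply: exprn_ge0; first exact: growth_const_ge0.
  by rewrite invr_ge0 ltW.
pose N := (Num.bound (40 * Cc)).+2.
have N0 : (0 < N)%N by [].
pose M := (2 * N * L)%N.
pose kap : R := (128 * (N * L)%:R)^-1.
pose X : R := (N * L)%:R.
pose W : R := (2 * X / kap) ^+ M * (1 + X / delta) ^+ M.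
have X0 : 0 <= X by [].
have W0 : 0 <= W.
  have k0 : 0 <= kap by rewrite invr_ge0 mulr_ge0.
  by rewrite mulr_ge0// exprn_ge0// ?addr_ge0 ?divr_ge0// ?mulr_ge0 ?divr_ge0// ltW.
pose C : R := 1 + M%:R * (W / kap).
have k0 : 0 < kap by rewrite invr_gt0 mulr_gt0// ltr0n muln_gt0.
have C1 : 1 <= C by rewrite lerDl mulr_ge0// divr_ge0// ltW.
exists C; first by apply: le_trans C1.
move=> H Hd HL.
(* A value at a point of [H] needs no interpolation, and the node 0 would
   collide with the pole at 0. *)
have [H0|H0] := pselect (H 0).
  exists [:: 0]; first by move=> y; rewrite inE => /eqP ->.
  move=> J eta eta0; exists [:: (-1, 0)], [::]; split => [q||| j th t _ _].
  - by rewrite inE => /eqP ->; rewrite inE.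
  - by rewrite /coef_mass big_seq1 normrN1.
  - by rewrite /coef_mass big_nil; lra.
  by rewrite /cosum !big_cons big_nil/= !mulNr !mul1r addrA subrr addr0 normr0 ltW.
have [h [hH hb hd]] := rich_nodes N L0 Hd HL.
have h0 m : h m != 0 by apply: contra_notN H0 => /eqP <-.
have [s [s0 s1 sP]] := good_shift (fun i : 'I_M.+1 => @node R L N h i).
have G : @good_nodes R L N h s delta.
  split => //; first by move=> m m' _ _; exact: hd.
  split => // i; apply: le_trans (sP i).
  have X1 : 1 <= X by rewrite ler1n muln_gt0.
  have X10 : 0 < X by apply: lt_le_trans X1.
  have -> : 4 * kap = (32 * X)^-1.
    by rewrite /kap -/X; move: (X) X10 => x x0; field; rewrite gt_eqF.
  rewrite lef_pV2 ?posrE ?mulr_gt0 ?ltr0n ?muln_gt0 ?N0//.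
  have MX : M%:R = 2 * X by rewrite /M -mulnA natrM.
  by rewrite -[M.+2%:R]natr1 -[M.+1%:R]natr1 MX; move: (X) X1 => x x1; lra.
exists [seq h (val m) | m <- enum 'I_M].
  by move=> y /mapP[m _ ->]; exact: hH.
move=> J eta eta0.
pose b : R := Num.min 2 (gap / (2 * J.+1%:R)).
have J0 : 0 < J.+1%:R :> R by rewrite ltr0n.
have gJ : 0 < gap / (2 * J.+1%:R) by rewrite divr_gt0// mulr_gt0.
have b0 : 0 < b by rewrite lt_min gJ ltr0n.
have b2 : b <= 2 by rewrite ge_min lexx.
have bJ : b * J%:R <= gap / 2.
  apply: (@le_trans _ _ (gap / (2 * J.+1%:R) * J.+1%:R)).
    by apply: ler_pM => //; [exact: ltW|rewrite ge_min lexx orbT|rewrite ler_nat].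
  by rewrite invfM -!mulrA mulVf ?mulr1// gt_eqF.
pose D := damping a M0 b J.
pose rho' : R := rho + a / 2 *+ M0 + b / 2 *+ J.
have r2 : rho' < 1 / 2.
  have e1 : a / 2 *+ M0 = gap / 4.
    by rewrite -mulr_natr /a; field; rewrite gt_eqF.
  have e2 : b / 2 *+ J <= gap / 4.
    by rewrite -mulr_natr; have -> : b / 2 * J%:R = b * J%:R / 2; [ring|lra].
  by rewrite /rho' e1; move: e2 gap0; rewrite /gap; move: (b / 2 *+ J) => z; lra.
have [E E0 EP] := interpolation_cvg L0 N0 d0 G r2.
pose BJ : R := (2 / b) ^+ J.
pose w0 : R := @node_weight R L N h s ord0.
have s4 : `|s| <= 1 / 4 by rewrite ger0_norm// ltW.
have sin0' : sin (pi * (@node R L N h ord0 - s)) != 0.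
  exact: (node_weight_sin L0 N0 G).
have w01 : `|w0^-1| <= 1.
  rewrite /w0 /node_weight invf_div normrM normfV (gtr0_norm (@pi_gt0 R)).
  rewrite ler_pdivrMr ?pi_gt0// mul1r.
  by apply: le_trans (norm_sin_le1 _) _; have := @pi_ge2 R; lra.
have w00 : w0 != 0.
  by rewrite /w0 /node_weight mulf_neq0 ?invr_eq0 ?pi_neq0.
have [n En] : exists n, BJ * E n <= eta.
  have h1 : BJ * E n @[n --> \oo] --> (0 : R).
    by rewrite -[X in _ --> X](mulr0 BJ); apply: cvgMl_tmp.
  have [n _ /(_ n (leqnn n)) h2] := cvgr_le 0 h1 _ eta0.
  by exists n.
pose K := fejer_order n.
pose res (m : 'I_M) : R := @residue R L N h s (lift ord0 m).
pose wt (m : 'I_M) : R := @node_weight R L N h s (lift ord0 m).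
pose U := @swap_ratio R L N h s.
pose A := [seq (res m * wt m * D (h m) / w0, h m) | m <- enum 'I_M].
pose T := [seq (q.1 * (U (q.2 + s) / (q.2 + s) * D (q.2 + s) / w0), q.2 + s) | q <- fejer_points K].
exists A, T.
split.
- by move=> q /mapP[m mM ->]; apply/mapP; exists m.
- rewrite /coef_mass /A big_map big_enum/=.
  apply: (@le_trans _ _ (\sum_(m < M) W / kap)); last first.
    rewrite sumr_const card_ord -mulr_natl.
    by rewrite /C lerDr.
  apply: ler_sum => m _.
  have rW : `|res m| <= W := norm_residue_le L0 N0 d0 G m.
  have wk : `|wt m / w0| <= kap^-1.
    have [_ _ _ [_ _ /(_ (lift ord0 m)) hs]] := G.
    have p0 := @pi_neq0 R.
    have sm := node_weight_sin L0 N0 G (lift ord0 m).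
    have -> : wt m / w0 = sin (pi * (@node R L N h ord0 - s)) /
        sin (pi * (@node R L N h (lift ord0 m) - s)).
      rewrite /wt /w0 /node_weight; move: sm sin0'.
      move: (sin _) => S1; move: (sin _) => S2 S10 S20.
      move: (pi : R) p0 => p p0.
      by field; rewrite S10 S20 p0.
    rewrite normrM normfV -[leRHS]mul1r; apply: ler_pM; rewrite ?invr_ge0 ?norm_sin_le1//.
    have h4 : kap <= `|sin (pi * (@node R L N h (lift ord0 m) - s))|.
      by apply: le_trans hs; rewrite -/kap; lra.
    by rewrite lef_pV2 ?posrE//; exact: lt_le_trans h4.
  have -> : res m * wt m * D (h m) / w0 = res m * (wt m / w0) * D (h m) by ring.
  rewrite normrM -[leRHS]mulr1; apply: ler_pM; rewrite ?norm_damping_le1//.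
  by rewrite normrM; apply: ler_pM.
- pose g t := `|U (t + s) / (t + s) * D (t + s) / w0|.
  rewrite /coef_mass /T big_map/=.
  rewrite (eq_bigr (fun q => `|q.1| * g q.2)); last by move=> q _; rewrite normrM.
  apply: le_trans (@fejer_points_mass R K g (fun t => normr_ge0 _)) _.
  have X2 : (1 < N * L)%N by apply: leq_trans (leq_pmulr N L0).
  have X1 : 1 <= X by rewrite ler1n ltnW.
  have gl m : (m < M)%N -> g (m%:R - X) = 0.
    by move=> mM; rewrite /g /U swap_ratio_eq0// !mul0r normr0.
  have g0 (k : nat) : (k < N * L)%N -> g k%:R = 0.
    move=> kX; have := gl (k + N * L)%N; rewrite natrD addrK; apply.
    by rewrite /M -mulnA mul2n -addnn ltn_add2r.
  have gN0 (k : nat) : (k <= N * L)%N -> g (- k%:R) = 0.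
    move=> kX; have := gl (N * L - k)%N; rewrite natrB// addrAC subrr add0r; apply.
    rewrite /M -mulnA mul2n -addnn; apply: leq_ltn_trans (leq_subr _ _) _.
    by rewrite -[ltnLHS]addn0 ltn_add2l ltnW.
  have gfar (t : R) (k : nat) : (t = k%:R \/ t = - k%:R) -> X <= `|t + s| ->
      g t <= Cc / `|t + s| ^+ 2.
    move=> tk tX; have t0 : 0 < `|t + s| by apply: lt_le_trans tX; exact: lt_le_trans X1.
    have hU : `|U (t + s)| <= growth_const ^+ L * `|t + s| ^+ (6 * L).
      apply: (swap_ratio_far L0 N0 G) => // m mM.
      have [e1 e2] := node_gap G (lift ord0 (Ordinal mM)) k.
      by case: tk => ->.
    have hD : `|D (t + s)| <= ((pi * a * `|t + s|)^-1) ^+ M0.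
      by apply: norm_damping_le => //; rewrite -normr_gt0.
    rewrite /g; have -> : U (t + s) / (t + s) * D (t + s) / w0 =
      U (t + s) * D (t + s) * ((t + s)^-1 * w0^-1) by ring.
    rewrite normrM (normrM (U (t + s)) (D (t + s))) (normrM (t + s)^-1) -[leRHS]mulr1.
    apply: ler_pM; rewrite ?mulr_ge0//; last first.
      rewrite mulr_ile1// normfV invf_le1//; exact: le_trans tX.
    apply: le_trans (ler_pM _ _ hU hD) _ => //.
    have -> : (pi * a * `|t + s|)^-1 ^+ M0 = (pi * a)^-1 ^+ M0 * `|t + s|^-1 ^+ M0.
      by rewrite invfM exprMn_comm// /GRing.comm mulrC.
    have e : `|t + s| ^+ (6 * L) * `|t + s|^-1 ^+ M0 = (`|t + s| ^+ 2)^-1.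
      rewrite /M0 exprD mulrA -exprMn_comm; last by rewrite /GRing.comm mulrC.
      by rewrite divff ?gt_eqF// expr1n mul1r exprVn.
    by rewrite mulrACA e.
  have c50 : 0 <= 5 * Cc by rewrite mulr_ge0.
  pose v (k : nat) : R := g k%:R + g (- k%:R).
  have v0 k : (k < N * L)%N -> v k = 0.
    by move=> kX; rewrite /v g0// gN0 ?addr0// ltnW.
  have vc k : (N * L <= k)%N -> v k <= 5 * Cc / k%:R ^+ 2.
    move=> kX; have kX' : X <= k%:R by rewrite ler_nat.
    have k1 : 1 <= k%:R :> R := le_trans X1 kX'.
    have [q1 q2] := shifted_inv_sq Cc0 s0 s1 k1.
    have [n1 n2] := shifted_norm_ge k%:R s0 s1 X1.
    have h1 : g k%:R <= Cc / k%:R ^+ 2.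
      by apply: le_trans q1; apply: gfar (or_introl erefl) _; exact: n1.
    have h2 : g (- k%:R) <= 4 * Cc / k%:R ^+ 2.
      have [kX2|kX2] := leqP k (N * L).
        by rewrite gN0//; apply: divr_ge0; [apply: mulr_ge0|exact: sqr_ge0].
      apply: le_trans q2; apply: gfar (or_intror erefl) _; apply: n2.
      by rewrite natr1 ler_nat.
    have -> : 5 * Cc / k%:R ^+ 2 = Cc / k%:R ^+ 2 + 4 * Cc / k%:R ^+ 2 by ring.
    exact: lerD.
  rewrite (g0 0%N) ?muln_gt0// add0r.
  apply: le_trans (sum_inv_sq_tail K X2 c50 v0 vc) _.
  have b1 : 40 * Cc < (Num.bound (40 * Cc))%:R by apply: archi_boundP; rewrite mulr_ge0.
  have b3 : (Num.bound (40 * Cc))%:R <= (N * L).-1%:R :> R.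
    rewrite ler_nat -ltnS prednK ?(ltnW X2)//.
    by apply: leq_trans (leq_pmulr N L0); rewrite /N.
  have b4 : 0 < (N * L).-1%:R :> R.
    by rewrite ltr0n -ltnS prednK// ltnW.
  by rewrite ler_pdivrMr//; move: (lt_le_trans b1 b3); lra.
move=> j th t jJ tr.
have tF := trig_damping M0 th a0 b0 b2 jJ tr.
have := EP _ _ tF n; rewrite -/BJ -/K.
set F := (fun u => _) in tF *.
have c0 : F 0 * 1 = (2 * pi * 0) ^+ j * cos (2 * pi * 0 * t + th).
  by rewrite /F damping0 !mulr1.
have -> : cosum ((1, 0) :: A ++ T) th j t = w0^-1 *
   (\sum_i @residue R L N h s i * (@node_weight R L N h s i * F (@node R L N h i)) +
    fejer_sum K (fun t => F (t + s) * (U (t + s) / (t + s)))).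
  rewrite /cosum big_cons big_cat big_ord_recl [in RHS]mulrDr [in RHS]mulrDr addrA; congr (_ + _ + _).
  - rewrite (residue0 L0 N0 G) mul1r -/w0 mulrA mulVf// mul1r /node/= -[F 0]mulr1 c0.
    by rewrite mul1r.
  - rewrite /A big_map big_enum/= mulr_sumr; apply: eq_bigr => m _.
    by rewrite /F /res /wt /node/= /D; ring.
  rewrite /T big_map /fejer_sum mulr_sumr; apply: eq_bigr => q _ /=.
  by rewrite /F /D; ring.
move=> h1; rewrite normrM; apply: le_trans En.
by rewrite -[leRHS]mul1r; apply: ler_pM.
Qed.

End sampling_functional.

(** * Functions that are small on a sparse set *)
Section small_on_sparse.
Context {R : realType}.
Implicit Types (w t r e : R) (H : set R).

(** Arbitrarily long intervals of length [2 * r] contain at most about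
    [w * (2 * r)] points of [H]. *)
Definition sparse w H := forall eta r0 : R, 0 < eta -> exists r, exists x, exists s : seq R,
  [/\ 0 < r, r0 <= r, (size s)%:R <= (w + eta) * (2 * r) &
   forall y, H y -> `|y - x| <= r -> y \in s].

Lemma trig0 rho : trig rho 0 (fun=> 0 : R).
Proof.
exists (fun=> [::]); split => [n q|n|t]; rewrite ?in_nil// /cosmass ?big_nil//.
rewrite (_ : (fun n : nat => _) = cst 0); first exact: cvg_cst.
by apply/funext => n; rewrite /cospoly big_nil.
Qed.

Lemma trig_sum (I : Type) (s : seq I) rho (B : I -> R) (F : I -> R -> R) : 
  (forall i, trig rho (B i) (F i)) ->
  trig rho (\sum_(i <- s) B i) (fun t => \sum_(i <- s) F i t).
Proof.
move=> tF; elim: s => [|i s IH].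
  rewrite big_nil; apply: trig_ext (trig0 rho) => t; by rewrite big_nil.
rewrite big_cons; apply: trig_ext (trig_add (tF i) IH) => t; by rewrite big_cons.
Qed.

Lemma nonzero_kernel (n m : nat) (A : 'M[R]_(n, m)) : (m < n)%N ->
  exists2 c : 'rV[R]_n, c != 0 & c *m A = 0.
Proof.
move=> mn; have : kermx A != 0.
  by rewrite kermx_eq0 /row_free neq_ltn (leq_ltn_trans (rank_leq_col A) mn).
move=> /rowV0Pn[c cA c0]; exists c => //; exact/sub_kermxP.
Qed.

(** Among the multiples of [1 / w] it only sees the origin, and it decays like the
    inverse square, which makes it small far from a window. *)
Definition bump w e t : R := sinc (w * t) * sinc (e * t).

Lemma trig_bump w e : 0 <= w -> 0 <= e -> trig ((w + e) / 2) 1 (bump w e).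
Proof.
move=> w0 e0.
have := trig_mul (trig_affine w 0 (@trig_sinc R)) (trig_affine e 0 (@trig_sinc R)).
rewrite mulr1 (ger0_norm w0) (ger0_norm e0).
have -> : w * (1 / 2) + e * (1 / 2) = (w + e) / 2 by ring.
by apply: trig_ext => t; rewrite !addr0.
Qed.

Lemma bump_le w e t : 0 < w -> 0 < e -> t != 0 -> `|bump w e t| <= (w * e * t ^+ 2)^-1.
Proof.
move=> w0 e0 t0; rewrite normrM -(real_normK (num_real t)).
have T0 : 0 < `|t| by rewrite normr_gt0.
have P (u : R) : 0 < u -> `|sinc (u * t)| <= (u * `|t|)^-1.
  move=> u0; have ut0 : u * t != 0 by rewrite mulf_neq0// gt_eqF.
  apply: le_trans (sinc_le ut0) _; rewrite normrM (gtr0_norm u0).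
  have q0 : 0 < u * `|t| by rewrite mulr_gt0.
  rewrite lef_pV2 ?posrE ?mulr_gt0 ?pi_gt0// ler_peMl ?(ltW q0)//.
  by have := @pi_ge2 R; lra.
have -> : (w * e * `|t| ^+ 2)^-1 = (w * `|t|)^-1 * (e * `|t|)^-1.
  by field; rewrite !gt_eqF.
by apply: ler_pM => //; exact: P.
Qed.

Lemma bump_nat w e (i j : nat) : w != 0 -> i != j ->
  bump w e (i%:R / w - j%:R / w) = 0.
Proof.
move=> w0 ij; rewrite /bump -mulrBl mulrC [w * _]mulrC divfK//.
have -> : sinc (i%:R - j%:R) = 0 :> R; last by rewrite mulr0.
have [lt|lt|/eqP] := ltngtP i j; last by rewrite (negPf ij).
  by rewrite -sincN opprB -natrB ?(ltnW lt)// sinc_nat ?subn_gt0.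
by rewrite -natrB ?(ltnW lt)// sinc_nat ?subn_gt0.
Qed.

(** Take a combination of slightly more translates of [bump] than there are points
    of [H] in the interval, vanishing at all of these.  Its values at the centres
    of the translates are the coefficients, hence it is not small there. *)
Lemma small_on_sparse w e k H : 0 < w -> 0 < e -> 0 < k -> sparse w H ->
  exists f : R -> R, exists B : R, exists t0 : R,
  [/\ trig ((w + e) / 2) B f, forall t, `|f t| <= 1, 1 / 2 <= `|f t0| &
      forall h, H h -> `|f h| <= k].
Proof.
move=> w0 e0 k0 sp.
pose ep := e / 2; have ep0 : 0 < ep by rewrite divr_gt0.
pose w2 := w + ep; have w20 : 0 < w2 by rewrite addr_gt0.
(* The translates have their centres at distance at least [g * r] from the
   complement of the interval. *)
pose g : R := ep / (4 * w2); have g0 : 0 < g by rewrite divr_gt0// mulr_gt0.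
have eta0 : 0 < ep / 2 by rewrite divr_gt0.
have [r [x [s [r0 rb ss sH]]]] := sp (ep / 2) (2 / ep + 2 / (ep * g ^+ 2 * k)) eta0.
have gk0 : 0 < ep * g ^+ 2 * k by apply: mulr_gt0 => //; apply: mulr_gt0 => //; apply: exprn_gt0.
have rb1 : 2 / ep <= r by apply: le_trans rb; rewrite lerDl divr_ge0// ltW.
have rb2 : 2 / (ep * g ^+ 2 * k) <= r by apply: le_trans rb; rewrite lerDr divr_ge0// ltW.
pose n := (size s).+1.
have nr : n%:R / (2 * w2) <= (1 - g) * r.
  rewrite ler_pdivrMr ?mulr_gt0// /n -natr1.
  have -> : (1 - g) * r * (2 * w2) = 2 * w2 * r - ep * r / 2.
    by rewrite /g; field; rewrite gt_eqF.
  have h1 : 2 <= ep * r by move: rb1; rewrite ler_pdivrMr// mulrC.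
  have -> : 2 * w2 * r - ep * r / 2 = (w + ep / 2) * (2 * r) + ep * r / 2.
    by rewrite /w2; field.
  by move: ss h1; move: (_ * (2 * r)) (ep * r) => X Y; lra.
pose tau (i : nat) : R := x - n%:R / (2 * w2) + i%:R / w2.
have tau_near (i : nat) : (i <= n)%N -> `|tau i - x| <= n%:R / (2 * w2).
  move=> iN; have -> : tau i - x = i%:R / w2 - n%:R / (2 * w2) by rewrite /tau; ring.
  have i1 : i%:R / w2 <= n%:R / w2 by rewrite ler_pM2r ?invr_gt0// ler_nat.
  have i2 : 0 <= i%:R / w2 by rewrite divr_ge0// ltW.
  have e1 : n%:R / w2 = n%:R / (2 * w2) + n%:R / (2 * w2) by field; rewrite gt_eqF.
  by rewrite ler_norml; apply/andP; split; lra.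
pose A : 'M[R]_(n, size s) := \matrix_(i, j) bump w2 ep (nth 0 s j - tau i).
have [c c0 cA] := nonzero_kernel A (leqnn _).
pose f t := \sum_(i < n) c 0 i * bump w2 ep (t - tau i).
pose B := \sum_(i < n) `|c 0 i|.
have tf : trig ((w + e) / 2) B f.
  have we : (w + e) / 2 = (w2 + ep) / 2 by rewrite /w2 /ep; field.
  have := @trig_sum _ (index_enum 'I_n) ((w + e) / 2) (fun i => `|c 0 i|)
     (fun i t => c 0 i * bump w2 ep (t - tau i)); apply => i.
  have tb := trig_affine 1 (- tau i) (trig_bump (ltW w20) (ltW ep0)).
  rewrite normr1 mul1r -we in tb; have := trig_scale (c 0 i) tb; rewrite mulr1.
  by apply: trig_ext => t; rewrite mul1r.
have [i0 i0P] : exists i0 : 'I_n, forall i, `|c 0 i| <= `|c 0 i0|.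
  exists [arg max_(i > ord0 | xpredT i) `|c 0 i|]%O.
  by case: arg_maxP => //= i _ iP j; exact: iP.
pose m := `|c 0 i0|.
have m0 : 0 < m.
  rewrite normr_gt0; apply: contra c0 => /eqP ci; apply/eqP/rowP => i.
  by rewrite mxE; apply/eqP; rewrite -normr_le0 -(normr0 R) -ci.
have fi0 : f (tau i0) = c 0 i0.
  have b0 : bump w2 ep 0 = 1 by rewrite /bump !mulr0 sinc0 mulr1.
  rewrite /f (bigD1 i0)//= subrr b0 mulr1 big1 ?addr0// => i ii.
  have -> : tau i0 - tau i = i0%:R / w2 - i%:R / w2 by rewrite /tau; ring.
  have ii' : (i0 : nat) != i by apply: contra ii => /eqP/val_inj ->.
  by rewrite (bump_nat ep _ ii') ?mulr0// gt_eqF.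
have fH h : H h -> `|f h| <= m * k.
  move=> Hh; have [hx|hx] := leP `|h - x| r.
    have hs := sH h Hh hx.
    have js : (index h s < size s)%N by rewrite index_mem.
    have -> : f h = (c *m A) 0 (Ordinal js).
      by rewrite mxE; apply: eq_bigr => i _; rewrite mxE /= nth_index.
    by rewrite cA mxE normr0 mulr_ge0// ltW.
  have far (i : 'I_n) : g * r <= `|h - tau i|.
    have h1 := tau_near i (ltnW (ltn_ord i)).
    have : `|h - x| <= `|h - tau i| + `|tau i - x|.
      by have -> : h - x = (h - tau i) + (tau i - x); [ring|exact: ler_normD].
    have : (1 - g) * r = r - g * r by ring.
    by move: (g * r) => X; lra.
  have gr0 : 0 < g * r by apply: mulr_gt0.
  have wep0 : 0 < w2 * ep by apply: mulr_gt0.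
  have P0 : 0 < w2 * ep * (g * r) ^+ 2 by apply: mulr_gt0 => //; apply: exprn_gt0.
  apply: (@le_trans _ _ (\sum_(i < n) m * (w2 * ep * (g * r) ^+ 2)^-1)).
    apply: le_trans (ler_norm_sum _ _ _) _; apply: ler_sum => i _.
    rewrite normrM; apply: ler_pM => //.
    have ht0 : 0 < `|h - tau i| by apply: lt_le_trans (far i).
    have ht1 : h - tau i != 0 by rewrite -normr_gt0.
    apply: le_trans (bump_le w20 ep0 ht1) _.
    rewrite -(real_normK (num_real (h - tau i))).
    have P1 : 0 < w2 * ep * `|h - tau i| ^+ 2 by apply: mulr_gt0 => //; apply: exprn_gt0.
    rewrite lef_pV2 ?posrE//; apply: ler_wpM2l; first exact: ltW.
    by apply: lerXn2r; rewrite ?nnegrE// ltW.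
  rewrite sumr_const card_ord -mulrnAr; apply: ler_wpM2l; first exact: ltW.
  rewrite -mulr_natl (ler_pdivrMr _ _ P0).
  have n1 : n%:R <= 2 * w2 * r.
    have := nr; rewrite ler_pdivrMr ?mulr_gt0// => h2; apply: le_trans h2 _.
    have -> : (1 - g) * r * (2 * w2) = 2 * w2 * r - 2 * w2 * (g * r) by ring.
    have q0 : 0 <= 2 * w2 * (g * r) by apply: mulr_ge0; [apply: mulr_ge0 => //|]; exact: ltW.
    by rewrite gerBl.
  apply: le_trans n1 _.
  have -> : k * (w2 * ep * (g * r) ^+ 2) = w2 * r * (r * (ep * g ^+ 2 * k)) by ring.
  have -> : 2 * w2 * r = w2 * r * 2 by ring.
  apply: ler_wpM2l; first by rewrite mulr_ge0// ltW.
  by move: rb2; rewrite ler_pdivrMr.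
pose S := sup [set `|f t| | t in [set: R]].
have hs : has_sup [set `|f t| | t in [set: R]].
  split; first by exists `|f 0|; exists 0.
  by exists B => y [t _ <-]; exact: trig_bound tf.
have fS t : `|f t| <= S by apply: sup_upper_bound => //; exists t.
have mS : m <= S by rewrite /m -fi0.
have S0 : 0 < S by apply: lt_le_trans mS.
have [t0 ft0] : exists t0, S / 2 < `|f t0|.
  have S20 : 0 < S / 2 by rewrite divr_gt0.
  have [y [t0 _ <-] h] := sup_adherent S20 hs; exists t0; apply: le_lt_trans h.
  by rewrite -/S; lra.
have nS t : `|S^-1 * f t| = `|f t| / S.
  by rewrite normrM gtr0_norm ?invr_gt0// mulrC.
exists (fun t => S^-1 * f t), (`|S^-1| * B), t0; split.
- exact: trig_scale.
- by move=> t; rewrite nS ler_pdivrMr// mul1r.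
- by rewrite nS ler_pdivlMr//; move: ft0; lra.
move=> h Hh; rewrite nS ler_pdivrMr//; apply: le_trans (fH h Hh) _.
by rewrite mulrC; apply: ler_wpM2l => //; exact: ltW.
Qed.

End small_on_sparse.

Section averaging.
Context {R : realType}.
Implicit Types (w x : R) (H : set R).

(** A point is seen by few scales only: the terms decrease geometrically on both
    sides of the scale of [x]. *)
Lemma sum_min_scales x N : 0 < x ->
  \sum_(j < N) Num.min (x / 2 ^+ j) (2 ^+ j / x) <= (if x <= 1 then 2 * x else 4 - 2 / x).
Proof.
elim: N x => [|N IH] x x0.
  rewrite big_ord0; case: ifPn => [_|]; first by rewrite mulr_ge0// ltW.
  rewrite -ltNge => x1; rewrite subr_ge0 ler_pdivrMr//; lra.
rewrite big_ord_recl expr0 divr1 div1r.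
have -> : \sum_(i < N) Num.min (x / 2 ^+ lift ord0 i) (2 ^+ lift ord0 i / x) =
   \sum_(i < N) Num.min (x / 2 / 2 ^+ i) (2 ^+ i / (x / 2)).
  apply: eq_bigr => i _; rewrite lift0 exprS; congr Num.min.
    by rewrite invfM mulrA.
  by rewrite invfM invrK; ring.
have x20 : 0 < x / 2 by rewrite divr_gt0.
apply: le_trans (lerD (lexx _) (IH _ x20)) _.
have m1 : Num.min x x^-1 <= x by rewrite ge_min lexx.
have m2 : Num.min x x^-1 <= x^-1 by rewrite ge_min lexx orbT.
case: ifPn => h2; case: ifPn => h1.
- lra.
- rewrite -ltNge in h1; apply: le_trans (lerD m2 (lexx _)) _.
  rewrite -(ler_pM2r x0).
  have -> : (x^-1 + 2 * (x / 2)) * x = 1 + x * x by field; rewrite gt_eqF.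
  have -> : (4 - 2 / x) * x = 4 * x - 2 by field; rewrite gt_eqF.
  have : (x - 1) * (x - 3) <= 0 by apply: mulr_ge0_le0; lra.
  by have -> : (x - 1) * (x - 3) = x * x - 4 * x + 3; [ring|lra].
- by rewrite -ltNge in h2; lra.
rewrite -ltNge in h1; apply: le_trans (lerD m2 (lexx _)) _.
have -> : 2 / (x / 2) = 4 * x^-1 by field; rewrite gt_eqF.
have : 0 <= x^-1 by rewrite invr_ge0 ltW.
by lra.
Qed.

Lemma sum_min_scales_le x N : 0 <= x ->
  \sum_(j < N) Num.min (x / 2 ^+ j) (2 ^+ j / x) <= 4.
Proof.
rewrite le_eqVlt => /orP[/eqP <-|x0].
  rewrite big1// => j _; rewrite mul0r min_l// invr0 mulr0//.
apply: le_trans (sum_min_scales N x0) _; case: ifP => [|_]; first lra.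
by rewrite gerBl divr_ge0// ltW.
Qed.

(** The dilation factors [sj] and the frequencies [ej] of the damping satisfy
    [sj * wp + ej = w], so that every term has the critical spectrum.  At a point
    [h] of [H], the term of index [j] is small if [ej j * `|h - t0|] is small,
    since then the dilation barely moves [h], and also if it is large, by the
    decay of [sinc]. *)
Lemma small_on_critical w k H : 0 < w -> 0 < k -> sparse w H ->
  exists G : R -> R, exists B : R, exists t0 : R,
  [/\ trig (w / 2) B G, forall t, `|G t| <= 1, 1 / 2 <= `|G t0| &
      forall h, H h -> `|G h| <= k].
Proof.
move=> w0 k0 sp.
pose K : R := 1 + 40 * (w + 2) * 2 / w.
have K1 : 1 <= K by rewrite lerDl divr_ge0 ?(ltW w0)// !mulr_ge0//; lra.
pose N := (Num.bound (8 * K / k)).+1.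
have Np : 0 < N%:R :> R by rewrite ltr0n.
have NK : 4 * K / N%:R <= k / 2.
  have q0 : 0 <= 8 * K / k by rewrite divr_ge0 ?(ltW k0)// mulr_ge0//; lra.
  have h1 := archi_boundP q0.
  have h2 : (Num.bound (8 * K / k))%:R <= N%:R :> R by rewrite ler_nat.
  have h3 : 8 * K / k <= N%:R by lra.
  rewrite ler_pdivrMr//; move: h3; rewrite ler_pdivrMr//.
  by move: (N%:R : R) => z; have -> : k / 2 * z = z * k / 2; [ring|lra].
pose ej (j : nat) : R := w / 2 ^+ j.
have p2 (j : nat) : 0 < (2 : R) ^+ j by rewrite exprn_gt0.
have ej0 j : 0 < ej j by rewrite divr_gt0.
have ejw j : ej j <= w by rewrite ler_pdivrMr// ler_peMr ?(ltW w0)// exprn_ege1// ler1n.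
pose e := Num.min 1 (ej N).
have e0 : 0 < e by rewrite lt_min ltr01 ej0.
have e1 : e <= 1 by rewrite ge_min lexx.
have eN (j : nat) : (j <= N)%N -> e <= ej j.
  move=> jN; apply: (@le_trans _ _ (ej N)); first by rewrite ge_min lexx orbT.
  rewrite ler_pM2l// lef_pV2 ?posrE//; apply: ler_weXn2l => //; by rewrite ler1n.
have k20 : 0 < k / 2 by rewrite divr_gt0.
have [f [B [t0 [tf f1 ft0 fH]]]] := small_on_sparse w0 e0 k20 sp.
pose wp := w + e; have wp0 : 0 < wp by rewrite addr_gt0.
pose sj (j : nat) : R := (w - ej j) / wp.
have sj0 j : 0 <= sj j by rewrite divr_ge0 ?(ltW wp0)// subr_ge0.
have sj1 (j : nat) : (j <= N)%N -> `|sj j - 1| <= 2 / w * ej j.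
  move=> jN; have -> : sj j - 1 = - ((e + ej j) / wp).
    by rewrite /sj /wp; field; rewrite gt_eqF.
  have q0 : 0 <= e + ej j by rewrite addr_ge0// ltW.
  rewrite normrN ger0_norm ?divr_ge0 ?(ltW wp0)//.
  rewrite mulrAC; apply: ler_pM => //; first by rewrite invr_ge0 ltW.
    by have := eN j jN; lra.
  by rewrite lef_pV2 ?posrE// lerDl ltW.
pose F (j : nat) t := f (sj j * t + (1 - sj j) * t0) * sinc (ej j * t + - ej j * t0).
have Ft0 j : F j t0 = f t0.
  rewrite /F; have -> : sj j * t0 + (1 - sj j) * t0 = t0 by ring.
  by have -> : ej j * t0 + - ej j * t0 = 0; [ring|rewrite sinc0 mulr1].
have tF j : trig (w / 2) B (F j).
  have := trig_mul (trig_affine (sj j) ((1 - sj j) * t0) tf)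
    (trig_affine (ej j) (- ej j * t0) (@trig_sinc R)).
  rewrite mulr1 (ger0_norm (sj0 j)) (gtr0_norm (ej0 j)) -/wp.
  by have -> : sj j * (wp / 2) + ej j * (1 / 2) = w / 2
    by rewrite /sj; field; rewrite gt_eqF.
have F1 j t : `|F j t| <= 1 by rewrite normrM mulr_ile1// norm_sinc_le1.
pose G t := N%:R^-1 * \sum_(j < N) F j t.
have nN : `|N%:R^-1 : R| = N%:R^-1 by rewrite gtr0_norm ?invr_gt0.
exists G, (`|N%:R^-1| * \sum_(j <- index_enum 'I_N) B), t0; split.
- apply: trig_scale; apply: (@trig_sum _ _ _ _ (fun _ => B) (fun j : 'I_N => F j)) => j.
  exact: tF.
- move=> t; rewrite normrM nN ler_pdivrMl// mulr1.
  apply: le_trans (ler_norm_sum _ _ _) _.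
  apply: (@le_trans _ _ (\sum_(j < N) 1)); first by apply: ler_sum.
  by rewrite sumr_const card_ord.
- rewrite /G (eq_bigr (fun=> f t0)) => [|j _]; last exact: Ft0.
  by rewrite sumr_const card_ord -[f t0 *+ N]mulr_natl mulKf// gt_eqF.
move=> h Hh; rewrite normrM nN ler_pdivrMl//.
apply: le_trans (ler_norm_sum _ _ _) _.
pose x := w * `|h - t0|; have x0 : 0 <= x by rewrite mulr_ge0// ltW.
have lip t t' : `|f t - f t'| <= 40 * (w + 2) * `|t - t'|.
  have wp2 : 0 <= wp / 2 by rewrite divr_ge0// ltW.
  have h1 := trig_lipschitz t t' wp2 tf f1; rewrite mulr1 in h1.
  apply: le_trans h1 _; apply: ler_wpM2r => //.
  have -> : 2 * (wp / 2) + 1 = wp + 1 by field.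
  by rewrite ler_pM2l//; rewrite /wp; lra.
have FB (j : 'I_N) : `|F j h| <= k / 2 + K * Num.min (x / 2 ^+ j) (2 ^+ j / x).
  have k2 : 0 <= k / 2 by exact: ltW.
  have eE : ej j * h + - ej j * t0 = ej j * (h - t0) by ring.
  have xE : x / 2 ^+ j = ej j * `|h - t0| by rewrite /x /ej; ring.
  rewrite /Num.min; case: ifP => _.
    rewrite normrM; apply: (@le_trans _ _ (`|f (sj j * h + (1 - sj j) * t0)| * 1)).
      by apply: ler_wpM2l => //; exact: norm_sinc_le1.
    rewrite mulr1; have := lip (sj j * h + (1 - sj j) * t0) h.
    have -> : sj j * h + (1 - sj j) * t0 - h = (sj j - 1) * (h - t0) by ring.
    rewrite normrM => h1.
    have h2 := ler_wpM2r (normr_ge0 (h - t0)) (sj1 j (ltnW (ltn_ord j))).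
    have c0 : 0 <= 40 * (w + 2) by rewrite mulr_ge0// addr_ge0// ltW.
    have h3 := le_trans h1 (ler_wpM2l c0 h2).
    rewrite -[f _](subrK (f h)); apply: le_trans (ler_normD _ _) _.
    rewrite addrC; apply: lerD; first exact: fH.
    apply: le_trans h3 _; rewrite xE.
    have -> : 40 * (w + 2) * (2 / w * ej j * `|h - t0|) =
       (40 * (w + 2) * 2 / w) * (ej j * `|h - t0|) by ring.
    by apply: ler_wpM2r; [rewrite mulr_ge0// ltW|rewrite lerDr].
  have q0 : 0 <= 2 ^+ j / x by rewrite divr_ge0.
  have [ht|ht] := eqVneq h t0.
    have -> : F j h = f h by rewrite ht Ft0.
    apply: le_trans (fH h Hh) _; rewrite lerDl; apply: mulr_ge0 => //.
    by apply: le_trans K1.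
  have ht0 : h - t0 != 0 by rewrite subr_eq0.
  have T0 : 0 < ej j * `|h - t0| by rewrite mulr_gt0// normr_gt0.
  have et0 : ej j * (h - t0) != 0 by rewrite mulf_neq0// gt_eqF.
  apply: (@le_trans _ _ (2 ^+ j / x)); last first.
    have := ler_wpM2r q0 K1; rewrite mul1r => h1; apply: le_trans h1 _.
    by rewrite lerDr.
  have -> : 2 ^+ j / x = (ej j * `|h - t0|)^-1 by rewrite -xE invf_div.
  rewrite /F eE normrM -[leRHS]mul1r; apply: ler_pM => //.
  apply: le_trans (sinc_le et0) _; rewrite normrM (gtr0_norm (ej0 j)).
  rewrite lef_pV2 ?posrE ?mulr_gt0 ?pi_gt0 ?normr_gt0// ler_peMl ?(ltW T0)//.
  by have := @pi_ge2 R; lra.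
apply: (@le_trans _ _ (\sum_(j < N) (k / 2 + K * Num.min (x / 2 ^+ j) (2 ^+ j / x)))).
  by apply: ler_sum => j _; exact: FB.
rewrite big_split/= sumr_const card_ord -mulr_sumr -[_ *+ N]mulr_natl.
have K0 : 0 <= K by apply: le_trans K1.
have h1 := ler_wpM2l K0 (sum_min_scales_le N x0).
have h2 : K * 4 <= N%:R * (k / 2).
  by move: NK; rewrite ler_pdivrMr// mulrC [k / 2 * _]mulrC.
apply: le_trans (lerD (lexx _) (le_trans h1 h2)) _.
by rewrite -mulrDr -splitr.
Qed.

End averaging.

(** * Lower uniform density *)
Section density.
Context {R : realType}.
Implicit Types (H : set R) (x y l r e delta D : R) (n k : nat).

Definition rich_at l n H := forall x, exists s : seq R,
  [/\ uniq s, size s = n & forall y, y \in s -> [/\ H y, x <= y & y < x + l]].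

(** Rounding the points to multiples of [delta] is injective. *)
Lemma separated_size delta H x l (s : seq R) : 0 < delta -> 0 <= l -> separated_by delta H ->
  uniq s -> (forall y, y \in s -> [/\ H y, x <= y & y < x + l]) ->
  (size s)%:R <= l / delta + 1.
Proof.
move=> d0 l0 Hd us sP.
pose q y := Num.truncn ((y - x) / delta).
have qP y : y \in s -> (q y)%:R <= (y - x) / delta /\ (y - x) / delta < (q y).+1%:R.
  move=> /sP[_ xy _].
  have h : 0 <= (y - x) / delta by rewrite divr_ge0 ?subr_ge0// ltW.
  by have /andP[] := truncn_itv h.
have qinj : {in s &, injective q}.
  move=> y z ys zs qyz; have [h1 h2] := qP y ys; have [h3 h4] := qP z zs.
  apply/eqP; apply: contraT => yz.
  have [Hy _ _] := sP y ys; have [Hz _ _] := sP z zs.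
  have := Hd y z Hy Hz yz; rewrite leNgt => /negP; case.
  have di : 0 < delta^-1 by rewrite invr_gt0.
  rewrite -(ltr_pM2r di) divff ?gt_eqF// -(gtr0_norm di) -normrM.
  have -> : (y - z) / delta = (y - x) / delta - (z - x) / delta by ring.
  rewrite qyz in h1 h2; rewrite -natr1 in h2; rewrite -natr1 in h4.
  by rewrite ltr_norml; apply/andP; split; lra.
have le : (size s <= (Num.truncn (l / delta)).+1)%N.
  rewrite -(size_map q) -(size_iota 0 (Num.truncn (l / delta)).+1).
  apply: uniq_leq_size; first by rewrite map_inj_in_uniq.
  move=> m /mapP[y ys ->]; rewrite mem_iota/= add0n ltnS.
  apply: le_truncn; rewrite ler_pM2r ?invr_gt0//.
  by have [_ _ yl] := sP y ys; lra.
apply: (@le_trans _ _ (Num.truncn (l / delta)).+1%:R); first by rewrite ler_nat.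
by rewrite -natr1 lerD2r truncn_le divr_ge0// ltW.
Qed.

(** A maximal duplicate-free list. *)
Lemma enumerate (P : R -> Prop) n :
  (forall s : seq R, uniq s -> (forall y, y \in s -> P y) -> size s != n) ->
  exists s : seq R, (size s < n)%N /\ forall y, P y -> y \in s.
Proof.
move=> H; apply: contrapT => K.
have : forall m, (m <= n)%N -> exists s : seq R,
    [/\ uniq s, size s = m & forall y, y \in s -> P y].
  elim=> [|m IH] mn; first by exists [::].
  have [s [us ss sP]] := IH (ltnW mn).
  have [y Py ys] : exists2 y, P y & y \notin s.
    apply: contrapT => K'; apply: K; exists s; split; first by rewrite ss.
    by move=> y Py; apply: contrapT => /negP ys; apply: K'; exists y.
  exists (y :: s); split => /=; rewrite ?ys ?ss// => z.
  by rewrite inE => /orP[/eqP ->|/sP].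
move=> /(_ n (leqnn n))[s [us ss sP]].
by have := H s us sP; rewrite ss eqxx.
Qed.

Lemma counting_ge (A : set R) (s : seq R) : uniq s -> (forall y, y \in s -> A y) ->
  ((size s)%:R%:E <= @counting _ R A)%E.
Proof.
move=> us sA; rewrite /counting; case: asboolP => [fA|_]; last by rewrite leey.
rewrite lee_fin ler_nat; apply: uniq_leq_size us _ => y ys.
have -> : (y \in finmap.enum_fset (fset_set A)) = (y \in A) := in_fset_set fA y.
by rewrite inE; exact: sA.
Qed.

Lemma counting_le (A : set R) (s : seq R) : (forall y, A y -> y \in s) ->
  (@counting _ R A <= (size s)%:R%:E)%E.
Proof.
move=> sA; have fA : finite_set A by apply: (sub_finite_set _ (finite_seq s)).
rewrite /counting asboolT// lee_fin ler_nat.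
apply: uniq_leq_size (finmap.fset_uniq _) _ => y yA.
move: yA; have -> : (y \in finmap.enum_fset (fset_set A)) = (y \in A) := in_fset_set fA y.
by rewrite inE; exact: sA.
Qed.

Definition ball_ratio H r : \bar R := (ereal_inf (range (fun x : R =>
  counting (H `&` closed_ball x r) / lebesgue_measure (closed_ball x r))))%E.

(** Concatenate consecutive half-open intervals. *)
Lemma rich_at_mul l n H k : 0 <= l -> rich_at l n H -> rich_at (k%:R * l) (k * n)%N H.
Proof.
move=> l0 Hl; elim: k => [|k IH] x; first by exists [::]; split; rewrite ?mul0n.
have [s [us ss sP]] := IH x; have [u [uu su uP]] := Hl (x + k%:R * l).
have kl : k.+1%:R * l = k%:R * l + l by rewrite -natr1 mulrDl mul1r.
have kl0 : 0 <= k%:R * l by rewrite mulr_ge0.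
exists (s ++ u); split.
- rewrite cat_uniq us uu andbT/=; apply/hasPn => y /uP[_ h1 _].
  by apply/negP => /sP[_ _ h2]; move: (le_lt_trans h1 h2); rewrite ltxx.
- by rewrite size_cat ss su mulSnr.
move=> y; rewrite mem_cat kl => /orP[/sP[hy h1 h2]|/uP[hy h1 h2]]; split => //; lra.
Qed.

Lemma ball_ratio_ge H r l n k : 0 < r -> 0 <= l -> rich_at l n H -> k%:R * l <= 2 * r ->
  ((k%:R * n%:R / (2 * r))%:E <= ball_ratio H r)%E.
Proof.
move=> r0 l0 Hl kr; apply: le_ereal_inf_tmp => _ [x _ <-].
rewrite lebesgue_measure_closed_ball ?(ltW r0)//.
have r20 : r *+ 2 != 0 by rewrite mulrn_eq0/= gt_eqF.
rewrite inver (negPf r20) -[r *+ 2]mulr_natl EFinM; apply: lee_wpmul2r.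
  by rewrite lee_fin invr_ge0 mulr_ge0// ltW.
have [s [us ss sP]] := rich_at_mul k l0 Hl (x - r).
rewrite -natrM -ss; apply: counting_ge => // y /sP[hy h1 h2]; split => //.
by rewrite closed_ball_itv//= in_itv/= h1/=; lra.
Qed.

Lemma not_rich_at H l n : ~ rich_at l n H -> exists x, exists s : seq R,
  (size s < n)%N /\ forall y, H y -> x <= y -> y < x + l -> y \in s.
Proof.
move=> /existsNP[x Hx].
have [|s [sn sP]] := @enumerate (fun y => [/\ H y, x <= y & y < x + l]) n.
  by move=> s us sP; apply/negP => /eqP ss; apply: Hx; exists s.
by exists x, s; split => // y h1 h2 h3; apply: sP.
Qed.

Lemma not_rich_closed H l n : ~ rich_at l n H -> exists x, exists s : seq R,
  (size s <= n)%N /\ forall y, H y -> x <= y -> y <= x + l -> y \in s.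
Proof.
move=> /not_rich_at[x [s [sn sP]]]; exists x, (x + l :: s); split => // y Hy xy.
by rewrite le_eqVlt inE => /orP[/eqP ->|yl]; rewrite ?eqxx// sP ?orbT.
Qed.

Lemma ball_ratio_le H r n : 0 < r -> ~ rich_at (2 * r) n H ->
  (ball_ratio H r <= (n%:R / (2 * r))%:E)%E.
Proof.
move=> r0 /not_rich_closed[x [s [sn sP]]].
have h : (ball_ratio H r <= counting (H `&` closed_ball (x + r)%R r) /
   lebesgue_measure (closed_ball (x + r)%R r))%E.
  by apply: ereal_inf_lbound; exists (x + r).
apply: le_trans h _.
rewrite lebesgue_measure_closed_ball ?(ltW r0)//.
have r20 : r *+ 2 != 0 by rewrite mulrn_eq0/= gt_eqF.
rewrite inver (negPf r20) -[r *+ 2]mulr_natl EFinM; apply: lee_wpmul2r.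
  by rewrite lee_fin invr_ge0 mulr_ge0// ltW.
apply: (@le_trans _ _ (size s)%:R%:E); last by rewrite lee_fin ler_nat.
apply: counting_le => y [Hy]; rewrite closed_ball_itv//= in_itv/= => /andP[h1 h2].
by apply: sP => //; lra.
Qed.

(** The density is the supremum of the ratios [n / l] for which every half-open
    interval of length [l >= 1] contains [n] points.  The lower bound follows by
    cutting a long interval into pieces of length [l], the upper bound from the
    failure of the next integer. *)
Lemma density_dichotomy delta H : 0 < delta -> separated_by delta H ->
  exists D : R, [/\ 0 <= D, lower_density H = D%:E,
    forall w, 0 <= w -> w < D -> exists n, exists l,
      [/\ (0 < n)%N, 0 < l, w < n%:R / l & rich_at l n H] &
    forall w, D <= w -> sparse w H].
Proof.
move=> d0 Hd.
pose A : set R := [set a | exists n, exists l, [/\ 1 <= l, rich_at l n H & a = n%:R / l]].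
have A0 : A 0.
  exists 0%N, 1; split => //; last by rewrite mul0r.
  by move=> x; exists [::].
have hA : has_sup A.
  split; first by exists 0.
  exists (delta^-1 + 1) => _ [n [l [l1 Hl ->]]].
  have l0 : 0 < l by lra.
  have [s [us ss sP]] := Hl 0; have := separated_size d0 (ltW l0) Hd us sP.
  rewrite ss => h; rewrite ler_pdivrMr// mulrDl mul1r mulrC; lra.
pose D := sup A.
have AD a : A a -> a <= D by move=> Aa; exact: sup_upper_bound.
have D0 : 0 <= D by exact: AD.
have Dub r : 1 / 2 <= r -> exists n, ~ rich_at (2 * r) n H /\ n%:R <= D * (2 * r) + 1.
  move=> r1; have r0 : 0 < 2 * r by lra.
  have q0 : 0 <= D * (2 * r) by rewrite mulr_ge0// ltW.
  have /andP[h1 h2] := truncn_itv q0.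
  exists (Num.truncn (D * (2 * r))).+1; split; last by rewrite -natr1; lra.
  move=> Hr; have : (Num.truncn (D * (2 * r))).+1%:R / (2 * r) <= D.
    by apply: AD; exists (Num.truncn (D * (2 * r))).+1, (2 * r); split => //; lra.
  by rewrite ler_pdivrMr// leNgt h2.
have gub r : 1 / 2 <= r -> (ball_ratio H r <= (D + 1 / (2 * r))%:E)%E.
  move=> r1; have r0 : 0 < r by lra.
  have [n [nr nD]] := Dub r r1; apply: le_trans (ball_ratio_le r0 nr) _.
  rewrite lee_fin ler_pdivrMr ?mulr_gt0// mulrDl divfK// gt_eqF// mulr_gt0//.
have g0 r : 0 < r -> (0%:E <= ball_ratio H r)%E.
  move=> r0; have := @ball_ratio_ge H r 1 0 0%N r0 ler01.
  rewrite !mul0r; apply; first by move=> x; exists [::].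
  by rewrite mulr_ge0// ltW.
have glb e : 0 < e -> exists r0, forall r, r0 <= r -> ((D - e)%:E <= ball_ratio H r)%E.
  move=> e0; have e20 : 0 < e / 2 by rewrite divr_gt0.
  have [_ [n [l [l1 Hl ->]]] nl] := sup_adherent e20 hA.
  have l0 : 0 < l by lra.
  exists (1 + n%:R / e) => r rb; have q0 : 0 <= n%:R / e by rewrite divr_ge0// ltW.
  have r0 : 0 < r by lra.
  have p0 : 0 <= 2 * r / l by rewrite divr_ge0 ?(ltW l0)// mulr_ge0// ltW.
  have /andP[h1 h2] := truncn_itv p0; set k := Num.truncn _ in h1 h2.
  have kl : k%:R * l <= 2 * r by rewrite -ler_pdivlMr.
  apply: le_trans (ball_ratio_ge r0 (ltW l0) Hl kl); rewrite lee_fin.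
  rewrite ler_pdivlMr ?mulr_gt0//.
  have h3 : (2 * r / l - 1) * n%:R <= k%:R * n%:R.
    by apply: ler_wpM2r => //; rewrite -natr1 in h2; lra.
  have h4 : (D - e / 2) * (2 * r) <= n%:R / l * (2 * r).
    by apply: ler_wpM2r; [rewrite mulr_ge0// ltW|rewrite ltW].
  have h5 : n%:R <= e * r.
    have : n%:R / e <= r by lra.
    by rewrite ler_pdivrMr// mulrC.
  have e1 : (2 * r / l - 1) * n%:R = n%:R / l * (2 * r) - n%:R by ring.
  have e2 : (D - e) * (2 * r) = (D - e / 2) * (2 * r) - e * r by field.
  by rewrite e2; lra.
have fin r : 1 / 2 <= r -> ball_ratio H r \is a fin_num.
  move=> r1; have r0 : 0 < r by lra.
  by have := g0 r r0; have := gub r r1; case: (ball_ratio H r).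
have cv : ball_ratio H @ +oo --> D%:E.
  apply/fine_cvgP; split.
    near=> r; apply: fin; near: r; apply: nbhs_pinfty_ge; rewrite num_real//.
  apply/cvgrPdist_le => e e0; have [r0 r0P] := glb e e0.
  near=> r.
  have r1 : 1 / 2 <= r by near: r; apply: nbhs_pinfty_ge; rewrite num_real//.
  have r2 : r0 <= r by near: r; apply: nbhs_pinfty_ge; rewrite num_real//.
  have r3 : 1 / e <= r by near: r; apply: nbhs_pinfty_ge; rewrite num_real//.
  have := r0P r r2; have := gub r r1; rewrite -(fineK (fin r r1)) !lee_fin /= => h1 h2.
  have h3 : 1 / (2 * r) <= e.
    rewrite ler_pdivrMr; last by lra.
    move: r3; rewrite ler_pdivrMr// => h3.
    by have -> : e * (2 * r) = 2 * (r * e); [ring|lra].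
  by rewrite ler_distl; apply/andP; split; lra.
exists D; split => //.
- rewrite /lower_density; apply/cvg_lim => //.
- move=> w w0 wD; have e0 : 0 < D - w by rewrite subr_gt0.
  have [_ [n [l [l1 Hl ->]]] nl] := sup_adherent e0 hA.
  have wn : w < n%:R / l by rewrite -/D in nl; lra.
  exists n, l; split => //; last by lra.
  by case: n wn {Hl nl} => //; rewrite mul0r => h; lra.
move=> w Dw eta r0 eta0.
pose r := Num.max (Num.max r0 (1 / 2)) (1 / eta).
have r1 : 1 / 2 <= r by rewrite !le_max lexx orbT.
have r2 : r0 <= r by rewrite !le_max lexx.
have r3 : 1 / eta <= r by rewrite !le_max lexx orbT.
have rp : 0 < r by lra.
have [n [nr nD]] := Dub r r1; have [x [s [sn sP]]] := not_rich_closed nr.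
exists r, (x + r), s; split => //.
  apply: (@le_trans _ _ (n%:R)); first by rewrite ler_nat.
  apply: le_trans nD _; move: r3; rewrite ler_pdivrMr// => r3.
  have h1 : D * (2 * r) <= w * (2 * r) by apply: ler_wpM2r => //; rewrite mulr_ge0// ltW.
  have -> : (w + eta) * (2 * r) = w * (2 * r) + 2 * (r * eta) by ring.
  have : 0 <= r * eta by rewrite mulr_ge0// ltW.
  lra.
by move=> y Hy; rewrite ler_norml => /andP[h1 h2]; apply: sP => //; lra.
Unshelve. all: by end_near. Qed.

End density.

(** * Convex sets in the plane *)
Section geometry.
Context {R : realType}.
Notation mu := (@lebesgue_measure R).
Implicit Types (x y v d p : R * R) (t c w W D : R) (Omega K : set (R * R)).

Lemma plane_eq x y : x.1 = y.1 -> x.2 = y.2 -> x = y.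
Proof. by case: x y => [a b] [c d] /= -> ->. Qed.

Lemma dotDl x y d : dot (x + y) d = dot x d + dot y d.
Proof. by rewrite /dot/=; ring. Qed.

Lemma dotBl x y d : dot (x - y) d = dot x d - dot y d.
Proof. by rewrite /dot/=; ring. Qed.

Lemma dotZl t y d : dot (t *: y) d = t * dot y d.
Proof. by rewrite /dot/= /GRing.scale/=; ring. Qed.

Lemma dotC x y : dot x y = dot y x.
Proof. by rewrite /dot; ring. Qed.

Lemma dot_ge0 x : 0 <= dot x x.
Proof. by rewrite /dot -!expr2 addr_ge0 ?sqr_ge0. Qed.

Lemma dot_eq0 x : dot x x = 0 -> x = 0.
Proof.
case: x => a b; rewrite /dot/= -!expr2 => /eqP.
by rewrite paddr_eq0 ?sqr_ge0// !sqrf_eq0 => /andP[/eqP -> /eqP ->].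
Qed.

Lemma continuous_dotl d : continuous (fun x : R * R => dot x d).
Proof.
move=> x; apply: cvgD; apply: cvgMl_tmp || apply: cvgMr_tmp.
  exact: cvg_fst.
exact: cvg_snd.
Qed.

Definition convex2 Omega := forall x y t, Omega x -> Omega y -> 0 <= t -> t <= 1 ->
  Omega (t *: x + (1 - t) *: y).

Lemma convex_setP Omega : convex_set Omega -> convex2 Omega.
Proof.
move=> cO x y t Ox Oy t0 t1.
have := cO x y (Itv01 t0 t1); rewrite !inE => /(_ Ox Oy).
by rewrite /conv/=.
Qed.

(** Otherwise moving from [p] towards [k] would decrease the distance to [q]. *)
Lemma nearest_ineq K q p : convex2 K -> K p ->
  (forall k, K k -> dot (q - p) (q - p) <= dot (q - k) (q - k)) ->
  forall k, K k -> dot (k - p) (q - p) <= 0.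
Proof.
move=> cK Kp pmin k Kk; rewrite leNgt; apply/negP => h.
set a := dot (k - p) (q - p) in h.
set b := dot (k - p) (k - p).
have b0 : 0 <= b by exact: dot_ge0.
pose t := Num.min 1 (a / (b + 1)).
have t0 : 0 < t by rewrite lt_min ltr01 divr_gt0//; lra.
have t1 : t <= 1 by rewrite ge_min lexx.
have tb : t * (b + 1) <= a by rewrite -ler_pdivlMr; [rewrite ge_min lexx orbT|lra].
have := pmin _ (cK k p t Kk Kp (ltW t0) t1).
have -> : dot (q - (t *: k + (1 - t) *: p)) (q - (t *: k + (1 - t) *: p)) =
   dot (q - p) (q - p) - 2 * t * a + t * t * b.
  rewrite /a /b /dot/=.
  by rewrite /GRing.scale/=; ring.
have h1 : t * (t * (b + 1)) <= t * a by rewrite ler_pM2l.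
have h2 : 0 < t * a by rewrite mulr_gt0.
have h3 : 0 < t * t by rewrite mulr_gt0.
have -> : t * t * b = t * (t * (b + 1)) - t * t by ring.
have -> : 2 * t * a = 2 * (t * a) by ring.
lra.
Qed.

Lemma compact_max Omega (f : R * R -> R) : compact Omega -> Omega !=set0 -> continuous f ->
  exists2 c, Omega c & forall x, Omega x -> f x <= f c.
Proof.
move=> cO O0 cf; have [c cc cP] := compact_EVT_max O0 cO (continuous_subspaceT cf).
by exists c; [rewrite inE in cc|move=> x Ox; apply: cP; rewrite inE].
Qed.

(** The direction is that from the point of [Omega - Omega] nearest to [D *: v] to
    the point [D *: v] itself; it is not orthogonal to [v] because the difference
    set contains 0. *)
Lemma strip_of_not_difference Omega v D : compact Omega -> convex_set Omega ->
  Omega !=set0 -> 0 <= D -> ~ difference_set Omega (D *: v) ->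
  exists d, exists c, exists W, [/\ dot v d = 1, 0 <= W, W < D &
    forall xi, Omega xi -> `|dot xi d - c| <= W / 2].
Proof.
move=> cO /convex_setP vO O0 D0 nD.
have [z0 Oz0] := O0; set K := difference_set Omega in nD *; set q := D *: v.
have cK : convex2 K.
  move=> _ _ t [a Oa [b Ob <-]] [a' Oa' [b' Ob' <-]] t0 t1.
  exists (t *: a + (1 - t) *: a'); first exact: vO.
  exists (t *: b + (1 - t) *: b'); first exact: vO.
  by rewrite !scalerBr opprD addrACA.
have compK : compact K.
  have -> : K = (fun z : (R * R) * (R * R) => z.1 - z.2) @` (Omega `*` Omega).
    apply/seteqP; split => [_ [a Oa [b Ob <-]]|_ [[a b] [Oa Ob] <-]].
      by exists (a, b).
    by exists a => //; exists b.
  apply: continuous_compact; last exact: compact_setX.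
  by apply: continuous_subspaceT => z; apply: cvgB; [exact: cvg_fst|exact: cvg_snd].
have K0 : K 0 by exists z0 => //; exists z0 => //; rewrite subrr.
have cdist : continuous (fun k : R * R => - dot (q - k) (q - k)).
  have E : (fun k : R * R => - dot (q - k) (q - k)) =
      (fun k => - ((q.1 - k.1) * (q.1 - k.1) + (q.2 - k.2) * (q.2 - k.2))) by [].
  rewrite E => k; apply: cvgN; apply: cvgD; apply: cvgM; apply: cvgB;
    try exact: cvg_cst; try exact: cvg_fst; exact: cvg_snd.
have [p Kp pmax] := compact_max compK (ex_intro _ 0 K0) cdist.
have pmin k : K k -> dot (q - p) (q - p) <= dot (q - k) (q - k).
  by move=> /pmax; rewrite lerN2.
have near := nearest_ineq cK Kp pmin.
set e := q - p in near.
have e0 : e != 0.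
  by apply/eqP => /eqP; rewrite subr_eq0 => /eqP qp; apply: nD; rewrite -/q qp.
have ee : 0 < dot e e.
  by rewrite lt_neqAle dot_ge0 andbT eq_sym; apply: contra e0 => /eqP/dot_eq0 ->.
have pe0 : 0 <= dot p e by have := near 0 K0; rewrite sub0r -scaleN1r dotZl; lra.
have qe : dot p e < D * dot v e.
  by rewrite -dotZl -/q -subr_gt0 -dotBl.
have ve : 0 < dot v e.
  rewrite ltNge; apply/negP => h; have := mulr_ge0_le0 D0 h; lra.
pose d := (dot v e)^-1 *: e.
have dotd x : dot x d = dot x e / dot v e.
  by rewrite /d dotC dotZl [dot e x]dotC mulrC.
pose W := dot p e / dot v e.
have width k : K k -> dot k d <= W.
  move=> Kk; rewrite dotd /W ler_pM2r ?invr_gt0//.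
  by have := near k Kk; rewrite dotBl; lra.
have [x1 Ox1 x1P] := compact_max cO O0 (@continuous_dotl d).
have [x2 Ox2 x2P] : exists2 x2, Omega x2 & forall x, Omega x -> dot x2 d <= dot x d.
  have cN : continuous (fun x : R * R => - dot x d).
    by move=> x; apply: cvgN; exact: continuous_dotl.
  by have [c Oc cP] := compact_max cO O0 cN; exists c => // x /cP; rewrite lerN2.
have w12 : dot x1 d - dot x2 d <= W.
  by rewrite -dotBl; apply: width; exists x1 => //; exists x2.
exists d, ((dot x1 d + dot x2 d) / 2), W; split.
- by rewrite dotd divff// gt_eqF.
- by rewrite divr_ge0// ltW.
- by rewrite ltr_pdivrMr.
move=> xi Oxi; have h1 := x1P xi Oxi; have h2 := x2P xi Oxi.
by rewrite ler_norml; apply/andP; split; lra.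
Qed.

Lemma chord_of_difference Omega v w : convex_set Omega -> difference_set Omega (w *: v) ->
  exists p, forall t, `|t| <= w / 2 -> Omega (p + t *: v).
Proof.
move=> /convex_setP cO [x Ox [y Oy xy]]; exists (2^-1 *: (x + y)) => t tw.
have [w0|w0] := eqVneq w 0.
  have t0 : t = 0 by apply/eqP; rewrite -normr_le0; move: tw; rewrite w0 mul0r.
  have -> : 2^-1 *: (x + y) + t *: v = 2^-1 *: x + (1 - 2^-1) *: y.
    rewrite t0 scale0r addr0 scalerDr; congr (_ + _ *: _); by field.
  by apply: cO => //; lra.
have w00 : 0 < w.
  by rewrite lt_neqAle eq_sym w0/=; have := le_trans (normr_ge0 t) tw; lra.
pose s := 2^-1 + t / w.
have -> : 2^-1 *: (x + y) + t *: v = s *: x + (1 - s) *: y.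
  have -> : t *: v = (t / w) *: (x - y) by rewrite xy scalerA divfK.
  have -> : 1 - s = 2^-1 - t / w by rewrite /s; field.
  by rewrite /s scalerDl scalerBl scalerDr scalerBr; rewrite addrACA.
have tw2 : `|t / w| <= 2^-1.
  rewrite normrM normfV (gtr0_norm w00) ler_pdivrMr// mulrC; exact: tw.
move: tw2; rewrite ler_norml /s => /andP[h1 h2].
by apply: cO => //; lra.
Qed.

Lemma line_null (a b c : R) : (a, b) != 0 ->
  lebesgue2 [set x : R * R | a * x.1 + b * x.2 = c] = 0%E.
Proof.
move=> ab; have [b0|b0] := eqVneq b 0.
  have a0 : a != 0 by apply: contra ab => /eqP a0; rewrite a0 b0.
  have -> : [set x : R * R | a * x.1 + b * x.2 = c] = [set c / a] `*` setT.
    apply/seteqP; split => [[x y]/= h|[x y]/= [-> _]].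
      by split => //; rewrite -h b0 mul0r addr0 mulrC mulKf.
    by rewrite b0 mul0r addr0 mulrC divfK.
  transitivity (lebesgue_measure [set (c / a)%R] * lebesgue_measure [set: R])%E.
    exact: product_measure1E.
  by rewrite lebesgue_measure_set1 mul0e.
rewrite /lebesgue2 /product_measure1/=.
rewrite (eq_integral (fun=> 0%E)) ?integral0// => x _ /=.
rewrite (_ : xsection _ _ = [set (c - a * x) / b]) ?lebesgue_measure_set1//.
apply/seteqP; split => y; rewrite /xsection/= inE/=.
  by move=> <-; rewrite addrAC subrr add0r mulrC mulKf.
by move=> ->; rewrite [b * _]mulrC divfK//; ring.
Qed.

Lemma closed_measurable_plane (F : set (R * R)) : closed F -> measurable F.
Proof.
move=> cF; rewrite -[F]setCK; apply: measurableC; apply: open_measurable_plane.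
exact: closed_openC.
Qed.

Lemma subset_line_null Omega (a b c : R) : compact Omega -> (a, b) != 0 ->
  (forall x, Omega x -> a * x.1 + b * x.2 = c) -> lebesgue2 Omega = 0%E.
Proof.
move=> kO ab OL; apply/eqP; rewrite eq_le; apply/andP; split; last exact: measure_ge0.
rewrite -(line_null c ab); apply: le_measure.
- rewrite inE; apply: closed_measurable_plane; apply: compact_closed kO.
  exact: norm_hausdorff.
- rewrite inE; apply: closed_measurable_plane.
  have cf : continuous (fun x : R * R => dot x (a, b)) by exact: continuous_dotl.
  rewrite (_ : [set x | _] = (fun x : R * R => dot x (a, b)) @^-1` [set c]).
    by apply: closed_comp => [x _|]; [exact: cf|exact: closed_eq].
  by apply/seteqP; split => x /=; rewrite /dot/= => <-; ring.
- by move=> x /OL.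
Qed.

Definition det2 x y : R := x.1 * y.2 - x.2 * y.1.

(** A set contained in a line is a null set. *)
Lemma not_collinear Omega : compact Omega -> (0 < lebesgue2 Omega)%E ->
  exists x0 b c : R * R, [/\ Omega x0, Omega b, Omega c & det2 (b - x0) (c - x0) != 0].
Proof.
move=> kO posO; apply: contrapT => H.
have [x0 O0] : Omega !=set0.
  by apply/set0P/eqP => O0; move: posO; rewrite O0 /lebesgue2 measure0 ltxx.
have null (a b c : R) : (a, b) != 0 -> ~ (forall x, Omega x -> a * x.1 + b * x.2 = c).
  by move=> ab OL; move: posO; rewrite (subset_line_null kO ab OL) ltxx.
have [b [Ob bx]] : exists b, Omega b /\ b != x0.
  apply: contrapT => H'.
  have n10 : ((1, 0) : R * R) != 0 by apply/eqP => -[/eqP]; rewrite oner_eq0.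
  apply: (null _ _ x0.1 n10) => x Ox.
  have [->|xo] := eqVneq x x0; first by rewrite /= mul1r mul0r addr0.
  by exfalso; apply: H'; exists x.
have nb : (- (b - x0).2, (b - x0).1) != 0.
  apply: contra bx => /eqP[/eqP h2 /eqP h1]; move: h1 h2; rewrite oppr_eq0 !subr_eq0.
  by case: b x0 {H O0 Ob} => [b1 b2] [z1 z2] /= /eqP -> /eqP ->.
apply: (null _ _ (- (b - x0).2 * x0.1 + (b - x0).1 * x0.2) nb) => x Ox.
apply/eqP; rewrite -subr_eq0; apply: contraT => h; exfalso; apply: H.
exists x0, b, x; split => //; apply: contra h => /eqP; rewrite /det2/= => h.
by apply/eqP; rewrite -[RHS]h; ring.
Qed.

Lemma triangle_mem Omega (x0 b c : R * R) (s r : R) : convex2 Omega -> Omega x0 -> Omega b -> Omega c ->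
  0 <= s -> 0 <= r -> s + r <= 1 -> Omega (x0 + s *: (b - x0) + r *: (c - x0)).
Proof.
move=> cO O0 Ob Oc s0 r0 sr.
have [E|E] := eqVneq (s + r) 0.
  have -> : s = 0 by lra.
  have -> : r = 0 by lra.
  by rewrite !scale0r !addr0.
have sr0 : 0 < s + r by rewrite lt_neqAle eq_sym E/= addr_ge0.
have h1 : 0 <= s / (s + r) by rewrite divr_ge0// ltW.
have h2 : s / (s + r) <= 1 by rewrite ler_pdivrMr// mul1r lerDl.
have := cO _ _ (s + r) (cO _ _ _ Ob Oc h1 h2) O0 (ltW sr0) sr.
have -> : (s + r) *: (s / (s + r) *: b + (1 - s / (s + r)) *: c) + (1 - (s + r)) *: x0 =
  x0 + s *: (b - x0) + r *: (c - x0).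
  have e1 : (s + r) * (s / (s + r)) = s by rewrite mulrC divfK.
  have e2 : (s + r) * (1 - s / (s + r)) = r by rewrite mulrBr e1; ring.
  rewrite scalerDr !scalerA e1 e2.
  by apply: plane_eq; rewrite /= /GRing.scale/=; ring.
by [].
Qed.

(** A triangle contains a small segment in every direction around its centroid. *)
Lemma positive_chord Omega v : compact Omega -> convex_set Omega ->
  (0 < lebesgue2 Omega)%E -> exists2 t, 0 < t & difference_set Omega (t *: v).
Proof.
move=> kO /convex_setP cO posO.
have [x0 [b [c [h0 Ob Oc dbc]]]] := not_collinear kO posO.
pose al := det2 v (c - x0) / det2 (b - x0) (c - x0).
pose be := det2 (b - x0) v / det2 (b - x0) (c - x0).
have vE : v = al *: (b - x0) + be *: (c - x0).
  have e k : al * k = det2 v (c - x0) * k / det2 (b - x0) (c - x0) by rewrite mulrAC.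
  have e' k : be * k = det2 (b - x0) v * k / det2 (b - x0) (c - x0) by rewrite mulrAC.
  by apply: plane_eq; rewrite /= /GRing.scale/= e e' -mulrDl; apply: (mulIf dbc);
    rewrite divfK// /det2/=; ring.
pose t := (3 * (1 + `|al| + `|be|))^-1.
have q0 : 0 < 1 + `|al| + `|be| by have := normr_ge0 al; have := normr_ge0 be; lra.
have t0 : 0 < t by rewrite invr_gt0 mulr_gt0.
have tab : t * `|al| + t * `|be| <= 1 / 3.
  have e : t * (1 + `|al| + `|be|) = 1 / 3 by rewrite /t; field; rewrite gt_eqF.
  by rewrite -e -mulrDr ler_pM2l//; lra.
have ta : `|t * al| = t * `|al| by rewrite normrM gtr0_norm.
have tb : `|t * be| = t * `|be| by rewrite normrM gtr0_norm.
have := ler_norm (t * al); have := ler_norm (- (t * al)); rewrite normrN.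
have := ler_norm (t * be); have := ler_norm (- (t * be)); rewrite normrN ta tb.
have := normr_ge0 al => /(mulr_ge0 (ltW t0)); have := normr_ge0 be => /(mulr_ge0 (ltW t0)).
move=> g1 g2 g3 g4 g5 g6.
exists t => //.
exists (x0 + (1 / 3 + t * al / 2) *: (b - x0) + (1 / 3 + t * be / 2) *: (c - x0)).
  by apply: triangle_mem => //; lra.
exists (x0 + (1 / 3 - t * al / 2) *: (b - x0) + (1 / 3 - t * be / 2) *: (c - x0)).
  by apply: triangle_mem => //; lra.
rewrite [in RHS]vE; move: (b - x0) (c - x0) => B C.
by apply: plane_eq; rewrite /= /GRing.scale/=; field.
Qed.

End geometry.

(** * Functions of one linear form in the Bernstein space *)
Section bounded_limit.
Context {R : realType}.

(** Limits along a free ultrafilter extend the limit functional to all bounded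
    sequences. *)
Lemma bounded_limit : exists Lm : (nat -> R) -> R,
  [/\ forall u v (c M M' : R), (forall n, `|u n| <= M) -> (forall n, `|v n| <= M') ->
        Lm (fun n => c * u n + v n) = c * Lm u + Lm v,
      forall u (M : R), (forall n, `|u n| <= M) -> `|Lm u| <= M &
      forall u (l : R), u n @[n --> \oo] --> l -> Lm u = l].
Proof.
have [U [UU oU]] := @ultraFilterLemma nat eventually _.
pose Lm (u : nat -> R) : R := lim (u n @[n --> U]).
have key u (M : R) : (forall n, `|u n| <= M) -> u n @[n --> U] --> Lm u /\ `|Lm u| <= M.
  move=> uM; have cK : compact `[- M, M]%classic := @segment_compact R (- M) M.
  have uK : (u @ U) `[- M, M]%classic.
    rewrite /fmap/= (_ : u @^-1` _ = setT); first exact: filterT.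
    by apply/seteqP; split => // n _ /=; rewrite in_itv/= -ler_norml.
  have [p [pK pcl]] := cK (u @ U) _ uK.
  have up : u n @[n --> U] --> p.
    move=> V Vp; have [//|UV] := in_ultra_setVsetC (u @^-1` V) UU.
    have [y [yV' yV]] := pcl (~` V) V UV Vp.
    by exfalso; exact: yV'.
  have E : Lm u = p by apply/cvg_lim.
  by rewrite E; split => //; move: pK; rewrite /= in_itv/= -ler_norml.
exists Lm; split.
- move=> u v c M M' uM vM; apply/cvg_lim => //.
  apply: cvgD; last exact: (key v M' vM).1.
  by apply: cvgMl_tmp; exact: (key u M uM).1.
- by move=> u M uM; exact: (key u M uM).2.
move=> u l ul; apply/cvg_lim => //; apply: cvg_trans ul; exact: cvg_app.
Qed.

End bounded_limit.

Section complex_integrals.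
Context {R : realType}.
Notation mu := (@lebesgue_measure R).
Notation mu2 := (mu \x mu)%E.
Implicit Types (f g k phi : R * R -> R[i]).

Definition cintegrable g :=
  mu2.-integrable setT (EFin \o (fun x => complex.Re (g x))) /\
  mu2.-integrable setT (EFin \o (fun x => complex.Im (g x))).

Definition cbounded_continuous (u : R * R -> R[i]) :=
  [/\ continuous (fun x => complex.Re (u x)), continuous (fun x => complex.Im (u x)) &
   exists M : R, forall x, cabs (u x) <= M].

Lemma Re_mul (z w : R[i]) : complex.Re (z * w) =
  complex.Re z * complex.Re w - complex.Im z * complex.Im w.
Proof. by case: z w => [a b] [c d]. Qed.

Lemma Im_mul (z w : R[i]) : complex.Im (z * w) =
  complex.Re z * complex.Im w + complex.Im z * complex.Re w.
Proof. by case: z w => [a b] [c d]. Qed.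

Lemma Re_add (z w : R[i]) : complex.Re (z + w) = complex.Re z + complex.Re w.
Proof. by case: z w => [a b] [c d]. Qed.

Lemma Im_add (z w : R[i]) : complex.Im (z + w) = complex.Im z + complex.Im w.
Proof. by case: z w => [a b] [c d]. Qed.

Lemma cintegrable_mul u g : cbounded_continuous u -> cintegrable g ->
  cintegrable (fun x => u x * g x).
Proof.
move=> [c1 c2 [M uM]] [i1 i2].
have b1 x : `|complex.Re (u x)| <= M by apply: le_trans (cabs_Re _) (uM x).
have b2 x : `|complex.Im (u x)| <= M by apply: le_trans (cabs_Im _) (uM x).
have m1 := continuous_measurable_plane c1; have m2 := continuous_measurable_plane c2.
have j11 := integrable_bounded_mul i1 m1 b1; have j12 := integrable_bounded_mul i1 m2 b2.
have j21 := integrable_bounded_mul i2 m1 b1; have j22 := integrable_bounded_mul i2 m2 b2.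
split.
  have := integrableB measurableT j11 j22; apply: eq_integrable => // x _ /=.
  by rewrite Re_mul -EFinB; congr EFin; ring.
have := integrableD measurableT j21 j12; apply: eq_integrable => // x _ /=.
by rewrite Im_mul -EFinD; congr EFin; ring.
Qed.

Lemma cintegralD f g : cintegrable f -> cintegrable g ->
  cintegral (fun x => f x + g x) = cintegral f + cintegral g.
Proof.
move=> [f1 f2] [g1 g2]; rewrite /cintegral; apply: complex_eqP => /=.
  by rewrite -RintegralD//; apply: eq_Rintegral => x _; rewrite Re_add.
by rewrite -RintegralD//; apply: eq_Rintegral => x _; rewrite Im_add.
Qed.

Lemma cintegralZ (c : R[i]) f : cintegrable f ->
  cintegral (fun x => c * f x) = c * cintegral f.
Proof.
move=> [f1 f2]; have Z (r : R) h : mu2.-integrable setT (EFin \o h) ->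
    mu2.-integrable setT (EFin \o (fun x => r * h x)).
  by move=> ih; have := integrableZl measurableT r ih; apply: eq_integrable.
rewrite /cintegral; apply: complex_eqP; rewrite ?Re_mul ?Im_mul/=.
  rewrite -!RintegralZl// -RintegralB//; [|exact: Z|exact: Z].
  by apply: eq_Rintegral => x _; rewrite Re_mul.
rewrite -!RintegralZl// -RintegralD//; [|exact: Z|exact: Z].
by apply: eq_Rintegral => x _; rewrite Im_mul.
Qed.

Lemma integrable_oneDsqrV : mu.-integrable setT (EFin \o (fun x : R => (oneDsqr x)^-1)).
Proof.
have c1 : continuous (fun x : R => (oneDsqr x)^-1) by exact: continuous_oneDsqrV.
have p0 (x : R) : 0 <= (oneDsqr x)^-1 by rewrite invr_ge0 (le_trans ler01)// oneDsqr_ge1.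
apply/integrableP; split; first by apply/measurable_EFinP; exact: continuous_measurable_fun.
have -> : (\int[mu]_x `|(EFin \o (fun y : R => (oneDsqr y)^-1%R)) x|)%E =
    (\int[mu]_x ((oneDsqr x)^-1)%:E)%E.
  by apply: eq_integral => x _ /=; rewrite ger0_norm.
rewrite (ge0_symfun_integralT p0 c1); last first.
  by move=> x /=; rewrite /oneDsqr sqrrN.
rewrite (_ : [set x : R | 0 <= x] = `[0, +oo[%classic); last first.
  by apply/seteqP; split => x /=; rewrite in_itv/= andbT.
by rewrite integral0y_oneDsqr -EFinM ltry.
Qed.

(** Domination by a product of two functions [1 / (1 + t ^+ 2)]. *)
Lemma schwartz_cintegrable phi : schwartz phi -> cintegrable phi.
Proof.
move=> [sm /(_ 2%N)[M MP]].
have [C1 C2] := sm 0%N.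
have c1 : continuous (fun x => complex.Re (phi x)) by case: C1.
have c2 : continuous (fun x => complex.Im (phi x)) by case: C2.
pose g (x : R * R) := (oneDsqr x.1)^-1 * (oneDsqr x.2)^-1.
have ig : mu2.-integrable setT (EFin \o g).
  exact: integrable_plane_mul integrable_oneDsqrV integrable_oneDsqrV.
have o1 (x : R) : 0 < oneDsqr x by rewrite (lt_le_trans ltr01)// oneDsqr_ge1.
have phiM x : cabs (phi x) <= 4 * M * g x.
  have pE : cpartial 0 0 phi x = phi x by rewrite /cpartial /mixed_partial/=; case: (phi x).
  have h00 := MP 0%N 0%N 0%N 0%N x isT isT isT isT.
  have h20 := MP 2%N 0%N 0%N 0%N x isT isT isT isT.
  have h02 := MP 0%N 2%N 0%N 0%N x isT isT isT isT.
  have h22 := MP 2%N 2%N 0%N 0%N x isT isT isT isT.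
  rewrite pE ?expr0 ?mul1r ?mulr1 !(real_normK (num_real _)) in h00 h20 h02 h22.
  have e : 4 * M * g x = 4 * M / (oneDsqr x.1 * oneDsqr x.2).
    by rewrite /g -invfM.
  rewrite e ler_pdivlMr ?mulr_gt0// /oneDsqr.
  have -> : cabs (phi x) * ((1 + x.1 ^+ 2) * (1 + x.2 ^+ 2)) = cabs (phi x) +
    x.1 ^+ 2 * cabs (phi x) + x.2 ^+ 2 * cabs (phi x) + x.1 ^+ 2 * x.2 ^+ 2 * cabs (phi x).
    by ring.
  by lra.
have M0 : 0 <= 4 * M.
  rewrite mulr_ge0//; apply: le_trans (MP 0%N 0%N 0%N 0%N 0 isT isT isT isT).
  by rewrite !expr0 !mul1r cabs_ge0.
have dom (h : R * R -> R) : continuous h -> (forall x, `|h x| <= cabs (phi x)) ->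
    mu2.-integrable setT (EFin \o h).
  move=> ch hb; have iM : mu2.-integrable setT (EFin \o (fun x => 4 * M * g x)).
    by have := integrableZl measurableT (4 * M) ig; apply: eq_integrable.
  apply: le_integrable iM => //.
    by apply/measurable_EFinP; exact: continuous_measurable_plane.
  move=> x _ /=; rewrite lee_fin; apply: le_trans (hb x) _.
  by apply: le_trans (phiM x) _; exact: ler_norm.
by split; apply: dom => // x; [exact: cabs_Re|exact: cabs_Im].
Qed.

Lemma continuous_complex f : continuous (fun x => complex.Re (f x)) ->
  continuous (fun x => complex.Im (f x)) -> continuous (f : R * R -> R[i]^o).
Proof.
move=> c1 c2 x; apply/cvgrPdist_le => e e0.
have [r eE r0] : exists2 r : R, e = (r%:C)%C & 0 < r.
  have er : e \is Num.real by exact: gtr0_real.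
  case: e e0 er => a b; rewrite ltcE/= => /andP[/eqP -> a0] _.
  by exists a.
have r20 : 0 < r / 2 by rewrite divr_gt0.
have n1 := (cvgrPdist_le _ _).1 (c1 x) (r / 2) r20.
have n2 := (cvgrPdist_le _ _).1 (c2 x) (r / 2) r20.
near=> y.
have h1 : `|complex.Re (f x) - complex.Re (f y)| <= r / 2 by near: y; exact: n1.
have h2 : `|complex.Im (f x) - complex.Im (f y)| <= r / 2 by near: y; exact: n2.
rewrite eE; suff h : cabs (f x - f y) <= r.
  have : ((cabs (f x - f y))%:C <= r%:C)%C by rewrite lecR.
  by [].
apply: le_trans (cabs_le _) _; move: h1 h2.
by case: (f x) (f y) => [a b] [c d] /= h1 h2; lra.
Unshelve. all: by end_near. Qed.

End complex_integrals.

Section exponential_sums.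
Context {R : realType}.
Notation mu := (@lebesgue_measure R).
Notation mu2 := (mu \x mu)%E.
Implicit Types (s : seq (R * R * R)) (phi psi k : R * R -> R[i]) (p v : R * R).

Lemma cabs_sum (I : eqType) (r : seq I) (F : I -> R[i]) :
  cabs (\sum_(i <- r) F i) <= \sum_(i <- r) cabs (F i).
Proof.
elim: r => [|i r IH]; first by rewrite !big_nil cabs0.
by rewrite !big_cons; apply: le_trans (cabsD _ _) _; rewrite lerD2l.
Qed.

(** The combination of point evaluations whose inverse Fourier transform is the
    cosine polynomial [cospoly s (dot x v)] times the character of frequency [p]. *)
Definition exp_functional p v s phi : R[i] :=
  \sum_(q <- s) ((q.1.1 / 2)%:C)%C *
    (cis q.2 * phi (p + q.1.2 *: v) + cis (- q.2) * phi (p - q.1.2 *: v)).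

Lemma exp_functional_le p v s phi (rho M : R) : spectrum_in rho s ->
  (forall t : R, `|t| <= rho -> cabs (phi (p + t *: v)) <= M) ->
  cabs (exp_functional p v s phi) <= cosmass s * M.
Proof.
move=> sp phiM; apply: le_trans (cabs_sum _ _) _.
rewrite /cosmass mulr_suml big_seq [leRHS]big_seq; apply: ler_sum => q qs.
have q1 := sp q qs.
have h1 := phiM _ q1; have h2 := phiM (- q.1.2); rewrite normrN in h2; have {}h2 := h2 q1.
rewrite scaleNr in h2; rewrite cabsM cabsR normrM normfV (@ger0_norm _ (2 : R))//.
rewrite -mulrA; apply: ler_wpM2l => //.
apply: le_trans (ler_wpM2l _ (cabsD _ _)) _; first by rewrite invr_ge0.
by rewrite !cabsM !cabs_cis !mul1r; lra.
Qed.

Lemma exp_functional_linear p v s (c : R[i]) phi psi :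
  exp_functional p v s (fun x => c * phi x + psi x) =
  c * exp_functional p v s phi + exp_functional p v s psi.
Proof.
rewrite /exp_functional mulr_sumr -big_split/=; apply: eq_bigr => q _.
by ring.
Qed.

Lemma continuous_dotr p : continuous (fun x : R * R => dot p x).
Proof.
rewrite (_ : (fun x => _) = fun x => dot x p); first exact: continuous_dotl.
by apply/funext => x; rewrite dotC.
Qed.

Lemma cbounded_cis (a : R) p : cbounded_continuous (fun x => cis (a * dot p x)).
Proof.
have ca : continuous (fun x : R * R => a * dot p x).
  by move=> x; apply: cvgMl_tmp; exact: continuous_dotr.
split.
- by move=> x; apply: continuous_comp; [exact: ca|exact: continuous_cos].
- by move=> x; apply: continuous_comp; [exact: ca|exact: continuous_sin].
by exists 1 => x; rewrite cabs_cis.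
Qed.

Lemma cbounded_real (u : R -> R) (M : R) v : continuous u -> (forall t, `|u t| <= M) ->
  cbounded_continuous (fun x => ((u (dot v x))%:C)%C).
Proof.
move=> cu uM; split.
- by rewrite /= => x; apply: continuous_comp; [exact: continuous_dotr|exact: cu].
- by rewrite /= => x; exact: cvg_cst.
by exists M => x; rewrite cabsR.
Qed.

Lemma trig_continuous rho B (F : R -> R) : 0 <= rho -> trig rho B F -> continuous F.
Proof.
move=> r0 tF t; apply/cvgrPdist_le => e e0.
have B0 := trig_mass_ge0 tF.
pose K : R := 40 * (2 * rho + 1) * B + 1.
have K0 : 0 < K by rewrite ltr_wpDl// !mulr_ge0//; lra.
near=> t'.
have h : `|t - t'| <= e / K.
  by near: t'; apply: (cvgrPdist_le _ _).1; [exact: cvg_id|rewrite divr_gt0].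
apply: le_trans (trig_lipschitz t t' r0 tF (fun t => trig_bound t tF)) _.
have h1 : 40 * (2 * rho + 1) * B * `|t - t'| <= K * `|t - t'|.
  by apply: ler_wpM2r => //; rewrite /K; lra.
by apply: le_trans h1 _; rewrite mulrC -ler_pdivlMr.
Unshelve. all: by end_near. Qed.

Lemma cospoly_trig s (rho : R) : spectrum_in rho s -> trig rho (cosmass s) (cospoly s).
Proof. by move=> sp; exists (fun=> s); split => // t; exact: cvg_cst. Qed.

Lemma continuous_cospoly s : continuous (cospoly s).
Proof.
pose rho : R := \sum_(q <- s) `|q.1.2|.
have r0 : 0 <= rho by apply: sumr_ge0.
apply: (@trig_continuous rho (cosmass s)) => //; apply: cospoly_trig => q qs.
rewrite /rho; elim: s qs {rho r0} => [//|q' s IH]; rewrite inE big_cons.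
by move=> /orP[/eqP ->|/IH h]; rewrite ?lerDl ?sumr_ge0//; apply: le_trans h _; rewrite lerDr.
Qed.

Lemma cos_cis (c w th : R) : ((c * cos (w + th))%:C)%C =
  ((c / 2)%:C)%C * (cis th * cis w + cis (- th) * cis (- w)) :> R[i].
Proof.
rewrite -!cisD -opprD [th + w]addrC.
apply: complex_eqP; rewrite ?Re_mul ?Im_mul /= ?cosN ?sinN; last by ring.
by field.
Qed.

(** Linearity of the integral and the addition formula for [cis]. *)
Lemma exp_functional_inv_fourier p v s phi : cintegrable phi ->
  exp_functional p v s (inv_fourier phi) =
  cintegral (fun x => ((cospoly s (dot v x))%:C)%C * (cis (2 * pi * dot p x) * phi x)).
Proof.
move=> iphi; pose k x := cis (2 * pi * dot p x) * phi x.
have ik : cintegrable k by apply: cintegrable_mul => //; exact: cbounded_cis.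
have E (t : R) : inv_fourier phi (p + t *: v) =
    cintegral (fun x => cis (2 * pi * t * dot v x) * k x).
  rewrite /inv_fourier; congr cintegral; apply/funext => x.
  rewrite dotDl dotZl /k mulrA -cisD; congr (cis _ * _); ring.
have icis (a : R) : cintegrable (fun x => cis (a * dot v x) * k x).
  by apply: cintegrable_mul => //; exact: cbounded_cis.
have icst (c : R[i]) g : cintegrable g -> cintegrable (fun x => c * g x).
  move=> ig; apply: (@cintegrable_mul _ (fun=> c)) => //.
  by split => [x|x|]; [exact: cvg_cst|exact: cvg_cst|exists (cabs c)].
have iadd (g h : R * R -> R[i]) : cintegrable g -> cintegrable h ->
    cintegrable (fun x => g x + h x).
  move=> [g1 g2] [h1 h2]; split.
    have := integrableD measurableT g1 h1; apply: eq_integrable => // x _ /=.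
    by rewrite Re_add.
  have := integrableD measurableT g2 h2; apply: eq_integrable => // x _ /=.
  by rewrite Im_add.
rewrite /exp_functional; elim: s => [|q s IH].
  rewrite big_nil (_ : (fun x => _) = (fun x => 0 * k x)); first by rewrite cintegralZ// mul0r.
  by apply/funext => x; rewrite /cospoly big_nil /k.
rewrite big_cons IH -scaleNr !E.
rewrite -!cintegralZ// -cintegralD; [|by apply: icst|by apply: icst].
rewrite -cintegralZ; last by apply: (iadd); apply: (icst).
rewrite -cintegralD; first last.
- apply: cintegrable_mul ik.
  apply: (@cbounded_real (cospoly s) (cosmass s)); first exact: continuous_cospoly.
  by move=> t; exact: cospoly_le.
- by apply: (icst); apply: (iadd); apply: (icst).
congr cintegral; apply/funext => x; rewrite -/(k x) /cospoly big_cons.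
have -> (a b : R) : ((a + b)%:C)%C = (a%:C)%C + (b%:C)%C :> R[i] by rewrite rmorphD.
rewrite [RHS]mulrDl; congr (_ + _); rewrite cos_cis.
have -> : 2 * pi * - q.1.2 * dot v x = - (2 * pi * q.1.2 * dot v x) by ring.
by ring.
Qed.

End exponential_sums.

Section bernstein_of_trig.
Context {R : realType}.
Notation mu := (@lebesgue_measure R).
Notation mu2 := (mu \x mu)%E.

Lemma schwartz_bounded (phi : R * R -> R[i]) : schwartz phi ->
  exists M : R, forall x, cabs (phi x) <= M.
Proof.
move=> [_ /(_ 0%N)[M MP]]; exists M => x.
have := MP 0%N 0%N 0%N 0%N x isT isT isT isT; rewrite !expr0 !mul1r.
by rewrite /cpartial /mixed_partial/=; case: (phi x).
Qed.

Lemma ball_cpair (z : R[i]) (M : R) : `|complex.Re z| <= M -> `|complex.Im z| <= M ->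
  cabs z <= 2 * M.
Proof. by move=> h1 h2; apply: le_trans (cabs_le _) _; lra. Qed.

(** The distribution is a generalised limit of combinations of point evaluations
    on the chord.  On inverse Fourier transforms of Schwartz functions the limit
    exists in the ordinary sense, by dominated convergence; a Banach limit is used
    to have a linear functional on all Schwartz functions. *)
Lemma bernstein_trig (Omega : set (R * R)) (p v : R * R) (rho B : R) (G : R -> R) :
  0 <= rho -> trig rho B G -> (forall t : R, `|t| <= rho -> Omega (p + t *: v)) ->
  bernstein Omega (fun x => cis (2 * pi * dot p x) * ((G (dot v x))%:C)%C).
Proof.
move=> r0 tG Op; have cG := trig_continuous r0 tG; have B0 := trig_mass_ge0 tG.
have [P [Psp Pm Pc]] := tG.
have cu := cbounded_cis (2 * pi) p.
have cg := cbounded_real v cG (fun t => trig_bound t tG).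
split.
- have [u1 u2 _] := cu; have [g1 g2 _] := cg.
  apply: continuous_complex => x.
    rewrite (_ : (fun x => _) = fun x => cos (2 * pi * dot p x) * G (dot v x)).
      by apply: cvgM; [exact: u1|exact: g1].
    by apply/funext => y; rewrite Re_mul/= mulr0 subr0.
  rewrite (_ : (fun x => _) = fun x => sin (2 * pi * dot p x) * G (dot v x)).
    by apply: cvgM; [exact: u2|exact: g1].
  by apply/funext => y; rewrite Im_mul/= mulr0 add0r.
- by exists B => x; rewrite cabsM cabs_cis mul1r cabsR; exact: trig_bound tG.
have [Lm [LmD LmB LmC]] := @bounded_limit R.
pose E n phi := exp_functional p v (P n) phi.
pose T phi : R[i] := (Lm (fun n => complex.Re (E n phi)) +i* Lm (fun n => complex.Im (E n phi)))%C.
have EM phi (M : R) : (forall x, cabs (phi x) <= M) -> forall n, cabs (E n phi) <= B * M.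
  move=> phiM n; have M0 : 0 <= M by apply: le_trans (phiM 0); exact: cabs_ge0.
  apply: le_trans (@exp_functional_le _ p v (P n) phi rho M (Psp n) _) _; first by move=> t _; exact: phiM.
  exact: ler_wpM2r.
have ERe phi (M : R) : (forall x, cabs (phi x) <= M) ->
    forall n, `|complex.Re (E n phi)| <= B * M.
  by move=> phiM n; apply: le_trans (cabs_Re _) (EM _ _ phiM n).
have EIm phi (M : R) : (forall x, cabs (phi x) <= M) ->
    forall n, `|complex.Im (E n phi)| <= B * M.
  by move=> phiM n; apply: le_trans (cabs_Im _) (EM _ _ phiM n).
have Tlin (c : R[i]) phi psi (M M' : R) : (forall x, cabs (phi x) <= M) ->
    (forall x, cabs (psi x) <= M') ->
    T (fun x => c * phi x + psi x) = c * T phi + T psi.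
  move=> phiM psiM.
  have bnd (r : R) (u w : nat -> R) (K K' : R) : (forall n, `|u n| <= K) ->
      (forall n, `|w n| <= K') -> forall n, `|r * u n + w n| <= `|r| * K + K'.
    move=> uK wK n; apply: le_trans (ler_normD _ _) _; rewrite normrM.
    by apply: lerD => //; apply: ler_wpM2l.
  rewrite /T; apply: complex_eqP; rewrite ?Re_add ?Im_add ?Re_mul ?Im_mul /=.
    rewrite (_ : (fun n => _) = fun n => complex.Re c * complex.Re (E n phi) +
       (- complex.Im c * complex.Im (E n phi) + complex.Re (E n psi))); last first.
      by apply/funext => n; rewrite /E exp_functional_linear Re_add Re_mul; ring.
    rewrite (LmD _ _ _ _ _ (ERe _ _ phiM) (bnd _ _ _ _ _ (EIm _ _ phiM) (ERe _ _ psiM))).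
    by rewrite (LmD _ _ _ _ _ (EIm _ _ phiM) (ERe _ _ psiM)); ring.
  rewrite (_ : (fun n => _) = fun n => complex.Re c * complex.Im (E n phi) +
     (complex.Im c * complex.Re (E n phi) + complex.Im (E n psi))); last first.
    by apply/funext => n; rewrite /E exp_functional_linear Im_add Im_mul; ring.
  rewrite (LmD _ _ _ _ _ (EIm _ _ phiM) (bnd _ _ _ _ _ (ERe _ _ phiM) (EIm _ _ psiM))).
  by rewrite (LmD _ _ _ _ _ (ERe _ _ phiM) (EIm _ _ psiM)); ring.
exists T; split.
- split.
    move=> c phi psi /schwartz_bounded[M phiM] /schwartz_bounded[M' psiM].
    exact: Tlin phiM psiM.
  move=> phi sphi e e0; exists 0%N, (e / (2 * (B + 1))).
    by rewrite divr_gt0// mulr_gt0//; lra.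
  set d := e / _ => psi spsi sd.
  have B1 : 0 < B + 1 by lra.
  have dE : 2 * (B * d) < e.
    rewrite /d; have -> : 2 * (B * (e / (2 * (B + 1)))) = e * (B / (B + 1)).
      by field; rewrite gt_eqF.
    by rewrite gtr_pMr// ltr_pdivrMr//; lra.
  have [M phiM] := schwartz_bounded sphi; have [M' psiM] := schwartz_bounded spsi.
  have db x : cabs (-1 * phi x + psi x) <= d.
    have := sd 0%N 0%N 0%N 0%N x isT isT isT isT; rewrite !expr0 !mul1r.
    rewrite /cpartial /mixed_partial/=; apply: le_trans; rewrite mulN1r addrC.
    by case: (psi x - phi x).
  have -> : T psi - T phi = T (fun x => -1 * phi x + psi x).
    by rewrite (Tlin _ _ _ _ _ phiM psiM) mulN1r addrC.
  apply: le_lt_trans dE; apply: ball_cpair; rewrite /=.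
  - by apply: LmB; exact: ERe.
  by apply: LmB; exact: EIm.
- move=> phi _ _ sup0.
  have phi0 y : Omega y -> phi y = 0.
    move=> Oy; apply/eqP; apply: contraT => py.
    have cl : supp phi y by exact: subset_closure.
    by case: (sup0 y cl Oy).
  have E0 n : E n phi = 0.
    apply: cabs_eq0; apply/eqP; rewrite eq_le cabs_ge0 andbT.
    have := @exp_functional_le _ p v (P n) phi rho 0 (Psp n); rewrite mulr0; apply => t tr.
    by rewrite phi0 ?cabs0//; exact: Op.
  have L0 (u : nat -> R) : (forall n, u n = 0) -> Lm u = 0.
    move=> u0; apply: LmC; rewrite (_ : (fun n => u n) = cst 0); first exact: cvg_cst.
    by apply/funext => n; rewrite u0.
  by rewrite /T !L0// => n; rewrite E0.
move=> phi sphi; have iphi := schwartz_cintegrable sphi.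
pose k x := cis (2 * pi * dot p x) * phi x.
have ik : cintegrable k by apply: cintegrable_mul.
have fk : (fun x => cis (2 * pi * dot p x) * ((G (dot v x))%:C)%C * phi x) =
    (fun x => ((G (dot v x))%:C)%C * k x).
  by apply/funext => x; rewrite /k; ring.
have conv (h : R * R -> R) : mu2.-integrable setT (EFin \o h) ->
    \int[mu2]_x (cospoly (P n) (dot v x) * h x) @[n --> \oo] -->
    \int[mu2]_x (G (dot v x) * h x).
  move=> ih; have mh : measurable_fun setT h.
    by apply/measurable_EFinP; case/integrableP: ih.
  apply: (@dominated_Rintegral _ _ _ mu2 _ _ (fun x => B * `|h x|)).
  - move=> n; apply: measurable_funM => //; apply: continuous_measurable_plane => x.
    by apply: continuous_comp; [exact: continuous_dotr|exact: continuous_cospoly].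
  - apply: measurable_funM => //; apply: continuous_measurable_plane => x.
    by apply: continuous_comp; [exact: continuous_dotr|exact: cG].
  - by move=> x; apply: cvgMr_tmp; exact: Pc.
  - have := integrableZl measurableT B (integrable_norm ih).
    by apply: eq_integrable => // x _ /=.
  move=> n x; rewrite normrM; apply: ler_wpM2r => //.
  by apply: le_trans (cospoly_le _ _) (Pm n).
rewrite fk /T; apply: complex_eqP => /=; apply/esym; apply: LmC.
  rewrite (_ : (fun n => _) = fun n => \int[mu2]_x (cospoly (P n) (dot v x) * complex.Re (k x))).
    rewrite (_ : \int[mu2]_x _ = \int[mu2]_x (G (dot v x) * complex.Re (k x))).
      exact: (conv _ ik.1).
    by apply: eq_Rintegral => x _; rewrite Re_mul/= mul0r subr0.
  apply/funext => n; rewrite /E exp_functional_inv_fourier//.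
  by apply: eq_Rintegral => x _; rewrite Re_mul/= mul0r subr0.
rewrite (_ : (fun n => _) = fun n => \int[mu2]_x (cospoly (P n) (dot v x) * complex.Im (k x))).
  rewrite (_ : \int[mu2]_x _ = \int[mu2]_x (G (dot v x) * complex.Im (k x))).
    exact: (conv _ ik.2).
  by apply: eq_Rintegral => x _; rewrite Im_mul/= mul0r addr0.
apply/funext => n; rewrite /E exp_functional_inv_fourier//.
by apply: eq_Rintegral => x _; rewrite Im_mul/= mul0r addr0.
Qed.

End bernstein_of_trig.

(** * Sampling on parallel lines *)
Section sampling.
Context {R : realType}.
Notation mu := (@lebesgue_measure R).
Notation mu2 := (mu \x mu)%E.
Implicit Types (f : R * R -> R[i]) (p x v d : R * R) (e s M m : R).

Lemma continuous_Re_Im f : continuous (f : R * R -> R[i]^o) ->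
  continuous (fun x => complex.Re (f x)) /\ continuous (fun x => complex.Im (f x)).
Proof.
move=> cf; have near_f x e : 0 < e -> \forall y \near x, cabs (f x - f y) <= e.
  move=> e0; have eC : 0 < (e%:C)%C :> R[i] by rewrite ltcR.
  have n := (cvgrPdist_le _ _).1 (cf x) _ eC.
  near=> y; have h : `|(f x : R[i]^o) - f y| <= (e%:C)%C by near: y; exact: n.
  have h' : ((cabs (f x - f y))%:C <= e%:C)%C by exact: h.
  by rewrite lecR in h'.
split=> x; apply/cvgrPdist_le => e e0; near=> y.
  have h : cabs (f x - f y) <= e by near: y; exact: near_f.
  by apply: le_trans h; apply: le_trans (cabs_Re _); case: (f x) (f y) => [? ?] [].
have h : cabs (f x - f y) <= e by near: y; exact: near_f.
by apply: le_trans h; apply: le_trans (cabs_Im _); case: (f x) (f y) => [? ?] [].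
Unshelve. all: by end_near. Qed.

Lemma mollifyE f s p : mollify f s p =
  ((\int[mu2]_x (complex.Re (f x) * gauss_kernel s p x)) +i*
   (\int[mu2]_x (complex.Im (f x) * gauss_kernel s p x)))%C.
Proof.
rewrite /mollify /cintegral; apply: complex_eqP => /=; apply: eq_Rintegral => x _.
  by rewrite Re_mul/= mulr0 subr0.
by rewrite Im_mul/= mulr0 add0r.
Qed.

Lemma mollify_approx f M p e : continuous (fun x => complex.Re (f x)) ->
  continuous (fun x => complex.Im (f x)) -> (forall x, cabs (f x) <= M) -> 0 < e ->
  exists2 s0 : R, 0 < s0 & forall s, 0 < s -> s <= s0 -> cabs (mollify f s p - f p) <= e.
Proof.
move=> c1 c2 fM e0; have e20 : 0 < e / 2 by rewrite divr_gt0.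
have [s1 s10 h1] := gauss_kernel_approx p c1 (fun x => le_trans (cabs_Re _) (fM x)) e20.
have [s2 s20 h2] := gauss_kernel_approx p c2 (fun x => le_trans (cabs_Im _) (fM x)) e20.
exists (Num.min s1 s2); first by rewrite lt_min s10.
move=> s s0; rewrite le_min => /andP[ss1 ss2].
apply: le_trans (cabs_le _) _; rewrite mollifyE.
have := h1 s s0 ss1; have := h2 s s0 ss2.
by case: (f p) => a b /= g2 g1; lra.
Qed.

(** The continuity of [f] is not uniform a priori, so the mollification is only
    controlled at finitely many points at a time. *)
Lemma mollify_approx_seq f M (ps : seq (R * R)) e :
  continuous (fun x => complex.Re (f x)) ->
  continuous (fun x => complex.Im (f x)) -> (forall x, cabs (f x) <= M) -> 0 < e ->
  exists2 s0 : R, 0 < s0 & forall s, 0 < s -> s <= s0 ->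
    forall p, p \in ps -> cabs (mollify f s p - f p) <= e.
Proof.
move=> c1 c2 fM e0; elim: ps => [|p ps [s1 s10 h1]]; first by exists 1.
have [s2 s20 h2] := mollify_approx p c1 c2 fM e0.
exists (Num.min s1 s2); first by rewrite lt_min s10.
move=> s s0; rewrite le_min => /andP[ss1 ss2] q; rewrite inE => /orP[/eqP ->|qs].
  exact: h2.
exact: h1.
Qed.

Lemma norm_mollify_real (u : R * R -> R) M s p : continuous u -> (forall x, `|u x| <= M) ->
  `|\int[mu2]_x (u x * gauss_kernel s p x)| <= M.
Proof.
move=> cu uM; have mu_ := continuous_measurable_plane cu.
have ik := integrable_gauss_kernel s p.
have iu : mu2.-integrable setT (EFin \o (fun x => u x * gauss_kernel s p x)).
  under [EFin \o _]eq_fun do rewrite mulrC.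
  exact: integrable_bounded_mul ik mu_ uM.
have iM : mu2.-integrable setT (EFin \o (fun x => M * gauss_kernel s p x)).
  under [EFin \o _]eq_fun do rewrite mulrC.
  exact: (integrable_bounded_mul ik (measurable_cst M) (fun=> lexx `|M|)).
apply: le_trans (le_normr_Rintegral _ iu) _ => //.
apply: (@le_trans _ _ (\int[mu2]_x (M * gauss_kernel s p x))).
  apply: le_Rintegral => //; first exact: (integrable_norm iu).
  move=> x _ /=; rewrite normrM (ger0_norm (gauss_kernel_ge0 _ _ _)).
  by apply: ler_wpM2r => //; exact: gauss_kernel_ge0.
by rewrite RintegralZl// Rintegral_gauss_kernel mulr1.
Qed.

Lemma mollify_le f M s p : continuous (fun x => complex.Re (f x)) ->
  continuous (fun x => complex.Im (f x)) -> (forall x, cabs (f x) <= M) ->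
  cabs (mollify f s p) <= 2 * M.
Proof.
move=> c1 c2 fM; rewrite mollifyE; apply: ball_cpair => /=.
  by apply: norm_mollify_real => // x; apply: le_trans (cabs_Re _) (fM x).
by apply: norm_mollify_real => // x; apply: le_trans (cabs_Im _) (fM x).
Qed.

Lemma cabs_weighted_sum (S : seq (R * R)) (g : R -> R) (h : R -> R[i]) (K : R) :
  (forall q, q \in S -> cabs (h q.2) <= K) ->
  cabs (\sum_(q <- S) (q.1%:C)%C * cis (g q.2) * h q.2) <= coef_mass S * K.
Proof.
move=> hK; apply: le_trans (cabs_sum _ _) _.
rewrite /coef_mass mulr_suml big_seq [leRHS]big_seq; apply: ler_sum => q qS.
by rewrite !cabsM cabs_cis mulr1 cabsR; apply: ler_wpM2l => //; exact: hK.
Qed.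

(** Apply [sampling_functional] to the line of direction [d] through the point,
    parametrised so that [n] points of [A] correspond to a length [n].  First the
    nodes are chosen, then the width of the mollification, then the precision. *)
Lemma strip_sampling (Omega : set (R * R)) (A : set R) (d v : R * R) (c W delta l : R)
    (n : nat) : dot v d = 1 -> 0 <= W -> (forall xi, Omega xi -> `|dot xi d - c| <= W / 2) ->
  0 < delta -> separated_by delta A -> (0 < n)%N -> 0 < l -> W < n%:R / l -> rich_at l n A ->
  exists2 C : R, 0 <= C & forall f M m, bernstein Omega f -> (forall x, cabs (f x) <= M) ->
    0 <= m -> (forall x, A (dot x v) -> cabs (f x) <= m) ->
    forall x, cabs (f x) <= C * m + M / 4.
Proof.
move=> vd W0 Ostrip d0 Ad n0 l0 Wl rA.
have np : 0 < n%:R :> R by rewrite ltr0n.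
pose w := n%:R / l; have w0 : 0 < w by rewrite divr_gt0.
have wl : w * l = n%:R by rewrite /w divfK// gt_eqF.
pose d' := w^-1 *: d; pose rho1 := W / 2 / w.
have rho10 : 0 <= rho1 by rewrite !divr_ge0// ltW.
have rho12 : rho1 < 1 / 2.
  by rewrite /rho1 ltr_pdivrMr//; move: Wl; rewrite -/w; lra.
pose rho2 := (rho1 + 1 / 2) / 2.
have r12 : rho1 < rho2 by rewrite /rho2; lra.
have r2 : rho2 < 1 / 2 by rewrite /rho2; lra.
have r20 : 0 <= rho2 by rewrite /rho2; lra.
have wd0 : 0 < w * delta by rewrite mulr_gt0.
have [C C0 CP] := sampling_functional n0 wd0 r20 r2.
exists C => // f M m fB fM m0 fm x0.
have [cf _ [T [tT sT fT]]] := fB.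
have [c1 c2] := continuous_Re_Im cf.
have M0 : 0 <= M by apply: le_trans (fM 0); exact: cabs_ge0.
pose t0 := dot x0 v.
pose H : set R := [set q | A (t0 + q / w)].
have Hd : separated_by (w * delta) H.
  move=> q q' Hq Hq' qq'.
  have ne : t0 + q / w != t0 + q' / w.
    by apply: contra qq' => /eqP/addrI/(mulIf (invr_neq0 (lt0r_neq0 w0))) ->.
  have := Ad _ _ Hq Hq' ne.
  have -> : t0 + q / w - (t0 + q' / w) = (q - q') / w by ring.
  by rewrite normrM normfV (gtr0_norm w0) ler_pdivlMr// mulrC.
have HL : rich n H.
  move=> y; have [s [us ss sP]] := rA (t0 + y / w).
  have bE z : t0 + w * (z - t0) / w = z by rewrite [w * _]mulrC mulfK ?gt_eqF//; ring.
  exists [seq w * (z - t0) | z <- s]; split.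
  - rewrite map_inj_uniq// => z z' E.
    by rewrite -(bE z) E bE.
  - by rewrite size_map.
  move=> _ /mapP[z zs ->]; have [Az z1 z2] := sP z zs; split.
  - by rewrite /H/= bE.
  - have h : y / w <= z - t0 by lra.
    by move: h; rewrite ler_pdivrMr// mulrC.
  have h : z - t0 < y / w + l by lra.
  have h2 : w * (z - t0) < w * (y / w + l) by rewrite ltr_pM2l.
  have e1 : w * (y / w + l) = y + n%:R by rewrite mulrDr wl [w * (y / w)]mulrC divfK ?gt_eqF.
  by rewrite -e1.
have [nodes nodesH NP] := CP H Hd HL.
apply/ler_addgt0Pr => e e0.
have C2 : 0 < C + 2 by lra.
pose e' := e / (C + 2); have e'0 : 0 < e' by rewrite divr_gt0.
pose ps := x0 :: [seq x0 + y *: d' | y <- nodes].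
have [s s0 sP] := mollify_approx_seq ps c1 c2 fM e'0.
have {}sP := sP s s0 (lexx _).
have strip' xi : Omega xi -> `|dot xi d' - c / w| <= rho1.
  move=> /Ostrip h; have -> : dot xi d' - c / w = (dot xi d - c) / w.
    by rewrite /d' dotC dotZl dotC; ring.
  by rewrite normrM normfV (gtr0_norm w0) /rho1 ler_pM2r ?invr_gt0.
have [N [C' C'0 ann]] := @mollified_annihilator _ f T Omega tT sT fT d' x0 (c / w) rho1 rho2 r12 strip' s s0.
have eta0 : 0 < e' / C' by rewrite divr_gt0.
have [S [B [Sn SC BC SB]]] := NP N _ eta0.
have := ann ((1, 0) :: S ++ B) (e' / C') eta0 SB.
rewrite big_cons big_cat/= mulr0 oppr0 scale0r addr0.
have -> : cis 0 = 1 :> R[i] by rewrite /cis cos0 sin0.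
rewrite mulr1 mul1r [C' * _]mulrC divfK ?gt_eqF//.
set SA := \sum_(q <- S) _; set SB' := \sum_(q <- B) _.
move=> tot.
have hA : cabs SA <= C * (m + e').
  have me : 0 <= m + e' by lra.
  apply: le_trans (@cabs_weighted_sum S (fun t => - (2 * pi * (c / w) * t))
    (fun t => mollify f s (x0 + t *: d')) (m + e') _) _; last exact: ler_wpM2r.
  move=> q qS; have qn := Sn q qS.
  have qps : x0 + q.2 *: d' \in ps.
    by rewrite inE; apply/orP; right; apply/mapP; exists q.2.
  have h1 := sP _ qps.
  have h2 : cabs (f (x0 + q.2 *: d')) <= m.
    apply: fm; have := nodesH _ qn; rewrite /H/=; congr A.
    rewrite dotDl dotZl /d' dotZl [dot d v]dotC vd mulr1; by [].
  rewrite -[mollify _ _ _](subrK (f (x0 + q.2 *: d'))).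
  by apply: le_trans (cabsD _ _) _; lra.
have hB : cabs SB' <= M / 4.
  apply: le_trans (@cabs_weighted_sum B (fun t => - (2 * pi * (c / w) * t))
    (fun t => mollify f s (x0 + t *: d')) (2 * M) _) _.
    by move=> q _; exact: mollify_le.
  have -> : M / 4 = 1 / 8 * (2 * M) by field.
  by apply: ler_wpM2r => //; rewrite mulr_ge0.
have xps : x0 \in ps by rewrite inE eqxx.
have h0 := sP _ xps.
have -> : f x0 = - (mollify f s x0 - f x0) + ((mollify f s x0 + (SA + SB')) - (SA + SB')).
  by ring.
apply: le_trans (cabsD _ _) _; rewrite cabsN.
apply: le_trans (lerD h0 (cabsB _ _)) _.
apply: le_trans (lerD (lexx _) (lerD tot (cabsD _ _))) _.
apply: le_trans (lerD (lexx _) (lerD (lexx _) (lerD hA hB))) _.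
(* The three errors add up to the given [e]. *)
have eE : e' + (e' + (C * (m + e') + M / 4)) = C * m + M / 4 + e' * (C + 2) by ring.
by rewrite eE /e' divfK// gt_eqF.
Qed.

Lemma uniformly_discrete_separated (H : set R) : uniformly_discrete H ->
  exists2 delta : R, 0 < delta & separated_by delta H.
Proof.
rewrite /uniformly_discrete; set E := ereal_inf _ => E0.
have lb (x y : R) : H x -> H y -> x != y -> (E <= (`|x - y|)%:E)%E.
  by move=> Hx Hy xy; apply: ereal_inf_lbound; exists (x, y).
move: E E0 lb => [r| |] E0 lb //.
  by exists r => [|x y Hx Hy xy]; [rewrite lte_fin in E0|rewrite -lee_fin; exact: lb].
by exists 1 => // x y Hx Hy xy; have := lb x y Hx Hy xy; rewrite leye_eq.
Qed.

Lemma enorm_eq1 v : enorm v = 1 -> dot v v = 1.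
Proof. by move=> /(congr1 (fun z : R => z ^+ 2)); rewrite /enorm sqr_sqrtr ?dot_ge0// expr1n. Qed.

(** In the plane, the vectors orthogonal to [v] form a line. *)
Lemma orthogonal_line (u v z : R * R) : dot v u = 0 -> dot z v = 0 -> dot v v = 1 ->
  dot u u != 0 -> (dot z u / dot u u) *: u = z.
Proof.
case: u v z => [u1 u2] [v1 v2] [z1 z2]; rewrite /dot/= => uv zv vv uu.
have det : z1 * u2 - z2 * u1 = 0.
  have e1 : v1 * (z1 * u2 - z2 * u1) = 0.
    have -> : v1 * (z1 * u2 - z2 * u1) = u2 * (z1 * v1 + z2 * v2) - z2 * (v1 * u1 + v2 * u2) by ring.
    by rewrite zv uv !mulr0 subrr.
  have e2 : v2 * (z1 * u2 - z2 * u1) = 0.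
    have -> : v2 * (z1 * u2 - z2 * u1) = z1 * (v1 * u1 + v2 * u2) - u1 * (z1 * v1 + z2 * v2) by ring.
    by rewrite zv uv !mulr0 subrr.
  have -> : z1 * u2 - z2 * u1 = v1 * (v1 * (z1 * u2 - z2 * u1)) + v2 * (v2 * (z1 * u2 - z2 * u1)).
    by rewrite !mulrA -mulrDl vv mul1r.
  by rewrite e1 e2 !mulr0 addr0.
apply: plane_eq; rewrite /= /GRing.scale/=; apply: (mulIf uu).
  rewrite mulrAC divfK//; have -> : z1 * (u1 * u1 + u2 * u2) =
    (z1 * u1 + z2 * u2) * u1 + u2 * (z1 * u2 - z2 * u1) by ring.
  by rewrite det mulr0 addr0.
rewrite mulrAC divfK//; have -> : z2 * (u1 * u1 + u2 * u2) =
  (z1 * u1 + z2 * u2) * u2 - u1 * (z1 * u2 - z2 * u1) by ring.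
by rewrite det mulr0 subr0.
Qed.

Lemma mem_lines_translates (l : set (R * R)) (a : int -> R) v :
  line_through_origin l -> dot v v = 1 -> (forall x, l x -> dot v x = 0) ->
  forall x, lines_translates l a v x <-> range a (dot x v).
Proof.
move=> [u u0 lE] vv lv x; split.
  move=> [k _ [y ly <-]]; exists k => //.
  by rewrite dotDl dotZl vv mulr1 dotC lv// add0r.
move=> [k _ ak]; exists k => //; exists (x - a k *: v); last by rewrite subrK.
have uv : dot v u = 0 by apply: lv; rewrite lE; exists 1; rewrite ?scale1r.
have uu : dot u u != 0 by apply: contra u0 => /eqP/dot_eq0 ->.
set z := x - _; have zv : dot z v = 0 by rewrite /z dotBl dotZl vv mulr1 ak subrr.
rewrite lE; exists (dot z u / dot u u) => //.
exact: orthogonal_line uv zv vv uu.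
Qed.

Lemma le_supnorm (P : set (R * R)) f M x : (forall y, cabs (f y) <= M) -> P x ->
  cabs (f x) <= supnorm_on P f.
Proof.
move=> fM Px; apply: sup_upper_bound; last by exists x.
by split; [exists (cabs (f x)), x|exists M => _ [y _ <-]].
Qed.

Lemma supnorm_le (P : set (R * R)) f M x : P x -> (forall y, P y -> cabs (f y) <= M) ->
  supnorm_on P f <= M.
Proof.
move=> Px fM; apply: sup_le_ub; first by exists (cabs (f x)), x.
by move=> _ [y Py <-]; exact: fM.
Qed.

End sampling.

Theorem theorem2 (R : realType) (Omega : set (R * R))
    (Omega_compact : compact Omega) (Omega_convex : convex_set Omega)
    (Omega_pos : (0 < lebesgue2 Omega)%E)
    (l : set (R * R)) (l_line : line_through_origin l)
    (v : R * R) (v_unit : enorm v = 1) (v_orth : forall x, l x -> dot v x = 0)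
    (a : int -> R) (a_ud : uniformly_discrete (range a)) :
  sampling_set Omega (lines_translates l a v) <->
  ~ difference_set Omega (fine (lower_density (range a)) *: v).
Proof.
have vv := enorm_eq1 v_unit.
have PE := mem_lines_translates a l_line vv v_orth.
have [delta d0 Hd] := uniformly_discrete_separated a_ud.
have [D [D0 DE dense thin]] := density_dichotomy d0 Hd.
have Pa : lines_translates l a v (a 0 *: v).
  by apply/PE; exists 0 => //; rewrite dotZl vv mulr1.
rewrite DE /=; split.
  move=> [K K0 KP] DO; have q12 : 1 / 4 < 1 / 2 :> R by lra.
  have [w [w0 Dw wO]] : exists w, [/\ 0 < w, D <= w & difference_set Omega (w *: v)].
    have [Dp|Dn] := ltP 0 D; first by exists D.
    have [t t0 tO] := positive_chord v Omega_compact Omega_convex Omega_pos.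
    by exists t; split => //; apply: le_trans (ltW t0).
  have k0 : 0 < (4 * K)^-1 by rewrite invr_gt0 mulr_gt0.
  have [G [B [t0 [tG G1 Gt0 Gk]]]] := small_on_critical w0 k0 (thin w Dw).
  have [p pO] := chord_of_difference Omega_convex wO.
  have w20 : 0 <= w / 2 by rewrite divr_ge0// ltW.
  have := KP _ (bernstein_trig w20 tG pO).
  set f := (fun x => _); have fE x : cabs (f x) = `|G (dot v x)|.
    by rewrite /f cabsM cabs_cis mul1r cabsR.
  have f1 x : cabs (f x) <= 1 by rewrite fE.
  have h1 : 1 / 2 <= supnorm_on setT f.
    apply: (@le_trans _ _ (cabs (f (t0 *: v)))); last exact: (@le_supnorm _ _ _ 1).
    by rewrite fE dotC dotZl vv mulr1.
  have h2 : supnorm_on (lines_translates l a v) f <= (4 * K)^-1.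
    apply: supnorm_le Pa _ => y /PE Ay; rewrite fE; apply: Gk.
    by rewrite dotC.
  move=> h3; have h4 := ler_wpM2l (ltW K0) h2.
  have e : K * (4 * K)^-1 = 1 / 4 by field; rewrite gt_eqF.
  by move: (le_trans h1 (le_trans h3 h4)); rewrite e leNgt q12.
move=> nD.
have O0 : Omega !=set0.
  by apply/set0P/eqP => O0; move: Omega_pos; rewrite O0 /lebesgue2 measure0 ltxx.
have [d [c [W [vd W0 WD strip]]]] :=
  strip_of_not_difference Omega_compact Omega_convex O0 D0 nD.
have [n [r [n0 r0 Wr rA]]] := dense W W0 WD.
have [C C0 CP] := strip_sampling vd W0 strip d0 Hd n0 r0 Wr rA.
exists (2 * C + 1); first by lra.
move=> f fB; have [_ [M fM] _] := fB.
set m := supnorm_on (lines_translates l a v) f; set S := supnorm_on setT f.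
have fm x : range a (dot x v) -> cabs (f x) <= m.
  by move=> /PE Px; exact: le_supnorm fM Px.
have fS x : cabs (f x) <= S by exact: (le_supnorm fM).
have m0 : 0 <= m by apply: le_trans (le_supnorm fM Pa); exact: cabs_ge0.
have h : S <= C * m + S / 4.
  by apply: (@supnorm_le _ _ _ _ 0) => // y _; exact: CP.
have := mulr_ge0 C0 m0.
by rewrite mulrDl mul1r -mulrA; move: (C * m) h => X; lra.
Qed.
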